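(* Let $G$ be a simple strongly even-cycle decomposable graph, let $v$ be a non-isolated vertex of $G$, and let $H$ be a simple Eulerian graph with an odd number of vertices. If $H$ is not (isomorphic to) $K_3$ or $\deg_G(v)\ge 4$, then the substitution of $v$ by $H$ in $G$ is strongly even-cycle decomposable.
   Context: All graphs are finite. An Eulerian graph is a (not necessarily connected) graph in which every vertex has even degree. A graph is even-cycle decomposable if its edge set can be partitioned into (edge sets of) cycles of even length. A subdivision of a graph is obtained by replacing each edge by a path of length at least $1$ with the same ends (so a graph is a subdivision of itself). A graph $G$ is strongly even-cycle decomposable if every subdivision of $G$ with an even number of edges is even-cycle decomposable. Equivalently, for every $\Sigma\subseteq E(G)$ with $|\Sigma|$ even, $E(G)$ can be partitioned into cycles each containing an even number of edges of $\Sigma$. For simple graphs $G$, $H$ and $v\in V(G)$, the substitution of $v$ by $H$ in $G$ is the graph obtained from the disjoint union of $G-v$ and $H$ by adding an edge $xy$ for all $x\in V(H)$ and all neighbors $y$ of $v$ in $G$. *)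

(* Defs.v *)
From mathcomp Require Import all_boot.

Set Implicit Arguments.
Unset Strict Implicit.
Unset Printing Implicit Defensive.

(* A subdivision of a simple graph is simple, so simple graphs suffice. *)
Record sgraph := SGraph {
  vert :> finType;
  adj : rel vert;
  adj_sym : symmetric adj;
  adj_irrefl : irreflexive adj }.

Definition deg (G : sgraph) (x : G) : nat := #|[set y | adj x y]|.

Definition edges (G : sgraph) : {set {set G}} :=
  [set [set x; y] | x in G, y in G & adj x y].

Definition isolated (G : sgraph) (v : G) : Prop := forall u : G, ~~ adj v u.

Definition eulerian (G : sgraph) : Prop := forall x : G, ~~ odd (deg x).

Definition isomorphic (G H : sgraph) : Prop :=
  exists2 f : G -> H, bijective f & forall x y, adj (f x) (f y) = adj x y.

Definition is_cycle (G : sgraph) (c : seq G) : bool :=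
  [&& 2 < size c, cycle (@adj G) c & uniq c].

Definition cycle_edges (G : sgraph) (c : seq G) : {set {set G}} :=
  [set [set x; next c x] | x in c].

Definition even_cycle_decomposable (G : sgraph) : Prop :=
  exists2 P : {set {set {set G}}}, partition P (edges G)
    & forall B, B \in P ->
      exists c : seq G, [/\ is_cycle c, ~~ odd (size c) & B = cycle_edges c].

(* [p x y] lists the internal vertices, in order from [f x] to [f y], of the
   path replacing the edge xy; its values at non-adjacent x, y are irrelevant.
   The last condition says that the edges of S are exactly those of the paths. *)
Definition subdivision (G S : sgraph) : Prop :=
  exists (f : G -> S) (p : G -> G -> seq S),
    injective f /\
    (forall x y, adj x y -> [/\ uniq (p x y), p y x = rev (p x y)
                              & forall z, f z \notin p x y]) /\
    (forall x y x' y' s, adj x y -> adj x' y' ->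
       s \in p x y -> s \in p x' y' -> [set x; y] = [set x'; y']) /\
    (forall s, (exists x, s = f x) \/ (exists x y, adj x y /\ s \in p x y)) /\
    (forall s t, adj s t <->
       exists x y, adj x y /\ infix [:: s; t] (f x :: rcons (p x y) (f y))).

Definition strongly_even_cycle_decomposable (G : sgraph) : Prop :=
  forall S : sgraph, subdivision G S -> ~~ odd #|edges S| ->
    even_cycle_decomposable S.

Section Complete.
Variable n : nat.

Definition complete_adj (x y : 'I_n) : bool := x != y.

Lemma complete_sym : symmetric complete_adj.
Proof. by move=> x y; rewrite /complete_adj eq_sym. Qed.

Lemma complete_irrefl : irreflexive complete_adj.
Proof. by move=> x; rewrite /complete_adj eqxx. Qed.

Definition complete : sgraph := SGraph complete_sym complete_irrefl.
End Complete.

Section Substitution.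
Variables (G : sgraph) (v : G) (H : sgraph).

Definition subst_vert : finType := ({x : G | x != v} + H)%type.

Definition subst_adj (a b : subst_vert) : bool :=
  match a, b with
  | inl x, inl y => adj (val x) (val y)
  | inr h, inr k => adj h k
  | inl x, inr _ => adj v (val x)
  | inr _, inl y => adj v (val y)
  end.

Lemma subst_sym : symmetric subst_adj.
Proof. by move=> [x|h] [y|k] //=; rewrite adj_sym. Qed.

Lemma subst_irrefl : irreflexive subst_adj.
Proof. by move=> [x|h] /=; rewrite adj_irrefl. Qed.

Definition substitution : sgraph := SGraph subst_sym subst_irrefl.
End Substitution.

(* Main.v *)
(* Replace subdivisions by signs: a sign [s] on the edges, and cycles whose sum of
   signs is even.  Give the edge [vy] of [G] the sum of the signs of all edges
   from [y] to [H], and flip it on one edge [v y0] if the total sign of [H] is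
   odd.  In the resulting even decomposition of [G], a cycle through [v] with
   neighbours [c] and [b] of [v] stands for an outer path from [c] to [b] plus
   the complete bipartite graph between [b, c] and [H].  Since [H] has odd order
   this piece is even decomposable when its sign is even: one vertex of [H]
   closes the outer path, and the others pair up into 4-cycles.  The cycle
   through [v y0] must moreover absorb [H].  After removing even cycles from [H],
   no even cycle is left, so the rest is a cactus of odd cycles.  Each of them
   receives two private vertices of [H]; a cycle whose two vertices complete
   an odd 4-cycle with [b, c] is absorbed with them, the other cycles are
   absorbed in pairs, and the last one together with the outer path.  Only
   the triangle [H = K_3] resists; it is absorbed by two cycles through [v],
   which exist as [deg v >= 4]. *)

Require Import Defs.
From mathcomp Require Import all_boot zify.

Set Implicit Arguments.
Unset Strict Implicit.
Unset Printing Implicit Defensive.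

(** * Weights along paths and cycles *)

(** An odd cycle whose two private vertices form an even 4-cycle with [b] and [c] has odd total
    sign, so it can never be absorbed alone. What matters is the parity of the number of such
    cycles, and the difficulty is the last one when that number is odd. Private vertices come in
    pairs and [H] has odd order, so an odd number of its vertices remains free. The last cycle is
    absorbed when a free vertex lies off it, when three free vertices lie on it, when two more such
    cycles release a vertex, or when another cycle touches it suitably. A single free vertex and a
    single cycle leave just three vertices, which is the exception [K_3].

    The flip on [v y0] is chosen because the odd cycles left in [H] carry the parity of its total
    sign: together with the piece of [v y0] they have even sign.

    Why finitely many gadgets suffice: cutting long cycles at marked vertices leaves a bounded
    number of arcs, of which only the sign matters. Switching signs at a vertex preserves the parity
    of every cycle and clears a spanning forest, so few sign patterns remain. *)

Section PathSums.
Variable T : Type.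
Implicit Types (F : T -> T -> nat) (x y : T) (p q c : seq T).

Fixpoint psum F x p : nat :=
  if p is y :: p' then F x y + psum F y p' else 0.

Definition csum F c : nat := if c is x :: p then psum F x (rcons p x) else 0.

Lemma psum_cat F x p q : psum F x (p ++ q) = psum F x p + psum F (last x p) q.
Proof. by elim: p x => //= y p IH x; rewrite IH addnA. Qed.

Lemma psum_rcons F x p y : psum F x (rcons p y) = psum F x p + F (last x p) y.
Proof. by rewrite -cats1 psum_cat /= addn0. Qed.

Lemma psum_rev F x p y : commutative F ->
  psum F y (rcons (rev p) x) = psum F x (rcons p y).
Proof.
move=> FC; elim: p x y => [|z p IH] x y /=; first by rewrite FC.
by rewrite rev_cons psum_rcons last_rcons IH addnC FC.
Qed.

Lemma csum_rotr1 F x p : csum F (rcons p x) = csum F (x :: p).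
Proof.
case: p => [|y p] //=.
by rewrite !psum_rcons last_rcons; lia.
Qed.

Lemma csum_cat F p q : csum F (p ++ q) = csum F (q ++ p).
Proof.
elim: p q => [|x p IH] q; first by rewrite cats0.
by rewrite -[q ++ _]cat_rcons -IH -rcons_cat csum_rotr1.
Qed.

Lemma csum_rot F n c : csum F (rot n c) = csum F c.
Proof. by rewrite /rot csum_cat cat_take_drop. Qed.

Lemma csum_rev F c : commutative F -> csum F (rev c) = csum F c.
Proof.
move=> FC; case: c => [|x p] //.
by rewrite rev_cons csum_rotr1 /= psum_rev.
Qed.

Lemma eq_psum F F' x p : F =2 F' -> psum F x p = psum F' x p.
Proof. by move=> eqF; elim: p x => //= y p IH x; rewrite eqF IH. Qed.

Lemma eq_csum F F' c : F =2 F' -> csum F c = csum F' c.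
Proof. by case: c => //= x p; apply: eq_psum. Qed.

Lemma psumD F F' x p :
  psum (fun u v => F u v + F' u v) x p = psum F x p + psum F' x p.
Proof. by elim: p x => //= y p IH x; rewrite IH; lia. Qed.

Lemma csumD F F' c :
  csum (fun u v => F u v + F' u v) c = csum F c + csum F' c.
Proof. by case: c => //= x p; apply: psumD. Qed.

Lemma psumM a F x p : psum (fun u v => a * F u v) x p = a * psum F x p.
Proof. by elim: p x => [|y p IH] x /=; rewrite ?muln0 // IH; lia. Qed.

Lemma csumM a F c : csum (fun u v => a * F u v) c = a * csum F c.
Proof. by case: c => [|x p] /=; rewrite ?muln0 // psumM. Qed.

Lemma psum_vertex (f : T -> nat) x p :
  psum (fun u v => f u + f v) x p + f x + f (last x p)
  = (\sum_(u <- x :: p) f u).*2.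
Proof.
elim: p x => [|y p IH] x /=; first by rewrite big_seq1; lia.
by rewrite big_cons; have := IH y; lia.
Qed.

(** Each vertex of a closed walk is an end of two of its steps. Modulo 2 this is invariance under
    switching; for the indicator of a vertex it counts degrees. *)
Lemma csum_vertex (f : T -> nat) c :
  csum (fun u v => f u + f v) c = (\sum_(u <- c) f u).*2.
Proof.
case: c => [|x p] /=; first by rewrite big_nil.
have := psum_vertex f x (rcons p x).
by rewrite last_rcons !big_cons -cats1 big_cat big_seq1 /=; lia.
Qed.

End PathSums.

Lemma psum_map (T T' : Type) (f : T -> T') F x p :
  psum F (f x) (map f p) = psum (fun u v => F (f u) (f v)) x p.
Proof. by elim: p x => //= y p IH x; rewrite IH. Qed.

Lemma csum_map (T T' : Type) (f : T -> T') F c :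
  csum F (map f c) = csum (fun u v => F (f u) (f v)) c.
Proof. by case: c => //= x p; rewrite -map_rcons psum_map. Qed.

Section PathSumsEq.
Variable T : eqType.
Implicit Types (F : T -> T -> nat) (x y : T) (p q c : seq T).

Lemma eq_in_psum (P : pred T) F F' x p :
  {in P &, forall u v, F u v = F' u v} -> all P (x :: p) ->
  psum F x p = psum F' x p.
Proof.
move=> eqF; elim: p x => //= y p IH x /and3P[Px Py Pp].
by rewrite eqF // IH //= Py.
Qed.

Lemma eq_in_csum (P : pred T) F F' c :
  {in P &, forall u v, F u v = F' u v} -> all P c -> csum F c = csum F' c.
Proof.
move=> eqF; case: c => //= x p /andP[Px Pp].
by apply: (eq_in_psum eqF); rewrite /= Px all_rcons Px.
Qed.

Lemma csum_rot_to c x : x \in c ->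
  exists2 p, perm_eq c (x :: p) & forall F, csum F c = csum F (x :: p).
Proof.
case/splitPr => p1 p2; exists (p2 ++ p1); last by move=> G; rewrite csum_cat.
by rewrite -cat_cons perm_catC.
Qed.

(** The indicator of the edge [u v] as a commutative weight. Testing a sum over an edge set on it
    gives the multiplicity of that edge. *)
Definition ew u v x y : nat := (x == u) && (y == v) || (x == v) && (y == u).

Lemma ewC u v : commutative (ew u v).
Proof. by move=> x y; rewrite /ew orbC andbC [(x == u) && _]andbC. Qed.

Lemma ew_sym u v x y : ew u v x y = ew v u x y.
Proof. by rewrite /ew orbC. Qed.

Lemma ew_flip u v x y : ew u v x y = ew x y u v.
Proof. by rewrite /ew ![_ == u]eq_sym ![_ == v]eq_sym [(v == x) && _]andbC. Qed.

Lemma psum_ew_notin u v x p : u \notin x :: p -> psum (ew u v) x p = 0.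
Proof.
elim: p x => //= y p IH x; rewrite !inE !negb_or => /and3P[ux uy up].
by rewrite IH ?inE ?negb_or ?uy // /ew ![_ == u]eq_sym (negPf ux) (negPf uy) andbF.
Qed.

Lemma csum_ew_notin u v c : u \notin c -> csum (ew u v) c = 0.
Proof.
case: c => //= x p up; apply: psum_ew_notin.
by rewrite -rcons_cons mem_rcons inE (negPf up) orbF; apply: contra up => /eqP->; rewrite mem_head.
Qed.

Lemma csum_ew_head u v p : 1 < size p -> uniq (u :: p) ->
  csum (ew u v) (u :: p) = ((v == head u p) || (v == last u p)).
Proof.
case: p => [|y p] //= p1; rewrite inE negb_or => /and3P[/andP[uy up] yp pU].
rewrite psum_rcons psum_ew_notin ?inE ?negb_or ?uy //.
have ul : u != last y p.
  by apply/eqP => eul; have := mem_last y p; rewrite -eul inE (negPf uy) (negPf up).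
rewrite /ew !eqxx [y == u]eq_sym (negPf uy) [_ == u]eq_sym (negPf ul) /= andbF orbF.
have : y != last y p.
  by case: p p1 yp {up pU ul} => //= z p _; apply: contra => /eqP ->; apply: mem_last.
rewrite [y == v]eq_sym [last y p == v]eq_sym.
by move=> yl; rewrite andbT add0n; case: (v =P y) => [->|_] /=; rewrite ?(negPf yl).
Qed.

(** A closed walk of length 2 runs twice along its edge, hence the bound on the size. *)
Lemma csum_ew_le1 u v c : 2 < size c -> uniq c -> csum (ew u v) c <= 1.
Proof.
move=> sc Uc; have [uc|uc] := boolP (u \in c); last by rewrite csum_ew_notin.
have [p pc ->] := csum_rot_to uc.
rewrite csum_ew_head; [by case: (_ || _) | | by rewrite -(perm_uniq pc)].
by move: (perm_size pc) sc => -> /=.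
Qed.

End PathSumsEq.

(** * Even decompositions of edge weights *)

Section Decomposition.
Variable T : eqType.
Implicit Types (s F : T -> T -> nat) (c : seq T) (g : (T -> T -> nat) -> nat).

Definition even_cycle s c := [&& 2 < size c, uniq c & ~~ odd (csum s c)].

(* An edge set is encoded by the map [g] sending a commutative weight [F] to
   its sum over the edges, so disjoint unions of edge sets are sums. *)
Definition dec s g := exists2 L : seq (seq T), all (even_cycle s) L &
  forall F, commutative F -> g F = \sum_(c <- L) csum F c.

Lemma dec0 s : dec s (fun=> 0).
Proof. by exists [::] => // F _; rewrite big_nil. Qed.

Lemma decD s g g' : dec s g -> dec s g' -> dec s (fun F => g F + g' F).
Proof.
move=> [L Le gE] [L' Le' gE']; exists (L ++ L'); first by rewrite all_cat Le Le'.
by move=> F FC; rewrite big_cat gE ?gE'.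
Qed.

Lemma dec_cycle s c : even_cycle s c -> dec s (fun F => csum F c).
Proof. by move=> ec; exists [:: c] => /= [|F _]; rewrite ?ec // big_seq1. Qed.

Lemma eq_dec s g g' :
  (forall F, commutative F -> g' F = g F) -> dec s g -> dec s g'.
Proof. by move=> gg' [L Le gE]; exists L => // F FC; rewrite gg' ?gE. Qed.

Lemma dec_sum s (I : eqType) (r : seq I) (G : I -> (T -> T -> nat) -> nat) :
  {in r, forall i, dec s (G i)} -> dec s (fun F => \sum_(i <- r) G i F).
Proof.
elim: r => [|i r IH] rP.
  by apply: eq_dec (dec0 s) => F _; rewrite big_nil.
apply: eq_dec (decD (rP i (mem_head _ _)) (IH _)) => [F _|j jr].
  by rewrite big_cons.
by apply: rP; rewrite inE jr orbT.
Qed.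

Lemma dec_even s g : commutative s -> dec s g -> ~~ odd (g s).
Proof.
move=> sC [L Le ->] //; elim: L Le => [|c L IH] /=; first by rewrite big_nil.
by case/andP=> /and3P[_ _ ce] /IH {}IH; rewrite big_cons oddD (negPf ce) (negPf IH).
Qed.

End Decomposition.

(** * Closed walks of an abstract graph realised as cycles of another one *)

Fixpoint ppairs (T : Type) (x : T) p :=
  if p is y :: p' then (x, y) :: ppairs y p' else [::].

Definition cpairs (T : Type) (c : seq T) :=
  if c is x :: p then ppairs x (rcons p x) else [::].

Lemma psum_ppairs (T : Type) F (x : T) p :
  psum F x p = \sum_(e <- ppairs x p) F e.1 e.2.
Proof. by elim: p x => [|y p IH] x /=; rewrite ?big_nil // big_cons IH. Qed.

Lemma csum_cpairs (T : Type) F (c : seq T) :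
  csum F c = \sum_(e <- cpairs c) F e.1 e.2.
Proof. by case: c => [|x p]; rewrite /= ?big_nil // psum_ppairs. Qed.

Section Realization.
Variables (T U : Type) (f : T -> U) (P : T -> T -> seq U).
Implicit Types (F : U -> U -> nat) (x y : T) (p c : seq T).

(** The weight [F] pulled back to the abstract graph, where the pair [x y] stands for a path with
    inner vertices [P x y]. Gadgets and subdivisions are both treated in this way. *)
Definition seg F x y := psum F (f x) (rcons (P x y) (f y)).

Fixpoint rpath x p := if p is y :: p' then P x y ++ f y :: rpath y p' else [::].

Definition rcycle c :=
  if c is x :: p then f x :: rpath x p ++ P (last x p) x else [::].

Lemma last_rpath x p : last (f x) (rpath x p) = f (last x p).
Proof. by elim: p x => //= y p IH x; rewrite last_cat /= IH. Qed.

Lemma psum_rpath F x p : psum F (f x) (rpath x p) = psum (seg F) x p.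
Proof.
elim: p x => //= y p IH x.
by rewrite -cat_rcons psum_cat last_rcons IH.
Qed.

Lemma csum_rcycle F c : csum F (rcycle c) = csum (seg F) c.
Proof.
case: c => //= x p.
by rewrite rcons_cat psum_cat psum_rpath last_rpath [RHS]psum_rcons.
Qed.

Lemma size_rcycle c : size c <= size (rcycle c).
Proof.
case: c => //= x p; rewrite size_cat ltnS; apply: leq_trans (leq_addr _ _).
by elim: p x => //= y p IH x; rewrite size_cat addnS ltnS (leq_trans (IH y)) ?leq_addl.
Qed.

Lemma segC F : commutative F -> (forall x y, P y x = rev (P x y)) ->
  commutative (seg F).
Proof. by move=> FC PC x y; rewrite /seg [P y x]PC psum_rev. Qed.

End Realization.

Lemma perm_rcycle (T : Type) (U : eqType) (f : T -> U) P c :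
  perm_eq (rcycle f P c) (map f c ++ flatten [seq P e.1 e.2 | e <- cpairs c]).
Proof.
case: c => //= x p; rewrite perm_cons.
suff H z y q : perm_eq (rpath f P y q ++ P (last y q) z)
    (map f q ++ flatten [seq P e.1 e.2 | e <- ppairs y (rcons q z)]) by apply: H.
elim: q y => [|u q IH] y /=; first by rewrite cats0.
apply/permP => a; have /permP /(_ a) := IH u.
by rewrite !count_cat /= !count_cat /=; lia.
Qed.

(** * Gadgets decided by computation *)

(** The flagged positions are the forest edges, whose signs are normalised to 0; the exhaustive
    search does not branch on them. *)
Fixpoint forall_bits (flags : bitseq) (k : bitseq -> bool) : bool :=
  if flags is b :: fl then
    forall_bits fl (fun v => k (false :: v)) &&
    if b then true else forall_bits fl (fun v => k (true :: v))
  else k [::].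

Lemma forall_bitsP flags k v : forall_bits flags k -> size v = size flags ->
  (forall i, nth false flags i -> nth false v i = false) -> k v.
Proof.
elim: flags k v => [|b fl IH] k [|a v] //= /andP[k0 k1] [sv] vP.
have vP' i : nth false fl i -> nth false v i = false by apply: (vP i.+1).
case: a vP => vP; last exact: (IH _ v k0).
case: b k1 vP => //= [_ /(_ 0 erefl) //|k1 _].
exact: (IH _ v k1).
Qed.

Section Template.
Variable E : seq (nat * nat).
Implicit Types (c : seq nat) (v : bitseq).

Definition orient (e : nat * nat) := if e \in E then e else (e.2, e.1).

Definition tadj i j := ((i, j) \in E) || ((j, i) \in E).

(* The spanning forest along which signs are normalised joins each vertex to
   its least neighbour, when that neighbour is smaller. *)
Definition parent m := find (tadj^~ m) (iota 0 m).

Definition in_forest (e : nat * nat) :=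
  (e.1 != e.2) && (parent (maxn e.1 e.2) == minn e.1 e.2).

Definition edge_ids c := [seq index (orient e) E | e <- cpairs c].

Definition bits_odd v (ids : seq nat) := odd (\sum_(i <- ids) nth false v i).

(** The form of [bits_odd] that can be evaluated, big operators being locked. *)
Fixpoint bits_oddb v (ids : seq nat) :=
  if ids is i :: ids' then nth false v i (+) bits_oddb v ids' else false.

Lemma bits_oddbE v ids : bits_oddb v ids = bits_odd v ids.
Proof.
rewrite /bits_odd; elim: ids => [|i ids IH] /=; first by rewrite big_nil.
by rewrite big_cons oddD IH; case: (nth _ _ _).
Qed.

(** Switching preserves the parity of the sign of an edge set with even degrees, so only such sets
    may serve as parity conditions. *)
Definition eulerian_ids (q : seq nat) :=
  let ends := flatten [seq [:: (nth (0, 0) E i).1; (nth (0, 0) E i).2] | i <- q] in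
  all (fun i => ~~ odd (count_mem i ends)) ends && all (ltn^~ (size E)) q.

(* [Q] lists edge sets on which the signs have even sum, [I] lists the pairs
   (vertices, edges) within which the realisation is known to be injective. *)
Definition template (Q : seq (seq nat)) (I : seq (seq nat * seq nat))
    (D : seq (seq (seq nat))) :=
  [&& uniq E, all (fun e => (e.2, e.1) \notin E) E,
      all eulerian_ids Q, all (fun u => uniq u.1 && uniq u.2) I,
      all (fun L => perm_eq (flatten [seq [seq orient e | e <- cpairs c] | c <- L]) E
            && all (fun c => [&& 2 < size c, uniq c, uniq (edge_ids c) &
                 has (fun u : seq nat * seq nat =>
                       all (mem u.1) c && all (mem u.2) (edge_ids c)) I]) L) D
    & let ids := [seq [seq edge_ids c | c <- L] | L <- D] in
      forall_bits (map in_forest E) (fun v =>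
        all (fun q => ~~ bits_oddb v q) Q ==>
        has (all (fun q => ~~ bits_oddb v q)) ids)].

(** A parent has a smaller number than its child, so the potential [g] can be chosen vertex by
    vertex in increasing order. *)
Lemma switching (f : nat -> nat -> nat) n : exists g : nat -> nat,
  forall m, m < n -> parent m < m -> ~~ odd (f (parent m) m + g (parent m) + g m).
Proof.
elim: n => [|n [g gP]]; first by exists (fun=> 0).
exists (fun i => if i == n then f (parent n) n + g (parent n) else g i) => m.
rewrite ltnS leq_eqVlt => /orP[/eqP-> lt|lt pm].
  by rewrite eqxx ifN; [lia | rewrite neq_ltn lt].
have /negPf-> : parent m != n by rewrite neq_ltn (ltn_trans pm lt).
by rewrite ifN; [apply: gP | rewrite neq_ltn lt].
Qed.

Lemma sum_count_even (g : nat -> nat) (r : seq nat) :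
  all (fun i => ~~ odd (count_mem i r)) r -> ~~ odd (\sum_(i <- r) g i).
Proof.
move=> rP; rewrite -big_undup_iterop_count big_seq.
elim/big_ind: _ => // [a b|i]; first by rewrite oddD => /negPf-> /negPf->.
rewrite mem_undup => /(allP rP) /negPf even_i.
by rewrite Monoid.iteropE iter_addn_0 oddM even_i andbF.
Qed.

Lemma sum_orient F (r : seq (nat * nat)) : commutative F ->
  \sum_(e <- [seq orient e | e <- r]) F e.1 e.2 = \sum_(e <- r) F e.1 e.2.
Proof.
by move=> FC; rewrite big_map; apply: eq_bigr => e _; rewrite /orient; case: ifP.
Qed.

Section Realize.
Variables (U : eqType) (x0 : U) (vs : seq U) (ps : seq (seq U)).

Definition tvert i := nth x0 vs i.

Definition tpath i j := let p e := nth [::] ps (index e E) in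
  if (i, j) \in E then p (i, j) else rev (p (j, i)).

Definition tseg F i j := seg tvert tpath F i j.

Hypotheses (E_anti : all (fun e => (e.2, e.1) \notin E) E)
  (szps : size ps = size E).

Lemma tpathC i j : tpath j i = rev (tpath i j).
Proof.
rewrite /tpath; case: ifPn => ji; case: ifPn => ij //; rewrite ?revK //.
  by have := allP E_anti _ ji; rewrite /= ij.
by rewrite !nth_default ?szps ?memNindex.
Qed.

Lemma uniq_nth_sub (W : Type) (a0 : W) (g : W -> seq U) (ws : seq W) (I J : seq nat) q :
  uniq I -> uniq J -> {subset J <= I} ->
  uniq (q ++ flatten [seq g (nth a0 ws i) | i <- I]) ->
  uniq (q ++ flatten [seq g (nth a0 ws i) | i <- J]).
Proof.
move=> UI UJ JI.
have pI : perm_eq I (J ++ [seq i <- I | i \notin J]).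
  apply: uniq_perm => // [|i].
    rewrite cat_uniq UJ filter_uniq // andbT /=.
    by apply/hasPn => i; rewrite mem_filter => /andP[].
  by rewrite mem_cat mem_filter; case: (boolP (i \in J)) => //= /JI ->.
have /perm_uniq -> : perm_eq (q ++ flatten [seq g (nth a0 ws i) | i <- I])
   ((q ++ flatten [seq g (nth a0 ws i) | i <- J]) ++
    flatten [seq g (nth a0 ws i) | i <- I & i \notin J]).
  rewrite -catA perm_cat2l -flatten_cat -map_cat.
  exact/perm_flatten/perm_map.
by rewrite cat_uniq => /and3P[].
Qed.

Lemma uniq_tcycle I J c : uniq I -> uniq J ->
  uniq (map tvert I ++ flatten [seq nth [::] ps j | j <- J]) ->
  uniq c -> uniq (edge_ids c) -> all (mem I) c -> all (mem J) (edge_ids c) ->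
  all (fun e => orient e \in E) (cpairs c) ->
  uniq (rcycle tvert tpath c).
Proof.
move=> UI UJ UIJ Uc Uid cI cJ cE; rewrite (perm_uniq (perm_rcycle _ _ _)).
have flat1 (r : seq nat) : map tvert r = flatten [seq [:: nth x0 vs i] | i <- r].
  by elim: r => //= i r ->.
suff : uniq (map tvert c ++ flatten [seq nth [::] ps j | j <- edge_ids c]).
  congr (is_true _); apply: perm_uniq; rewrite perm_cat2l -map_comp.
  elim: (cpairs c) cE => //= e r IH /andP[eE /IH {}IH].
  apply: perm_cat IH; rewrite /orient /tpath -surjective_pairing.
  by case: ifP => // _; rewrite perm_sym perm_rev.
apply: (uniq_nth_sub (g := id) UJ Uid) => [|]; first exact/allP.
rewrite (perm_uniq (permEl (perm_catC _ _))) flat1.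
apply: (uniq_nth_sub (g := fun x => [:: x]) UI Uc); first exact/allP.
by rewrite -flat1 (perm_uniq (permEl (perm_catC _ _))).
Qed.

(** The signs of the paths are switched by [g] so as to vanish on the forest. Neither the cycles nor
    the sets of [Q] change parity, so the normalised sign is one of those examined by [forall_bits],
    and a decomposition in [D] that is even for it is even for [s]. Injectivity is needed only on
    the vertices and paths of one cycle at a time, which is what [I] provides. *)
Theorem template_dec Q I D s : template Q I D -> commutative s ->
  {in I, forall u : seq nat * seq nat,
     uniq (map tvert u.1 ++ flatten [seq nth [::] ps j | j <- u.2])} ->
  {in Q, forall q, ~~ odd (\sum_(i <- q) tseg s (nth (0, 0) E i).1 (nth (0, 0) E i).2)} ->
  dec s (fun F => \sum_(e <- E) tseg F e.1 e.2).
Proof.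
case/and3P => UE _ /and4P[Qeul IU Dok Dbits] sC IP QP.
have fC F : commutative F -> commutative (tseg F).
  by move=> FC; apply: segC => // i j; apply: tpathC.
set f := tseg s; have {}sC : commutative f by apply: fC.
pose n := (\max_(e <- E) maxn e.1 e.2).+1.
have ltn_n e : e \in E -> maxn e.1 e.2 < n.
  by move=> eE; rewrite ltnS (big_rem e eE) /= leq_maxl.
have [g gP] := switching f n.
pose f' i j := f i j + (g i + g j).
pose v := [seq odd (f' e.1 e.2) | e <- E].
have vE i : i < size E -> nth false v i = odd (f' (nth (0, 0) E i).1 (nth (0, 0) E i).2).
  by move=> lti; rewrite (nth_map (0, 0)).
have sumv (ids : seq nat) : all (ltn^~ (size E)) ids ->
  bits_odd v ids =
  odd (\sum_(i <- ids) f' (nth (0, 0) E i).1 (nth (0, 0) E i).2).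
  rewrite /bits_odd; elim: ids => [|i ids IH] /=; first by rewrite !big_nil.
  case/andP=> lti /IH {}IH; by rewrite !big_cons oddD [RHS]oddD IH vE // oddb.
have tree0 i : nth false (map in_forest E) i -> nth false v i = false.
  case: (ltnP i (size E)) => [lti|]; last by move=> ?; rewrite !nth_default ?size_map.
  rewrite vE // (nth_map (0, 0)) //; set e := nth _ _ _ => /andP[e12 /eqP pe].
  have fe : f' e.1 e.2 = f' (minn e.1 e.2) (maxn e.1 e.2).
    rewrite /f'; case: (leqP e.1 e.2) => _ //.
    by rewrite sC [g e.1 + _]addnC.
  apply/negbTE; rewrite fe -pe /f' addnA; apply: gP; first by apply/ltn_n/mem_nth.
  by rewrite pe; lia.
have Q0 : all (fun q => ~~ bits_oddb v q) Q.
  apply/allP => q qQ; rewrite bits_oddbE; have /andP[qeul qE] := allP Qeul _ qQ.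
  rewrite sumv // big_split oddD (negPf (QP _ qQ)) /=.
  have -> : \sum_(i <- q) (g (nth (0, 0) E i).1 + g (nth (0, 0) E i).2) =
    \sum_(j <- flatten [seq [:: (nth (0, 0) E i).1; (nth (0, 0) E i).2] | i <- q]) g j.
    rewrite big_flatten big_map; apply: eq_bigr => i _.
    by rewrite !big_cons big_nil /= addn0.
  exact: sum_count_even.
have /implyP/(_ Q0) := forall_bitsP Dbits (etrans (size_map _ _) (esym (size_map _ _))) tree0.
rewrite has_map => /hasP[L LD /=]; rewrite all_map => /allP Leven.
have /andP[LE /allP Lok] := allP Dok _ LD.
have cE c : c \in L -> {in cpairs c, forall e, orient e \in E}.
  move=> cL e ec; rewrite -(perm_mem LE); apply/flattenP.
  by exists [seq orient e | e <- cpairs c]; [apply: map_f | apply: map_f].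
have csumE F c : commutative F -> c \in L ->
    csum F c = \sum_(i <- edge_ids c) F (nth (0, 0) E i).1 (nth (0, 0) E i).2.
  move=> FC cL; rewrite csum_cpairs -sum_orient // !big_map !big_seq.
  by apply: eq_bigr => e ec; rewrite nth_index // (cE c).
exists [seq rcycle tvert tpath c | c <- L]; last first.
  move=> F /fC FC; rewrite big_map -(perm_big _ LE) big_flatten big_map.
  by apply: eq_bigr => c _; rewrite csum_rcycle csum_cpairs sum_orient.
rewrite all_map; apply/allP => c cL /=; have /and4P[c3 Uc Uid /hasP[u uI /andP[cu idu]]] := Lok c cL.
have /andP[U1 U2] := allP IU _ uI.
apply/and3P; split; first exact: leq_trans (size_rcycle _ _ _).
  by apply: (uniq_tcycle U1 U2) => //; [apply: IP | apply/allP/cE].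
have ltE : all (ltn^~ (size E)) (edge_ids c).
  by rewrite all_map; apply/allP => e ec /=; rewrite index_mem (cE c).
have := Leven c cL; rewrite /= bits_oddbE sumv // -csumE //.
  by rewrite /f' csumD csum_vertex csum_rcycle oddD odd_double addbF.
by move=> i j; rewrite /f' sC [g i + _]addnC.
Qed.

End Realize.
End Template.

Section StandardTemplate.
Variables (U : eqType) (x0 : U) (E : seq (nat * nat)) (vs : seq U) (ps : seq (seq U)).

Definition tedge F i : nat :=
  psum F (nth x0 vs (nth (0, 0) E i).1)
    (rcons (nth [::] ps i) (nth x0 vs (nth (0, 0) E i).2)).

Lemma tsegE F i : uniq E -> i < size E ->
  tseg E x0 vs ps F (nth (0, 0) E i).1 (nth (0, 0) E i).2 = tedge F i.
Proof.
by move=> UE lti; rewrite /tseg /seg /tpath -surjective_pairing mem_nth // index_uniq.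
Qed.

Theorem template_dec_ids Q I D s : template E Q I D -> commutative s ->
  size ps = size E ->
  all (fun u : seq nat * seq nat =>
     uniq ([seq nth x0 vs i | i <- u.1] ++ flatten [seq nth [::] ps j | j <- u.2])) I ->
  all (fun q => ~~ odd (\sum_(i <- q) tedge s i)) Q ->
  dec s (fun F => \sum_(i <- iota 0 (size E)) tedge F i).
Proof.
move=> tE sC szp /allP IP /allP QP; have /and4P[UE Ea Qeul _] := tE.
apply: (eq_dec _ (template_dec Ea szp tE sC IP _)) => [F FC|q qQ].
  rewrite (big_nth (0, 0)) /index_iota subn0 !big_seq.
  by apply: eq_bigr => i; rewrite mem_iota => /andP[_ lti]; rewrite tsegE.
have /andP[_ /allP qE] := allP Qeul _ qQ.
have := QP q qQ; congr (~~ odd _); rewrite !big_seq.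
by apply: eq_bigr => i /qE lti; rewrite tsegE.
Qed.

(** The usual situation: all vertices and paths are disjoint, and the only parity condition is that
    of the whole edge set. *)
Definition std_template n D :=
  template E [:: iota 0 (size E)] [:: (iota 0 n, iota 0 (size E))] D.

Lemma std_template_dec D s : std_template (size vs) D -> commutative s ->
  size ps = size E -> uniq (vs ++ flatten ps) ->
  ~~ odd (\sum_(i <- iota 0 (size E)) tedge s i) ->
  dec s (fun F => \sum_(i <- iota 0 (size E)) tedge F i).
Proof.
move=> tE sC szp Uvp even_s; apply: (template_dec_ids tE sC szp); rewrite ?all_seq1 //=.
by rewrite -szp [map _ _]mkseq_nth [X in flatten X]mkseq_nth.
Qed.

End StandardTemplate.

(* In all gadgets but the last, vertex 0 is [b] and the largest vertex is [c]; the
   edge from [c] to 0, if any, is the outer path.  The decompositions were found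
   by a computer search: each normalised sign of even sum makes all the cycles of
   at least one of them even. *)
Definition cycle_ears_edges : seq (nat * nat) :=
  [:: (1, 2); (2, 3); (3, 1); (0, 1); (0, 2); (4, 1); (4, 2)].

Lemma cycle_ears_template : std_template cycle_ears_edges 5
  [:: [:: [:: 0; 1; 2]; [:: 1; 3; 2; 4]];
   [:: [:: 1; 2; 3]; [:: 0; 1; 4; 2]];
   [:: [:: 1; 2; 4]; [:: 0; 1; 3; 2]]].
Proof. by vm_compute. Qed.

(** Vertices 5 and 6 carry no spokes. They cut the second arc between the two spoke vertices of each
    cycle, since a template has no parallel edges. *)
Definition disjoint_cycles_edges : seq (nat * nat) :=
  [:: (1, 2); (2, 5); (5, 1); (3, 4); (4, 6); (6, 3); (0, 1); (0, 2); (0, 3);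
    (0, 4); (7, 1); (7, 2); (7, 3); (7, 4)].

Lemma disjoint_cycles_template : std_template disjoint_cycles_edges 8
  [:: [:: [:: 0; 1; 2; 7; 3; 4]; [:: 0; 2; 5; 1; 7; 4; 6; 3]];
   [:: [:: 0; 1; 2; 7; 3; 6; 4]; [:: 0; 2; 5; 1; 7; 4; 3]];
   [:: [:: 0; 1; 2; 7; 4; 3]; [:: 0; 2; 5; 1; 7; 3; 6; 4]];
   [:: [:: 0; 2; 1; 7; 3; 4]; [:: 0; 1; 5; 2; 7; 4; 6; 3]];
   [:: [:: 1; 2; 5]; [:: 3; 4; 6]; [:: 0; 1; 7; 2]; [:: 0; 3; 7; 4]]].
Proof. by vm_compute. Qed.

(** The common vertex 5 carries no spokes and is the third mark on both cycles. *)
Definition touching_cycles_edges : seq (nat * nat) :=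
  [:: (1, 2); (2, 5); (5, 1); (3, 4); (4, 5); (5, 3); (0, 1); (0, 2); (0, 3);
    (0, 4); (6, 1); (6, 2); (6, 3); (6, 4)].

Lemma touching_cycles_template : std_template touching_cycles_edges 7
  [:: [:: [:: 0; 1; 2; 5; 3; 6; 4]; [:: 0; 2; 6; 1; 5; 4; 3]];
   [:: [:: 0; 1; 2; 5; 4; 6; 3]; [:: 0; 2; 6; 1; 5; 3; 4]];
   [:: [:: 0; 1; 2; 6; 3; 5; 4]; [:: 0; 2; 5; 1; 6; 4; 3]];
   [:: [:: 0; 1; 2; 6; 4; 5; 3]; [:: 0; 2; 5; 1; 6; 3; 4]];
   [:: [:: 0; 2; 1; 5; 3; 6; 4]; [:: 0; 1; 6; 2; 5; 4; 3]];
   [:: [:: 0; 2; 1; 6; 3; 5; 4]; [:: 0; 1; 5; 2; 6; 4; 3]];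
   [:: [:: 0; 3; 5; 1; 2; 6; 4]; [:: 0; 1; 6; 3; 4; 5; 2]];
   [:: [:: 0; 1; 2; 5; 3; 4]; [:: 1; 5; 4; 6]; [:: 0; 2; 6; 3]]].
Proof. by vm_compute. Qed.

(** Here the common vertex 1 is one of the two spoke vertices of the first cycle. *)
Definition touching_cycles_at_spoke_edges : seq (nat * nat) :=
  [:: (1, 2); (2, 5); (5, 1); (3, 4); (4, 1); (1, 3); (0, 1); (0, 2); (0, 3);
    (0, 4); (6, 1); (6, 2); (6, 3); (6, 4)].

Lemma touching_cycles_at_spoke_template : std_template touching_cycles_at_spoke_edges 7
  [:: [:: [:: 0; 1; 2]; [:: 0; 3; 1; 5; 2; 6; 4]; [:: 1; 4; 3; 6]];
   [:: [:: 0; 1; 2; 6; 3]; [:: 0; 2; 5; 1; 3; 4]; [:: 1; 4; 6]];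
   [:: [:: 0; 1; 2; 6; 4; 3]; [:: 0; 2; 5; 1; 4]; [:: 1; 3; 6]];
   [:: [:: 0; 1; 2; 6; 4]; [:: 0; 2; 5; 1; 6; 3]; [:: 1; 3; 4]];
   [:: [:: 1; 2; 6; 4]; [:: 0; 2; 5; 1; 6; 3; 4]; [:: 0; 1; 3]];
   [:: [:: 1; 2; 6]; [:: 0; 2; 5; 1; 3; 6; 4]; [:: 0; 1; 4; 3]];
   [:: [:: 0; 2; 1; 3]; [:: 0; 1; 5; 2; 6; 4]; [:: 1; 4; 3; 6]];
   [:: [:: 1; 2; 6; 3; 4]; [:: 0; 2; 5; 1; 3]; [:: 0; 1; 6; 4]];
   [:: [:: 1; 2; 5]; [:: 0; 1; 6; 4; 3]; [:: 0; 2; 6; 3; 1; 4]];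
   [:: [:: 0; 1; 2]; [:: 1; 3; 4; 6; 2; 5]; [:: 0; 3; 6; 1; 4]]].
Proof. by vm_compute. Qed.

(** Each cycle uses one spoke vertex only, so that its second private vertex becomes free. *)
Definition touching_cycles_two_spokes_edges : seq (nat * nat) :=
  [:: (1, 3); (3, 4); (4, 1); (2, 3); (3, 5); (5, 2); (0, 1); (0, 2); (6, 1);
    (6, 2)].

Lemma touching_cycles_two_spokes_template : std_template touching_cycles_two_spokes_edges 7
  [:: [:: [:: 0; 1; 3; 2]; [:: 1; 4; 3; 5; 2; 6]];
   [:: [:: 0; 1; 3; 5; 2]; [:: 1; 4; 3; 2; 6]];
   [:: [:: 1; 3; 2; 6]; [:: 0; 1; 4; 3; 5; 2]];
   [:: [:: 1; 3; 4]; [:: 2; 3; 5]; [:: 0; 1; 6; 2]]].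
Proof. by vm_compute. Qed.

(** Vertex 3 lies off the cycle; vertex 4 is a mere mark on it. *)
Definition cycle_path_ear_edges : seq (nat * nat) :=
  [:: (5, 0); (1, 2); (2, 4); (4, 1); (0, 1); (0, 2); (0, 3); (5, 1); (5, 2);
    (5, 3)].

Lemma cycle_path_ear_template : std_template cycle_path_ear_edges 6
  [:: [:: [:: 0; 1; 2; 5]; [:: 0; 2; 4; 1; 5; 3]];
   [:: [:: 0; 1; 4; 2; 5]; [:: 0; 2; 1; 5; 3]];
   [:: [:: 0; 2; 1; 5]; [:: 0; 1; 4; 2; 5; 3]];
   [:: [:: 0; 3; 5]; [:: 1; 2; 4]; [:: 0; 1; 5; 2]]].
Proof. by vm_compute. Qed.

Definition triangle_two_points_edges : seq (nat * nat) :=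
  [:: (6, 0); (1, 2); (2, 3); (3, 1); (0, 1); (0, 2); (0, 3); (0, 4); (0, 5);
    (6, 1); (6, 2); (6, 3); (6, 4); (6, 5)].

Lemma triangle_two_points_template : std_template triangle_two_points_edges 7
  [:: [:: [:: 0; 1; 2; 3; 6]; [:: 0; 2; 6; 1; 3]; [:: 0; 4; 6; 5]];
   [:: [:: 0; 1; 2; 6]; [:: 0; 2; 3; 1; 6; 4]; [:: 0; 3; 6; 5]];
   [:: [:: 0; 1; 3; 2; 6]; [:: 0; 2; 1; 6; 5]; [:: 0; 3; 6; 4]];
   [:: [:: 0; 1; 3; 6]; [:: 0; 2; 1; 6; 4]; [:: 0; 3; 2; 6; 5]];
   [:: [:: 0; 1; 6]; [:: 0; 2; 1; 3; 6; 5]; [:: 0; 3; 2; 6; 4]];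
   [:: [:: 0; 3; 6]; [:: 0; 1; 2; 6; 4]; [:: 0; 2; 3; 1; 6; 5]];
   [:: [:: 0; 4; 6]; [:: 0; 1; 2; 6; 3]; [:: 0; 2; 3; 1; 6; 5]];
   [:: [:: 0; 5; 6]; [:: 0; 1; 2]; [:: 0; 3; 2; 6; 4]; [:: 1; 3; 6]];
   [:: [:: 0; 2; 1; 3; 6]; [:: 0; 3; 2; 6; 4]; [:: 0; 1; 6; 5]]].
Proof. by vm_compute. Qed.

Definition five_cycle_edges : seq (nat * nat) :=
  [:: (6, 0); (1, 2); (2, 3); (3, 4); (4, 5); (5, 1); (0, 1); (0, 2); (0, 3);
    (0, 4); (0, 5); (6, 1); (6, 2); (6, 3); (6, 4); (6, 5)].

Lemma five_cycle_template : std_template five_cycle_edges 7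
  [:: [:: [:: 0; 1; 2; 3; 4; 5; 6]; [:: 0; 2; 6; 1; 5]; [:: 0; 3; 6; 4]];
   [:: [:: 0; 1; 2; 3; 4; 6]; [:: 0; 2; 6; 1; 5; 4]; [:: 0; 3; 6; 5]];
   [:: [:: 0; 1; 2; 3; 6]; [:: 0; 2; 6; 1; 5; 4; 3]; [:: 0; 4; 6; 5]];
   [:: [:: 0; 1; 2; 6]; [:: 0; 2; 3; 4; 6; 1; 5]; [:: 0; 3; 6; 5; 4]];
   [:: [:: 0; 1; 5; 6]; [:: 0; 2; 1; 6; 3; 4]; [:: 0; 3; 2; 6; 4; 5]];
   [:: [:: 0; 1; 6]; [:: 0; 3; 6; 2; 1; 5; 4]; [:: 0; 2; 3; 4; 6; 5]];
   [:: [:: 0; 2; 6]; [:: 0; 4; 6; 3; 2; 1; 5]; [:: 0; 1; 6; 5; 4; 3]];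
   [:: [:: 0; 3; 4; 5; 6]; [:: 0; 4; 6; 3; 2; 1; 5]; [:: 0; 1; 6; 2]];
   [:: [:: 0; 5; 1; 6]; [:: 0; 1; 2; 3; 6; 4]; [:: 0; 2; 6; 5; 4; 3]];
   [:: [:: 0; 4; 6]; [:: 0; 1; 2; 3; 6; 5]; [:: 0; 2; 6; 1; 5; 4; 3]];
   [:: [:: 0; 4; 5; 6]; [:: 0; 1; 2; 6; 3]; [:: 0; 2; 3; 4; 6; 1; 5]];
   [:: [:: 0; 2; 3; 4; 5; 1; 6]; [:: 0; 1; 2; 6; 4]; [:: 0; 3; 6; 5]]].
Proof. by vm_compute. Qed.

Definition bowtie_edges : seq (nat * nat) :=
  [:: (6, 0); (1, 2); (2, 3); (3, 1); (1, 4); (4, 5); (5, 1); (0, 1); (0, 2);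
    (0, 3); (0, 4); (0, 5); (6, 1); (6, 2); (6, 3); (6, 4); (6, 5)].

Lemma bowtie_template : std_template bowtie_edges 7
  [:: [:: [:: 0; 1; 2; 3; 6]; [:: 0; 2; 6; 4; 5; 1; 3]; [:: 0; 4; 1; 6; 5]];
   [:: [:: 0; 1; 2; 6]; [:: 0; 2; 3; 1; 4; 6; 5]; [:: 0; 3; 6; 1; 5; 4]];
   [:: [:: 0; 1; 3; 6]; [:: 0; 2; 1; 4; 6; 5]; [:: 0; 3; 2; 6; 1; 5; 4]];
   [:: [:: 0; 1; 4; 5; 6]; [:: 0; 3; 6; 2; 1; 5]; [:: 0; 2; 3; 1; 6; 4]];
   [:: [:: 0; 1; 5; 6]; [:: 0; 2; 1; 3; 6; 4; 5]; [:: 0; 3; 2; 6; 1; 4]];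
   [:: [:: 0; 1; 3; 2; 6]; [:: 0; 2; 1; 4; 5; 6; 3]; [:: 0; 4; 6; 1; 5]];
   [:: [:: 0; 1; 6]; [:: 0; 2; 1; 3; 6; 5; 4]; [:: 0; 3; 2; 6; 4; 1; 5]];
   [:: [:: 0; 5; 1; 3; 2; 6]; [:: 0; 2; 1; 6; 5; 4]; [:: 0; 1; 4; 6; 3]];
   [:: [:: 0; 3; 1; 4; 6]; [:: 0; 1; 2; 6; 5]; [:: 0; 2; 3; 6; 1; 5; 4]];
   [:: [:: 0; 4; 5; 1; 2; 6]; [:: 0; 1; 6; 3; 2]; [:: 0; 3; 1; 4; 6; 5]];
   [:: [:: 0; 2; 1; 3; 6]; [:: 0; 3; 2; 6; 4; 1; 5]; [:: 0; 1; 6; 5; 4]];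
   [:: [:: 0; 1; 5; 4; 6]; [:: 0; 3; 1; 2; 6; 5]; [:: 0; 2; 3; 6; 1; 4]];
   [:: [:: 0; 1; 2; 3; 6]; [:: 0; 3; 1; 6; 4; 5]; [:: 0; 2; 6; 5; 1; 4]];
   [:: [:: 0; 4; 5; 6]; [:: 0; 2; 1; 4; 6; 3]; [:: 1; 3; 2; 6]; [:: 0; 1; 5]];
   [:: [:: 0; 1; 2; 6]; [:: 0; 2; 3; 1; 6; 4; 5]; [:: 0; 3; 6; 5; 1; 4]]].
Proof. by vm_compute. Qed.

(* Vertices 1, 2, 3 form the triangle, and the outer paths are 4--0 and 6--5.  They
   may share vertices with each other, and each may meet the ends of the other
   one, so a cycle along one of them must avoid the other one and its ends. *)
Definition two_paths_triangle_edges : seq (nat * nat) :=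
  [:: (4, 0); (6, 5); (1, 2); (2, 3); (3, 1); (0, 1); (0, 2); (0, 3); (4, 1);
    (4, 2); (4, 3); (5, 1); (5, 2); (5, 3); (6, 1); (6, 2); (6, 3)].

Lemma two_paths_triangle_template : template two_paths_triangle_edges
  [:: [:: 0; 2; 3; 4; 5; 6; 7; 8; 9; 10]; [:: 1; 11; 12; 13; 14; 15; 16]]
  [:: ([:: 0; 4; 1; 2; 3], 0 :: iota 2 15); ([:: 5; 6; 1; 2; 3], iota 1 16); (iota 0 7, iota 2 15)]
  [:: [:: [:: 0; 1; 2; 3; 4]; [:: 1; 5; 6]; [:: 0; 2; 4; 1; 3]; [:: 2; 5; 3; 6]];
   [:: [:: 0; 1; 3; 2; 4]; [:: 2; 5; 6]; [:: 0; 2; 1; 4; 3]; [:: 1; 5; 3; 6]];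
   [:: [:: 0; 2; 1; 3; 4]; [:: 3; 5; 6]; [:: 0; 1; 4; 2; 3]; [:: 1; 5; 2; 6]];
   [:: [:: 0; 2; 3; 1; 4]; [:: 1; 5; 6]; [:: 0; 1; 2; 4; 3]; [:: 2; 5; 3; 6]];
   [:: [:: 0; 3; 1; 2; 4]; [:: 2; 5; 6]; [:: 0; 1; 4; 3; 2]; [:: 1; 5; 3; 6]];
   [:: [:: 0; 1; 2; 3; 4]; [:: 3; 5; 6]; [:: 0; 2; 4; 1; 3]; [:: 1; 5; 2; 6]];
   [:: [:: 0; 3; 2; 4]; [:: 1; 5; 6]; [:: 1; 2; 5; 3]; [:: 0; 1; 4; 3; 6; 2]];
   [:: [:: 0; 1; 2; 3; 4]; [:: 2; 5; 6]; [:: 0; 2; 4; 1; 3]; [:: 1; 5; 3; 6]];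
   [:: [:: 0; 1; 3; 2; 4]; [:: 3; 5; 6]; [:: 0; 2; 1; 4; 3]; [:: 1; 5; 2; 6]];
   [:: [:: 0; 1; 4]; [:: 1; 2; 5; 6; 3]; [:: 0; 2; 3]; [:: 1; 5; 3; 4; 2; 6]];
   [:: [:: 0; 3; 2; 4]; [:: 1; 2; 6; 5; 3]; [:: 0; 1; 5; 2]; [:: 1; 4; 3; 6]];
   [:: [:: 0; 3; 2; 4]; [:: 1; 2; 5; 6; 3]; [:: 0; 1; 6; 2]; [:: 1; 4; 3; 5]];
   [:: [:: 0; 1; 4]; [:: 1; 2; 6; 5; 3]; [:: 0; 2; 3]; [:: 1; 5; 2; 4; 3; 6]];
   [:: [:: 0; 2; 1; 3; 4]; [:: 2; 5; 6]; [:: 0; 1; 4; 2; 3]; [:: 1; 5; 3; 6]];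
   [:: [:: 0; 1; 2; 4]; [:: 3; 5; 6]; [:: 1; 4; 3; 2; 5]; [:: 0; 2; 6; 1; 3]];
   [:: [:: 0; 1; 3; 4]; [:: 2; 5; 6]; [:: 0; 2; 1; 5; 3]; [:: 1; 4; 2; 3; 6]];
   [:: [:: 0; 3; 1; 2; 4]; [:: 3; 5; 6]; [:: 0; 1; 4; 3; 2]; [:: 1; 5; 2; 6]]].
Proof. by vm_compute. Qed.

(** * Gadgets inside an ambient graph *)

(** Path sums, counts and booleans become plain variables, so that [lia] sees a linear identity
    without the context. *)
Ltac nat_linear :=
  repeat match goal with
  | |- context [nat_of_bool ?e] => generalize (nat_of_bool e); move=> ?
  | |- context [count ?a ?r] => generalize (count a r); move=> ?
  | |- context [psum ?F ?x ?r] => generalize (psum F x r); move=> ?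
  end; clear; lia.

Ltac perm_count := let a := fresh "a" in
  apply/permP => a; rewrite /=; repeat rewrite !count_cat /=;
  nat_linear.

Section Arcs.
Variable T : eqType.
Implicit Types (F : T -> T -> nat) (c p : seq T) (x y z : T).

Lemma csum3 F x p1 y p2 z p3 : csum F (x :: p1 ++ y :: p2 ++ z :: p3) =
  psum F x (rcons p1 y) + psum F y (rcons p2 z) + psum F z (rcons p3 x).
Proof.
rewrite /= !rcons_cat /= -cat_rcons psum_cat last_rcons rcons_cat /=.
by rewrite -cat_rcons psum_cat last_rcons addnA.
Qed.

(** Three marks appear in the prescribed cyclic order after reversing the cycle if necessary; the
    reversal is why [F] must be commutative. *)
Lemma arcs3 c x y z : uniq c -> x \in c -> y \in c -> z \in c ->
  x != y -> x != z -> y != z ->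
  exists p1 p2 p3, perm_eq c (x :: p1 ++ y :: p2 ++ z :: p3) /\
    forall F, commutative F -> csum F c = csum F (x :: p1 ++ y :: p2 ++ z :: p3).
Proof.
move=> Uc xc yc zc xy xz yz; have [p cp csp] := csum_rot_to xc.
have zp : z \in p by move: zc; rewrite (perm_mem cp) inE eq_sym (negPf xz).
have yp : y \in p by move: yc; rewrite (perm_mem cp) inE eq_sym (negPf xy).
case/splitPr: yp zp cp csp => q1 q2.
rewrite mem_cat inE eq_sym (negPf yz) orFb.
case/orP=> [] /splitPr[p1 p2] cp csp; last by exists q1, p1, p2; split=> // F _; rewrite csp.
exists (rev q2), (rev p2), (rev p1); split=> [|F FC].
  apply: perm_trans cp _; apply/permP => a.
  by rewrite /= !count_cat /= !count_cat /= !count_rev; nat_linear.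
rewrite csp -[LHS]csum_rev // rev_cons csum_rotr1 rev_cat rev_cons rev_cat rev_cons.
by rewrite !cat_rcons.
Qed.

Lemma csum5 F x1 p1 x2 p2 x3 p3 x4 p4 x5 p5 :
  csum F (x1 :: p1 ++ x2 :: p2 ++ x3 :: p3 ++ x4 :: p4 ++ x5 :: p5) =
  psum F x1 (rcons p1 x2) + psum F x2 (rcons p2 x3) + psum F x3 (rcons p3 x4) +
  psum F x4 (rcons p4 x5) + psum F x5 (rcons p5 x1).
Proof.
rewrite /= !rcons_cat /= -cat_rcons psum_cat last_rcons.
do 3 rewrite !rcons_cat /= -cat_rcons psum_cat last_rcons.
by rewrite !addnA.
Qed.

Lemma split_marks (a : pred T) p : exists p0 (ps : seq (seq T)), size ps = count a p /\
  p = p0 ++ flatten [seq u.1 :: u.2 | u <- zip (filter a p) ps].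
Proof.
elim: p => [|x p [p0 [ps [sps pE]]]]; first by exists [::], [::].
rewrite /=; case: (a x); last by exists (x :: p0), ps; rewrite cat_cons -pE.
by exists [::], (p0 :: ps); rewrite /= sps -pE.
Qed.

(** The cyclic order of five marks cannot be prescribed, so the marks are only recovered up to
    permutation. This is enough for a gadget in which all five play the same part. *)
Lemma arcs5 c ms : uniq c -> uniq ms -> size ms = 5 -> {subset ms <= c} ->
  exists x1 x2 x3 x4 x5 p1 p2 p3 p4 p5, [/\ perm_eq ms [:: x1; x2; x3; x4; x5],
    perm_eq c (x1 :: p1 ++ x2 :: p2 ++ x3 :: p3 ++ x4 :: p4 ++ x5 :: p5) &
    forall F, csum F c = csum F (x1 :: p1 ++ x2 :: p2 ++ x3 :: p3 ++ x4 :: p4 ++ x5 :: p5)].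
Proof.
move=> Uc Ums s5 sub; have [p0 [ps [sps cE]]] := split_marks (mem ms) c.
have fP : perm_eq (filter (mem ms) c) ms.
  apply: uniq_perm; rewrite ?filter_uniq // => x; rewrite mem_filter /=.
  by case: (boolP (x \in ms)) => //= /sub.
move: sps cE; rewrite -size_filter (perm_size fP) s5.
move: fP; case: (filter _ _) => [|x1 [|x2 [|x3 [|x4 [|x5 [|? ?]]]]]] fP; try by
  move: (perm_size fP); rewrite s5.
case: ps => [|p1 [|p2 [|p3 [|p4 [|p5 [|? ?]]]]]] // _ cE.
exists x1, x2, x3, x4, x5, p1, p2, p3, p4, (p5 ++ p0); rewrite perm_sym; split=> //.
  by rewrite cE; perm_count.
move=> F; rewrite cE [LHS]csum_cat; congr (csum F _).
by do 5 rewrite /= -?catA.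
Qed.

(** In the gadgets, a third mark separates the two arcs between [x] and [y], which would otherwise
    be parallel edges. *)
Lemma third_vertex c x y : uniq c -> 2 < size c ->
  exists z, [/\ z \in c, x != z & y != z].
Proof.
move=> Uc c2; have [/hasP[z zc /norP[xz yz]]|] := boolP (has (fun z => ~~ ((x == z) || (y == z))) c).
  by exists z.
rewrite -all_predC => /allP sub.
suff /(uniq_leq_size Uc) : {subset c <= [:: x; y]} by rewrite leqNgt c2.
by move=> z /sub /=; rewrite negbK !inE ![z == _]eq_sym.
Qed.

End Arcs.

Section Gadgets.
Variables (T : eqType) (s : T -> T -> nat) (b c : T).
Hypothesis sC : commutative s.
Implicit Types (F : T -> T -> nat) (C D q X : seq T) (h k l x : T).

Definition spoke_sum F h := F b h + F c h.

Local Notation spokes := spoke_sum.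

Lemma std_gadget E (vs : seq T) ps K g : std_template E (size vs) K ->
  size ps = size E -> uniq (vs ++ flatten ps) ->
  (forall F, commutative F ->
     g F = \sum_(i <- iota 0 (size E)) tedge b E vs ps F i) ->
  ~~ odd (g s) -> dec s g.
Proof.
move=> tE szp U gE even_g; apply: (eq_dec gE).
by apply: (std_template_dec tE) => //; rewrite -gE.
Qed.

Ltac expand := rewrite /tedge /spoke_sum !big_cons big_nil /=; nat_linear.

(** In its uses [C] is odd and the spokes at [h] and [k] have different parities: the 4-cycle
    through [h] and [k] is then odd and compensates [C]. *)
Lemma dec_cycle_ears C h k : uniq (b :: c :: C) -> 2 < size C ->
  h \in C -> k \in C -> h != k ->
  ~~ odd (csum s C + (spokes s h + spokes s k)) ->
  dec s (fun F => csum F C + (spokes F h + spokes F k)).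
Proof.
move=> U C2 hC kC hk; have UC : uniq C by case/and3P: U.
have [z [zC hz kz]] := third_vertex h k UC C2.
have [p1 [p2 [p3 [pC cC]]]] := arcs3 UC hC kC zC hk hz kz.
apply: (std_gadget (vs := [:: b; h; k; z; c])
  (ps := [:: p1; p2; p3; [::]; [::]; [::]; [::]]) cycle_ears_template) => //.
  rewrite (perm_uniq (s2 := b :: c :: C)) //.
  rewrite perm_sym (perm_trans (y := b :: c :: h :: p1 ++ k :: p2 ++ z :: p3)) ?perm_cons //.
  by perm_count.
by move=> F FC; rewrite cC // csum3; expand.
Qed.

Lemma dec_disjoint_cycles C D h k h' k' :
  uniq (b :: c :: C ++ D) -> 2 < size C -> 2 < size D ->
  h \in C -> k \in C -> h != k -> h' \in D -> k' \in D -> h' != k' ->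
  ~~ odd (csum s C + csum s D + (spokes s h + spokes s k) +
          (spokes s h' + spokes s k')) ->
  dec s (fun F => csum F C + csum F D + (spokes F h + spokes F k) +
          (spokes F h' + spokes F k')).
Proof.
move=> U C2 D2 hC kC hk h'D k'D hk'.
have [UC _ UD] : [/\ uniq C, ~~ has (mem C) D & uniq D].
  by have : uniq (C ++ D) by [case/and3P: U]; rewrite cat_uniq => /and3P.
have [z [zC hz kz]] := third_vertex h k UC C2.
have [p1 [p2 [p3 [pC cC]]]] := arcs3 UC hC kC zC hk hz kz.
have [w [wD hw kw]] := third_vertex h' k' UD D2.
have [q1 [q2 [q3 [pD cD]]]] := arcs3 UD h'D k'D wD hk' hw kw.
apply: (std_gadget (vs := [:: b; h; k; h'; k'; z; w; c])
  (ps := [:: p1; p2; p3; q1; q2; q3; [::]; [::]; [::]; [::]; [::]; [::]; [::]; [::]])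
  disjoint_cycles_template) => //.
  rewrite (perm_uniq (s2 := b :: c :: C ++ D)) //.
  rewrite perm_sym (perm_trans (y := b :: c :: (h :: p1 ++ k :: p2 ++ z :: p3) ++
     (h' :: q1 ++ k' :: q2 ++ w :: q3))) ?perm_cons //; last by perm_count.
  exact: perm_cat.
by move=> F FC; rewrite cC // cD // !csum3; expand.
Qed.

Lemma uniq_touch C D q x : uniq (b :: c :: C) -> uniq (b :: c :: D) ->
  (forall y, y \in C -> y \in D -> y = x) -> perm_eq D (x :: q) ->
  uniq (b :: c :: C ++ q).
Proof.
rewrite /= !inE !negb_or => /and3P[/andP[bc bC] cC UC] /and3P[/andP[_ bD] cD UD] CD Dq.
have sub y : y \in q -> y \in D by rewrite (perm_mem Dq) inE orbC => ->.
have [xq Uq] : x \notin q /\ uniq q by apply/andP; rewrite -cons_uniq -(perm_uniq Dq).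
rewrite !mem_cat !negb_or bc bC cC (contra (sub b)) // (contra (sub c)) //=.
rewrite cat_uniq UC Uq andbT; apply/hasPn => y yq; apply/negP => yC.
by move: xq; rewrite -(CD y yC (sub y yq)) yq.
Qed.

Lemma dec_touching_cycles C D h k h' k' x :
  uniq (b :: c :: C) -> uniq (b :: c :: D) -> 2 < size C -> 2 < size D ->
  x \in C -> x \in D -> (forall y, y \in C -> y \in D -> y = x) ->
  h \in C -> k \in C -> h != k -> h' \in D -> k' \in D -> h' != k' ->
  h' != x -> k' != x ->
  ~~ odd (csum s C + csum s D + (spokes s h + spokes s k) +
          (spokes s h' + spokes s k')) ->
  dec s (fun F => csum F C + csum F D + (spokes F h + spokes F k) +
          (spokes F h' + spokes F k')).
Proof.
move=> UbC UbD C2 D2 xC xD CD hC kC hk h'D k'D hk' h'x k'x.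
(* At most one of [h] and [k] is the common vertex; it is called [h]. The two gadgets for touching
   cycles treat the cases [h = x] and [h != x]. *)
wlog kx : h k hC kC hk / k != x.
  move=> H; have [kx|] := eqVneq k x; last exact: H.
  have swap F : spokes F h + spokes F k = spokes F k + spokes F h by rewrite addnC.
  move=> even_s; apply: eq_dec (H k h kC hC _ _ _) => [F _|||]; rewrite -?swap //.
    by rewrite eq_sym.
  by rewrite -kx.
have /and3P[_ _ UC] := UbC; have /and3P[_ _ UD] := UbD.
have [q1 [q2 [q3 [pD cD]]]] := arcs3 UD h'D k'D xD hk' h'x k'x.
have U : uniq (b :: c :: C ++ (h' :: q1 ++ k' :: q2 ++ q3)).
  by apply: uniq_touch UbC UbD CD _; apply: perm_trans pD _; perm_count.
have [hx|hx] := eqVneq h x.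
  rewrite {}hx in hC hk *.
  have [z [zC xz kz]] := third_vertex x k UC C2.
  have [p1 [p2 [p3 [pC cC]]]] := arcs3 UC hC kC zC hk xz kz.
  apply: (std_gadget (vs := [:: b; x; k; h'; k'; z; c])
    (ps := [:: p1; p2; p3; q1; q2; q3; [::]; [::]; [::]; [::]; [::]; [::]; [::]; [::]])
    touching_cycles_at_spoke_template) => //.
    rewrite (perm_uniq (s2 := b :: c :: C ++ (h' :: q1 ++ k' :: q2 ++ q3))) //.
    rewrite perm_sym (perm_trans (y := b :: c :: (x :: p1 ++ k :: p2 ++ z :: p3) ++
       (h' :: q1 ++ k' :: q2 ++ q3))) ?perm_cons ?perm_cat //.
    by perm_count.
  by move=> F FC; rewrite cC // cD // !csum3; expand.
have [p1 [p2 [p3 [pC cC]]]] := arcs3 UC hC kC xC hk hx kx.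
apply: (std_gadget (vs := [:: b; h; k; h'; k'; x; c])
  (ps := [:: p1; p2; p3; q1; q2; q3; [::]; [::]; [::]; [::]; [::]; [::]; [::]; [::]])
  touching_cycles_template) => //.
  rewrite (perm_uniq (s2 := b :: c :: C ++ (h' :: q1 ++ k' :: q2 ++ q3))) //.
  rewrite perm_sym (perm_trans (y := b :: c :: (h :: p1 ++ k :: p2 ++ x :: p3) ++
     (h' :: q1 ++ k' :: q2 ++ q3))) ?perm_cons ?perm_cat //.
  by perm_count.
by move=> F FC; rewrite cC // cD // !csum3; expand.
Qed.

Lemma dec_touching_cycles_two_spokes C D h k x :
  uniq (b :: c :: C) -> uniq (b :: c :: D) -> 2 < size C -> 2 < size D ->
  x \in C -> x \in D -> (forall y, y \in C -> y \in D -> y = x) ->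
  h \in C -> k \in D -> h != x -> k != x ->
  ~~ odd (csum s C + csum s D + (spokes s h + spokes s k)) ->
  dec s (fun F => csum F C + csum F D + (spokes F h + spokes F k)).
Proof.
move=> UbC UbD C2 D2 xC xD CD hC kD hx kx.
have /and3P[_ _ UC] := UbC; have /and3P[_ _ UD] := UbD.
have [z [zC hz xz]] := third_vertex h x UC C2.
have [p1 [p2 [p3 [pC cC]]]] := arcs3 UC hC xC zC hx hz xz.
have [w [wD kw xw]] := third_vertex k x UD D2.
have [q1 [q2 [q3 [pD cD]]]] := arcs3 UD kD xD wD kx kw xw.
have U : uniq (b :: c :: C ++ (k :: q1 ++ q2 ++ w :: q3)).
  by apply: uniq_touch UbC UbD CD _; apply: perm_trans pD _; perm_count.
apply: (std_gadget (vs := [:: b; h; k; x; z; w; c])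
  (ps := [:: p1; p2; p3; q1; q2; q3; [::]; [::]; [::]; [::]])
  touching_cycles_two_spokes_template) => //.
  rewrite (perm_uniq (s2 := b :: c :: C ++ (k :: q1 ++ q2 ++ w :: q3))) //.
  rewrite perm_sym (perm_trans (y := b :: c :: (h :: p1 ++ x :: p2 ++ z :: p3) ++
     (k :: q1 ++ q2 ++ w :: q3))) ?perm_cons ?perm_cat //.
  by perm_count.
by move=> F FC; rewrite cC // cD // !csum3; expand.
Qed.

End Gadgets.

(** * Absorption by the outer path *)

Section GadgetsWithPath.
Variables (T : eqType) (s : T -> T -> nat) (b c : T) (q : seq T).
Hypothesis sC : commutative s.
Implicit Types (F : T -> T -> nat) (C D X : seq T) (h k l x : T).

Local Notation spokes := (spoke_sum b c).

Definition outer F := psum F c (rcons q b).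

Ltac expand := rewrite /tedge /outer /spoke_sum ?big_cons ?big_nil /=; nat_linear.

Lemma dec_outer_cycle_ear C h k l : uniq (b :: c :: l :: q ++ C) -> 2 < size C ->
  h \in C -> k \in C -> h != k ->
  ~~ odd (outer s + csum s C + (spokes s h + spokes s k) + spokes s l) ->
  dec s (fun F => outer F + csum F C + (spokes F h + spokes F k) + spokes F l).
Proof.
move=> U C2 hC kC hk.
have [_ _ UC] : [/\ uniq (b :: c :: l :: q), ~~ has (mem (b :: c :: l :: q)) C & uniq C].
  by apply/and3P; rewrite -cat_uniq.
have [z [zC hz kz]] := third_vertex h k UC C2.
have [p1 [p2 [p3 [pC cC]]]] := arcs3 UC hC kC zC hk hz kz.
apply: (std_gadget sC (b := b) (vs := [:: b; h; k; l; z; c])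
  (ps := [:: q; p1; p2; p3; [::]; [::]; [::]; [::]; [::]; [::]]) cycle_path_ear_template) => //.
  rewrite (perm_uniq (s2 := b :: c :: l :: q ++ C)) //.
  rewrite perm_sym (perm_trans (y := b :: c :: l :: q ++ (h :: p1 ++ k :: p2 ++ z :: p3)))
    ?perm_cons ?perm_cat2l //.
  by perm_count.
by move=> F FC; rewrite cC // csum3; expand.
Qed.

Lemma dec_outer_triangle_two_points C h k l r1 r2 :
  uniq (b :: c :: r1 :: r2 :: q ++ C) ->
  h \in C -> k \in C -> l \in C -> h != k -> h != l -> k != l ->
  ~~ odd (outer s + csum s C + (spokes s h + spokes s k + spokes s l) +
     (spokes s r1 + spokes s r2)) ->
  dec s (fun F => outer F + csum F C + (spokes F h + spokes F k + spokes F l) +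
     (spokes F r1 + spokes F r2)).
Proof.
move=> U hC kC lC hk hl kl.
have [_ _ UC] : [/\ uniq (b :: c :: r1 :: r2 :: q),
   ~~ has (mem (b :: c :: r1 :: r2 :: q)) C & uniq C].
  by apply/and3P; rewrite -cat_uniq.
have [p1 [p2 [p3 [pC cC]]]] := arcs3 UC hC kC lC hk hl kl.
apply: (std_gadget sC (b := b) (vs := [:: b; h; k; l; r1; r2; c])
  (ps := [:: q; p1; p2; p3; [::]; [::]; [::]; [::]; [::]; [::]; [::]; [::]; [::]; [::]])
  triangle_two_points_template) => //.
  rewrite (perm_uniq (s2 := b :: c :: r1 :: r2 :: q ++ C)) //.
  rewrite perm_sym (perm_trans (y := b :: c :: r1 :: r2 :: q ++ (h :: p1 ++ k :: p2 ++ l :: p3)))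
    ?perm_cons ?perm_cat2l //.
  by perm_count.
by move=> F FC; rewrite cC // csum3; expand.
Qed.

Lemma dec_outer_five_cycle C ms : uniq (b :: c :: q ++ C) ->
  uniq ms -> size ms = 5 -> {subset ms <= C} ->
  ~~ odd (outer s + csum s C + \sum_(h <- ms) spokes s h) ->
  dec s (fun F => outer F + csum F C + \sum_(h <- ms) spokes F h).
Proof.
move=> U Ums s5 sub.
have [_ _ UC] : [/\ uniq (b :: c :: q), ~~ has (mem (b :: c :: q)) C & uniq C].
  by apply/and3P; rewrite -cat_uniq.
have [x1 [x2 [x3 [x4 [x5 [p1 [p2 [p3 [p4 [p5 [pms pC cC]]]]]]]]]]] := arcs5 UC Ums s5 sub.
apply: (std_gadget sC (b := b) (vs := [:: b; x1; x2; x3; x4; x5; c])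
  (ps := [:: q; p1; p2; p3; p4; p5; [::]; [::]; [::]; [::]; [::]; [::]; [::]; [::]; [::]; [::]])
  five_cycle_template) => //.
  rewrite (perm_uniq (s2 := b :: c :: q ++ C)) //.
  rewrite perm_sym (perm_trans (y := b :: c :: q ++
    (x1 :: p1 ++ x2 :: p2 ++ x3 :: p3 ++ x4 :: p4 ++ x5 :: p5))) ?perm_cons ?perm_cat2l //.
  by perm_count.
by move=> F FC; rewrite cC // csum5 (perm_big _ pms); expand.
Qed.

Lemma dec_outer_bowtie C D x k l u w :
  uniq (b :: c :: q ++ C) -> uniq (b :: c :: q ++ D) ->
  x \in C -> x \in D -> (forall y, y \in C -> y \in D -> y = x) ->
  k \in C -> l \in C -> x != k -> x != l -> k != l ->
  u \in D -> w \in D -> x != u -> x != w -> u != w ->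
  ~~ odd (outer s + csum s C + csum s D +
      (spokes s x + spokes s k + spokes s l) + (spokes s u + spokes s w)) ->
  dec s (fun F => outer F + csum F C + csum F D +
      (spokes F x + spokes F k + spokes F l) + (spokes F u + spokes F w)).
Proof.
move=> UqC UqD xC xD CD kC lC xk xl kl uD wD xu xw uw.
have [Uq _ UC] : [/\ uniq (b :: c :: q), ~~ has (mem (b :: c :: q)) C & uniq C].
  by apply/and3P; rewrite -cat_uniq.
have [_ qD UD] : [/\ uniq (b :: c :: q), ~~ has (mem (b :: c :: q)) D & uniq D].
  by apply/and3P; rewrite -cat_uniq.
have [p1 [p2 [p3 [pC cC]]]] := arcs3 UC xC kC lC xk xl kl.
have [q1 [q2 [q3 [pD cD]]]] := arcs3 UD xD uD wD xu xw uw.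
set Q := q1 ++ u :: q2 ++ w :: q3 in pD cD.
have sub y : y \in Q -> y \in D by rewrite (perm_mem pD) inE orbC => ->.
have [xQ UQ] : x \notin Q /\ uniq Q by apply/andP; rewrite -cons_uniq -(perm_uniq pD).
have U : uniq ((b :: c :: q ++ C) ++ Q).
  rewrite cat_uniq UqC UQ andbT; apply/hasPn => y yQ; have yD := sub y yQ.
  apply/negP; rewrite /= -cat_cons -cat_cons mem_cat => /orP[yq|yC].
    by case/hasP: qD; exists y.
  by move: xQ; rewrite -(CD y yC yD) yQ.
apply: (std_gadget sC (b := b) (vs := [:: b; x; k; l; u; w; c])
  (ps := [:: q; p1; p2; p3; q1; q2; q3;
     [::]; [::]; [::]; [::]; [::]; [::]; [::]; [::]; [::]; [::]])
  bowtie_template) => //.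
  rewrite (perm_uniq (s2 := (b :: c :: q ++ C) ++ Q)) //.
  rewrite perm_sym (perm_trans (y := (b :: c :: q ++ (x :: p1 ++ k :: p2 ++ l :: p3)) ++ Q))
    ?perm_cat2r ?perm_cons ?perm_cat2l //.
  by rewrite /Q; perm_count.
by move=> F FC; rewrite cC // cD // /Q !csum3; expand.
Qed.

(** Two vertices whose spokes have the same parity form an even 4-cycle with [b] and [c]. *)
Lemma dec_spokes_parity X e : uniq (b :: c :: X) -> ~~ odd (size X) ->
  {in X, forall h, odd (spokes s h) = e} -> dec s (fun F => \sum_(h <- X) spokes F h).
Proof.
have [n] := ubnP (size X); elim: n X => // n IH [|h [|k X]] //= sX.
  by move=> *; apply: eq_dec (dec0 s) => F _; rewrite big_nil.
rewrite !inE !negb_or negbK => U eX tX.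
have {U} [[bc bh bk bX] [ch ck cX] [hk hX] kX UX] :
    [/\ [/\ b != c, b != h, b != k & b \notin X], [/\ c != h, c != k & c \notin X],
     h != k /\ h \notin X, k \notin X & uniq X].
  by case/and5P: U => /and4P[-> -> -> ->] /and3P[-> -> ->] /andP[-> ->] -> ->.
have dX : dec s (fun F => \sum_(h <- X) spokes F h).
  apply: IH => //=; first exact: ltnW.
    by rewrite inE negb_or bc bX cX.
  by move=> y yX; apply: tX; rewrite !inE yX !orbT.
have dhk : dec s (fun F => csum F [:: b; h; c; k]).
  apply: dec_cycle; rewrite /even_cycle /= !inE !negb_or bc bh bk hk ck [h == c]eq_sym ch /=.
  have := etrans (tX h (mem_head _ _)) (esym (tX k _)); rewrite !inE eqxx orbT => /(_ isT).
  by rewrite /spoke_sum [s h c]sC [s k b]sC; clear; lia.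
apply: eq_dec (decD dhk dX) => F FC; rewrite !big_cons /spoke_sum /= [F h c]FC [F k b]FC.
by rewrite addn0; clear; lia.
Qed.

Lemma odd_sum_count (f : T -> nat) X : odd (\sum_(h <- X) f h) = odd (count (odd \o f) X).
Proof.
elim: X => [|h X IH]; first by rewrite big_nil.
by rewrite big_cons /= !oddD IH oddb.
Qed.

(** The number of vertices with odd spokes is even, hence so is the number of the others; each class
    is paired up separately. *)
Lemma dec_spokes X : uniq (b :: c :: X) -> ~~ odd (size X) ->
  ~~ odd (\sum_(h <- X) spokes s h) -> dec s (fun F => \sum_(h <- X) spokes F h).
Proof.
move=> U eX; rewrite odd_sum_count => eodd.
set a := odd \o _ in eodd.
have sub (P : pred T) : uniq (b :: c :: filter P X).
  apply: subseq_uniq U; rewrite /= !eqxx; exact: filter_subseq.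
have d1 : dec s (fun F => \sum_(h <- filter a X) spokes F h).
  apply: (@dec_spokes_parity _ true) => //; first by rewrite size_filter.
  by move=> h; rewrite mem_filter => /andP[].
have d2 : dec s (fun F => \sum_(h <- filter (predC a) X) spokes F h).
  apply: (@dec_spokes_parity _ false) => //.
    by move: eX; rewrite -(count_predC a) oddD (negPf eodd) size_filter.
  by move=> h; rewrite mem_filter => /andP[/negPf].
apply: eq_dec (decD d1 d2) => F _; rewrite -big_cat; apply: perm_big.
by rewrite perm_sym; apply/permPl/perm_filterC.
Qed.

(** If every [f l] had the parity opposite to [n], so would their sum, the number of terms being
    odd, and the total would be odd. *)
Lemma outer_spoke (f : T -> nat) X n : odd (size X) ->
  ~~ odd (n + \sum_(h <- X) f h) -> exists2 l, l \in X & odd (f l) = odd n.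
Proof.
move=> oX; rewrite oddD odd_sum_count.
have [/hasP[l lX /eqP] el|] := boolP (has (fun l => odd (f l) == odd n) X); first by exists l.
rewrite -all_predC => /allP none; case: (boolP (odd n)) none => _ none.
  rewrite (eq_in_count (a2 := pred0)) ?count_pred0 // => l /none.
  by rewrite /= eqb_id => /negPf.
rewrite (eq_in_count (a2 := predT)) ?count_predT ?oX // => l /none.
by rewrite /= eqbF_neg negbK.
Qed.

(** A vertex [l] whose spokes have the parity of the outer path closes it to an even cycle; an even
    number of vertices with even total sign remains. *)
Lemma dec_outer_spokes X : uniq (b :: c :: q ++ X) -> odd (size X) ->
  ~~ odd (outer s + \sum_(h <- X) spokes s h) ->
  dec s (fun F => outer F + \sum_(h <- X) spokes F h).
Proof.
move=> U oX even_s; have [l lX tl] := outer_spoke oX even_s.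
have pX := perm_to_rem lX.
have bigX F : \sum_(h <- X) spokes F h = spokes F l + \sum_(h <- rem l X) spokes F h.
  by rewrite (perm_big _ pX) big_cons.
have U' : uniq ((c :: q ++ [:: b; l]) ++ rem l X).
  rewrite (perm_uniq (s2 := b :: c :: q ++ X)) //.
  rewrite perm_sym (perm_trans (y := b :: c :: q ++ l :: rem l X)) ?perm_cons ?perm_cat2l //.
  by perm_count.
have d1 : dec s (fun F => csum F (c :: q ++ [:: b; l])).
  apply: dec_cycle; apply/and3P; split; first by rewrite /= size_cat /= addn2.
    by move: U'; rewrite cat_uniq => /and3P[].
  move: tl even_s; rewrite bigX /outer /spoke_sum /= rcons_cat /= -cat_rcons.
  by rewrite psum_cat last_rcons /= [s l c]sC; lia.
have d2 : dec s (fun F => \sum_(h <- rem l X) spokes F h).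
  apply: dec_spokes; last 2 first.
  - by move: oX; rewrite (perm_size pX).
  - by move: even_s; rewrite bigX; lia.
  apply: subseq_uniq U; rewrite /= !eqxx.
  by apply: subseq_trans (rem_subseq _ _) (suffix_subseq _ _).
apply: eq_dec (decD d1 d2) => F FC; rewrite bigX /outer /spoke_sum /=.
rewrite rcons_cat /= -cat_rcons psum_cat last_rcons /= [F l c]FC.
by lia.
Qed.

End GadgetsWithPath.

(** * Absorption of a cactus of odd cycles *)

(** A decomposable part has even sign, so evenness passes from the whole to the rest. This spares a
    parity computation each time something is split off. *)
Lemma dec_split (T : eqType) (s : T -> T -> nat) g g1 g2 : commutative s -> dec s g2 ->
  (forall F, commutative F -> g F = g1 F + g2 F) -> ~~ odd (g s) ->
  (~~ odd (g1 s) -> dec s g1) -> dec s g.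
Proof.
move=> sC d2 gE even_g d1; apply: (eq_dec gE (decD _ d2)); apply: d1.
by move: even_g; rewrite gE // oddD (negPf (dec_even sC d2)) addbF.
Qed.

Section Core.
Variables (T : eqType) (s : T -> T -> nat) (b c : T) (q X : seq T).
Hypotheses (sC : commutative s) (bcqX : uniq (b :: c :: q ++ X)).
Implicit Types (F : T -> T -> nat) (C D L W : seq T) (h k l r u x z : T).

Local Notation spokes := (spoke_sum b c).
Local Notation outer := (outer b c q).
Local Notation spar h := (odd (spokes s h)).

Lemma uniq_sub D : uniq D -> {subset D <= X} -> uniq (b :: c :: q ++ D).
Proof.
move=> UD DX; have : uniq ((b :: c :: q) ++ X) by [].
have -> : b :: c :: q ++ D = (b :: c :: q) ++ D by [].
rewrite !cat_uniq => /and3P[-> + _]; rewrite UD andbT /= => /hasPn nX.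
by apply/hasPn => y /DX /nX.
Qed.

Lemma uniq_sub0 D : uniq D -> {subset D <= X} -> uniq (b :: c :: D).
Proof.
move=> UD DX; apply: subseq_uniq (uniq_sub UD DX); rewrite /= !eqxx.
exact: suffix_subseq.
Qed.

(** * The last odd cycle, absorbed together with the outer path *)

Section LastCycle.
Variables (C : seq T) (h k : T).
Hypotheses (UC : uniq C) (C3 : 2 < size C) (CX : {subset C <= X})
  (C_odd : odd (csum s C)) (hC : h \in C) (kC : k \in C) (hk : h != k).
Variable W : seq T.
Hypotheses (UW : uniq [:: h, k & W]) (WX : {subset W <= X}) (W_odd : odd (size W)).
Hypothesis even_s : ~~ odd (outer s + csum s C + (spokes s h + spokes s k) +
  \sum_(w <- W) spokes s w).

Let goal := dec s (fun F => outer F + csum F C + (spokes F h + spokes F k) +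
  \sum_(w <- W) spokes F w).

Lemma ends_notin : [/\ h \notin W, k \notin W & uniq W].
Proof. by move: UW; rewrite /= inE negb_or => /and3P[/andP[_ ->] -> ->]. Qed.

(** The 4-cycle through [h] and [l] is odd and absorbs [C]; the released vertex [k] takes the place
    of [l] among the free vertices. *)
Lemma last_cycle_ear l : l \in W -> l \in C -> spar l != spar h -> goal.
Proof.
move=> lW lC lh; have [hW kW U] := ends_notin; have pW := perm_to_rem lW.
have hl : h != l by apply: contraNneq hW => ->.
apply: (dec_split (g1 := fun F => outer F + \sum_(w <- k :: rem l W) spokes F w)
  sC (dec_cycle_ears sC (uniq_sub0 UC CX) C3 hC lC hl _)) => // [|F FC|even_g].
- by move: C_odd lh; clear; lia.
- by rewrite (perm_big _ pW) /= !big_cons; clear; lia.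
apply: dec_outer_spokes => //.
  apply: uniq_sub => [|y].
    by rewrite /= rem_uniq // andbT; apply: contra kW; apply: mem_rem.
  by rewrite inE => /orP[/eqP-> |/mem_rem /WX //]; apply: CX.
by move: W_odd; rewrite (perm_size pW).
Qed.

Lemma last_cycle_outside r : r \in W -> r \notin C -> goal.
Proof.
move=> rW rC; have [hW kW U] := ends_notin.
have even_n : ~~ odd ((outer s + csum s C + (spokes s h + spokes s k)) +
  \sum_(w <- W) spokes s w) by [].
have sub (P : seq T) : uniq P -> {subset P <= X} -> uniq (b :: c :: P) by apply: uniq_sub0.
(* A free vertex off [C] whose spokes have the parity of the rest of the piece completes it; the
   other free vertices, even in number and in sign, split off. *)
have ear l : l \in W -> l \notin C -> spar l = odd (outer s + csum s C + (spokes s h + spokes s k)) -> goal.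
  move=> lW lC tl; have pW := perm_to_rem lW.
  have d1 : dec s (fun F => \sum_(w <- rem l W) spokes F w).
    apply: dec_spokes => //.
    - by apply: sub => [|y /mem_rem /WX //]; apply: rem_uniq.
    - by move: W_odd; rewrite (perm_size pW).
    by move: even_n tl; rewrite (perm_big _ pW) /= big_cons; clear; lia.
  apply: (dec_split (g1 := fun F => outer F + csum F C + (spokes F h + spokes F k) + spokes F l)
     sC d1) => // [F FC|even_g].
    by rewrite (perm_big _ pW) /= big_cons; clear; lia.
  apply: dec_outer_cycle_ear => //.
  rewrite (perm_uniq (s2 := b :: c :: q ++ l :: C)).
    by apply: uniq_sub => [|y]; rewrite /= ?lC // inE => /orP[/eqP->|/CX //]; apply: WX.
  by rewrite !perm_cons; apply/permPl; apply: (perm_catCA [:: l]).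
have [l lW tl] := outer_spoke W_odd even_n.
have [lC|lC] := boolP (l \in C); last exact: ear tl.
have [lh|lh] := eqVneq (spar l) (spar h); last exact: last_cycle_ear lh.
have [tr|tr] := eqVneq (spar r) (odd (outer s + csum s C + (spokes s h + spokes s k))).
  exact: ear tr.
have rl : r != l by apply: contraNneq rC => ->.
have rW' : r \in rem l W by rewrite mem_rem_uniq // inE rl.
have pW : perm_eq W (l :: r :: rem r (rem l W)).
  by rewrite (perm_trans (perm_to_rem lW)) // perm_cons perm_to_rem.
set W2 := rem r (rem l W) in pW.
(* From here on [l] lies on [C] and agrees with [h] in parity, while [r] lies off [C] and does not.
   A second vertex [r2] with the parity of [r] either lies on [C], where it differs from [h] and
   gives [last_cycle_ear], or lies off [C], and then [r] and [r2] are the two outside points of the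
   gadget. *)
have even2 : ~~ odd (spokes s r + \sum_(w <- W2) spokes s w).
  by move: even_n tl; rewrite (perm_big _ pW) /= !big_cons; clear; lia.
have odd2 : odd (size W2) by move: W_odd; rewrite (perm_size pW) /= negbK.
have [r2 r2W tr2] := outer_spoke odd2 even2.
have r2W' : r2 \in W by rewrite (perm_mem pW) !inE r2W !orbT.
have [r2C|r2C] := boolP (r2 \in C).
  by apply: last_cycle_ear r2C _ => //; rewrite tr2 -lh tl.
have pW2 := perm_to_rem r2W; set W3 := rem r2 W2 in pW2.
have U3 : uniq (l :: r :: r2 :: W3).
  by rewrite -(perm_uniq (_ : perm_eq W _)) // (perm_trans pW) // !perm_cons.
have sub3 : {subset W3 <= X}.
  by move=> y yW; apply: WX; rewrite (perm_mem pW) !inE (mem_rem yW) !orbT.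
have d3 : dec s (fun F => \sum_(w <- W3) spokes F w).
  apply: dec_spokes => //.
  - by apply: sub => //; case/and4P: U3.
  - by move: odd2; rewrite (perm_size pW2).
  by move: even2 tr2; rewrite (perm_big _ pW2) /= big_cons; clear; lia.
apply: (dec_split (g1 := fun F => outer F + csum F C +
   (spokes F h + spokes F k + spokes F l) + (spokes F r + spokes F r2)) sC d3) => // [F FC|even_g].
  by rewrite (perm_big _ pW) /= !big_cons (perm_big _ pW2) /= big_cons; clear; lia.
apply: dec_outer_triangle_two_points => //.
- rewrite (perm_uniq (s2 := b :: c :: q ++ r :: r2 :: C)).
    apply: uniq_sub => [|y]; last first.
      by rewrite !inE => /or3P[/eqP->|/eqP->|/CX //]; apply: WX.
    have : r != r2 by case/and3P: U3 => _; rewrite inE negb_or => /andP[].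
    by rewrite /= inE negb_or r2C rC UC => ->.
  by rewrite !perm_cons; apply/permPl; apply: (perm_catCA [:: r; r2]).
- by apply: contraNneq hW => ->.
by apply: contraNneq kW => ->.
Qed.

(** Unless [last_cycle_ear] applies, all free vertices have the parity of [h]. Three of them
    together with [h] and [k] give five marks on [C], and the others pair up into even 4-cycles. *)
Lemma last_cycle_inside : {subset W <= C} -> 2 < size W -> goal.
Proof.
move=> WC; have [hW kW U] := ends_notin.
have [/hasP[l lW lh] _|] := boolP (has (fun l => spar l != spar h) W).
  by apply: last_cycle_ear lh => //; apply: WC.
rewrite -all_predC => /allP tW.
move: UW WC W_odd even_s tW; rewrite /goal.
case: W => [|l1 [|l2 [|l3 W']]] //= U' WC oW even_W tW _.
have d1 : dec s (fun F => \sum_(w <- W') spokes F w).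
  apply: (@dec_spokes_parity _ _ _ _ sC _ (spar h)).
  - apply: uniq_sub0 => [|y yW].
      by move: U'; rewrite -[_ && _]/(uniq ([:: h; k; l1; l2; l3] ++ W')) cat_uniq => /and3P[].
    by apply: CX; apply: WC; rewrite !inE yW !orbT.
  - by move: oW; rewrite !negbK.
  by move=> y yW; have := tW y; rewrite !inE yW !orbT negbK => /(_ isT) /eqP.
apply: (dec_split (g1 := fun F => outer F + csum F C +
   \sum_(w <- [:: h; k; l1; l2; l3]) spokes F w) sC d1) => // [F FC|even_g].
  by rewrite !big_cons big_nil /=; clear; lia.
apply: dec_outer_five_cycle => //; first exact: uniq_sub.
  by move: U'; rewrite -[_ && _]/(uniq ([:: h; k; l1; l2; l3] ++ W')) cat_uniq => /and3P[].
move=> y; rewrite !inE => /or4P[/eqP->//|/eqP->//|yl|yl]; apply: WC; rewrite !inE.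
  by rewrite yl.
by case/orP: yl => ->; rewrite !orbT.
Qed.

End LastCycle.
(** An odd cycle of the cactus, preceded by its two private vertices. *)
Definition item := (T * T * seq T)%type.
Implicit Types (i j : item) (M N I : seq item).

Definition item_ok i := [&& i.1.1 \in i.2, i.1.2 \in i.2, i.1.1 != i.1.2, 2 < size i.2,
  uniq i.2, all (mem X) i.2 & odd (csum s i.2)].

(* [j] comes before [i] in the cactus. *)
Definition attached i j := [&& count (mem j.2) i.2 <= 1, i.1.1 \notin j.2 & i.1.2 \notin j.2].

Definition reps I := flatten [seq [:: i.1.1; i.1.2] | i <- I].

Definition item_sum F i := csum F i.2 + (spokes F i.1.1 + spokes F i.1.2).

(** The 4-cycle through the two private vertices is then even and cannot compensate the odd
    cycle. *)
Definition mono i := spar i.1.1 == spar i.1.2.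

Lemma sum_reps F I : \sum_(h <- reps I) spokes F h + \sum_(i <- I) csum F i.2 =
  \sum_(i <- I) item_sum F i.
Proof.
rewrite big_flatten big_map -big_split /=; apply: eq_bigr => i _.
by rewrite /item_sum !big_cons big_nil; clear; lia.
Qed.

Lemma attached_meet i j : uniq i.2 -> attached i j ->
  forall x y, x \in i.2 -> x \in j.2 -> y \in i.2 -> y \in j.2 -> y = x.
Proof.
move=> Ui /and3P[le1 _ _] x y xi xj yi yj; apply/eqP; apply: contraLR le1 => yx.
rewrite -ltnNge -size_filter; apply: (@uniq_leq_size _ [:: x; y]).
  by rewrite /= inE eq_sym yx.
by move=> z; rewrite !inE mem_filter => /orP[] /eqP-> /=; rewrite ?xi ?yi ?xj ?yj.
Qed.

Lemma item_uniq i : item_ok i -> uniq (b :: c :: i.2).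
Proof. by case/and5P=> _ _ _ _ /and3P[Ui /allP iX _]; apply: uniq_sub0. Qed.

Lemma dec_item i : item_ok i -> ~~ mono i -> dec s (fun F => item_sum F i).
Proof.
move=> ok; have U := item_uniq ok; case/and5P: ok => ai bi ab i3 /and3P[Ui iX io] mi.
apply: (dec_cycle_ears sC U i3 ai bi ab); move: io mi; rewrite /mono.
by clear; lia.
Qed.

Lemma dec_items N : all item_ok N -> all (predC mono) N ->
  dec s (fun F => \sum_(i <- N) item_sum F i).
Proof.
move=> /allP ok /allP nm; apply: (dec_sum (G := fun i F => item_sum F i)) => i iN.
by apply: dec_item; [apply: ok | apply: nm].
Qed.

(** Each of the two totals is odd, so only their union can be decomposed. The cycles are disjoint or
    touch in one vertex, which is not private to the later cycle [i]. *)
Lemma dec_mono_pair i j : item_ok i -> item_ok j -> mono i -> mono j -> attached i j ->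
  dec s (fun F => item_sum F i + item_sum F j).
Proof.
move=> oki okj mi mj ij; have Ubi := item_uniq oki; have Ubj := item_uniq okj.
case/and5P: oki => ai bi abi i3 /and3P[Ui /allP iX io].
case/and5P: okj => aj bj abj j3 /and3P[Uj /allP jX jo].
have even_ij : ~~ odd (csum s j.2 + csum s i.2 + (spokes s j.1.1 + spokes s j.1.2) +
   (spokes s i.1.1 + spokes s i.1.2)).
  by move: mi mj io jo; rewrite /mono; clear; lia.
suff : dec s (fun F => csum F j.2 + csum F i.2 + (spokes F j.1.1 + spokes F j.1.2) +
   (spokes F i.1.1 + spokes F i.1.2)).
  by apply: eq_dec => F _; rewrite /item_sum; clear; lia.
have [/hasP[x xi xj]|dij] := boolP (has (mem j.2) i.2).
  have meet := attached_meet Ui ij; case/and3P: ij => _ aij bij.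
  apply: (dec_touching_cycles sC Ubj Ubi j3 i3 xj xi) => //.
  - by move=> y yj yi; apply: meet.
  - by apply: contraNneq aij => ->.
  by apply: contraNneq bij => ->.
apply: dec_disjoint_cycles => //; apply: uniq_sub0; first by rewrite cat_uniq Uj Ui dij.
by move=> y; rewrite mem_cat => /orP[/jX|/iX].
Qed.

Lemma dec_mono_items M : all item_ok M -> all mono M -> pairwise attached M ->
  ~~ odd (size M) -> dec s (fun F => \sum_(i <- M) item_sum F i).
Proof.
have [n] := ubnP (size M); elim: n M => // n IH [|i [|j M]] //= sM.
  by move=> *; apply: eq_dec (dec0 s) => F _; rewrite big_nil.
case/and3P=> oki okj okM /and3P[mi mj mM] /andP[/andP[ij _] /andP[_ aM]].
rewrite negbK => eM.
apply: eq_dec (decD (dec_mono_pair oki okj mi mj ij) (IH M _ okM mM aM eM)) => [F _|].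
  by rewrite !big_cons addnA.
exact: ltnW.
Qed.

(* Three cycles of the cactus through [r]: two of them are absorbed together,
   which frees a vertex outside the third one. *)
Lemma dec_three_cycles i j (m : item) r W : item_ok i -> item_ok j -> item_ok m ->
  mono i -> mono j -> mono m -> spar i.1.1 = spar j.1.1 ->
  uniq (reps [:: i; j; m] ++ W) -> {subset W <= X} -> odd (size W) -> r \in W ->
  r \in i.2 -> r \in j.2 -> r \in m.2 ->
  (forall y, y \in i.2 -> y \in j.2 -> y = r) ->
  (forall y, y \in i.2 -> y \in m.2 -> y = r) ->
  ~~ odd (outer s + item_sum s i + item_sum s j + item_sum s m + \sum_(w <- W) spokes s w) ->
  dec s (fun F => outer F + item_sum F i + item_sum F j + item_sum F m +
     \sum_(w <- W) spokes F w).
Proof.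
move=> oki okj okk mi mj mk eij U WX oW rW ri rj rk mij mik even_s.
have Ubi := item_uniq oki; have Ubj := item_uniq okj; have Ubk := item_uniq okk.
case/and5P: oki => ai bi abi i3 /and3P[Ui /allP iX io].
case/and5P: okj => aj bj abj j3 /and3P[Uj /allP jX jo].
case/and5P: okk => ak bk abk k3 /and3P[Uk /allP kX ko].
have notr x : x \in reps [:: i; j; m] -> x != r.
  move: U; rewrite cat_uniq => /and3P[_ /hasPn nW _] xr.
  by apply: contraTneq xr => ->; apply: nW.
have d1 : dec s (fun F => csum F i.2 + csum F j.2 + (spokes F i.1.1 + spokes F j.1.1)).
  apply: (dec_touching_cycles_two_spokes sC Ubi Ubj i3 j3 ri rj) => //.
  - by apply: notr; rewrite inE eqxx.
  - by apply: notr; rewrite !inE eqxx !orbT.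
  by move: eij io jo; clear; lia.
(* The cycles [i] and [j] are absorbed with one private vertex each, so [i.1.2] and [j.1.2] become
   free. Since [i] and [m] meet only in [r], the vertex [i.1.2] lies off [m], as
   [last_cycle_outside] requires. *)
apply: (dec_split (g1 := fun F => outer F + csum F m.2 + (spokes F m.1.1 + spokes F m.1.2) +
  \sum_(w <- i.1.2 :: j.1.2 :: W) spokes F w) sC d1) => // [F FC|even_g].
  by rewrite !big_cons /item_sum; clear; lia.
apply: (last_cycle_outside _ _ _ ko) => //.
- have : uniq ([:: i.1.1; j.1.1] ++ [:: m.1.1, m.1.2, i.1.2, j.1.2 & W]).
    by rewrite -(perm_uniq (_ : perm_eq (reps [:: i; j; m] ++ W) _)) //; perm_count.
  by rewrite cat_uniq => /and3P[].
- by move=> y; rewrite !inE => /or3P[/eqP->|/eqP->|/WX //]; [apply: iX | apply: jX].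
- by rewrite /= negbK.
- exact: mem_head.
apply/negP => bik; have := notr i.1.2; rewrite !inE eqxx orbT => /(_ isT).
by rewrite (mik _ bi bik) eqxx.
Qed.

(** The five spoke vertices are [l] and the private vertices of both cycles. The common vertex [z]
    is one of the three on [i], and the cases differ only in which one plays the centre of the
    bowtie. *)
Lemma dec_last_bowtie i j l z : item_ok i -> item_ok j -> uniq [:: l; i.1.1; i.1.2] ->
  l \in i.2 -> (forall y, y \in i.2 -> y \in j.2 -> y = z) ->
  z \in j.2 -> j.1.1 != z -> j.1.2 != z -> z \in [:: l; i.1.1; i.1.2] ->
  ~~ odd (outer s + item_sum s i + item_sum s j + spokes s l) ->
  dec s (fun F => outer F + item_sum F i + item_sum F j + spokes F l).
Proof.
move=> oki okj U li meet zj az bz z3.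
case/and5P: oki => ai bi abi i3 /and3P[Ui /allP iX io].
case/and5P: okj => aj bj abj j3 /and3P[Uj /allP jX jo].
move: U; rewrite /= !inE negb_or andbT => /andP[/andP[la lb] _].
have Uqi := uniq_sub Ui iX; have Uqj := uniq_sub Uj jX.
have bowtie x1 x2 x3 : x1 \in i.2 -> x2 \in i.2 -> x3 \in i.2 ->
    x1 != x2 -> x1 != x3 -> x2 != x3 -> z = x1 ->
    (forall F, outer F + item_sum F i + item_sum F j + spokes F l =
      outer F + csum F i.2 + csum F j.2 + (spokes F x1 + spokes F x2 + spokes F x3) +
      (spokes F j.1.1 + spokes F j.1.2)) ->
    ~~ odd (outer s + item_sum s i + item_sum s j + spokes s l) ->
    dec s (fun F => outer F + item_sum F i + item_sum F j + spokes F l).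
  move=> i1 i2 i3' n12 n13 n23 z1 E even_s; rewrite {}z1 in meet zj az bz.
  apply: eq_dec (fun F _ => E F) _; apply: dec_outer_bowtie => //.
  - by rewrite eq_sym.
  - by rewrite eq_sym.
  by rewrite -E.
move: z3; rewrite !inE => /or3P[] /eqP zE.
- by apply: (bowtie _ _ _ li ai bi) => // F; rewrite /item_sum; clear; lia.
- by apply: (bowtie _ _ _ ai li bi); rewrite // 1?eq_sym // => F; rewrite /item_sum; clear; lia.
- apply: (bowtie _ _ _ bi li ai); rewrite // 1?eq_sym // => F.
  by rewrite /item_sum; clear; lia.
Qed.

Lemma pairwise_in I i j : pairwise attached I -> i \in I -> j \in I -> i != j ->
  attached i j || attached j i.
Proof.
elim: I => //= m I IH /andP[/allP mI pI]; rewrite !inE => /predU1P[->|iI] /predU1P[->|jI].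
- by rewrite eqxx.
- by rewrite mI.
- by rewrite mI ?orbT.
exact: IH.
Qed.

Lemma size_reps I : size (reps I) = (size I).*2.
Proof. by rewrite /reps; elim: I => //= i I /= ->. Qed.

(** The size of [X] is that of the set [W] of free vertices plus two for each cycle. With more than
    three vertices, a single free vertex therefore forces a second cycle, which can help to absorb
    the last one. *)
Theorem dec_core I : odd (size X) -> all item_ok I -> pairwise attached I -> uniq (reps I) ->
  (3 < size X) || (I == [::]) ->
  ~~ odd (outer s + \sum_(h <- X) spokes s h + \sum_(i <- I) csum s i.2) ->
  dec s (fun F => outer F + \sum_(h <- X) spokes F h + \sum_(i <- I) csum F i.2).
Proof.
move=> oX okI aI UI size_X even_s.
have UX : uniq X.
  have : uniq ((b :: c :: q) ++ X) by [].
  by rewrite cat_uniq => /and3P[].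
have okP i : i \in I -> item_ok i by apply: (allP okI).
have repsX : {subset reps I <= X}.
  move=> y /flatten_mapP[i /okP /and5P[ai bi _ _ /and3P[_ /allP iX _]]].
  by rewrite !inE => /orP[] /eqP ->; apply: iX.
pose W := [seq y <- X | y \notin reps I].
have pX : perm_eq X (W ++ reps I).
  apply: uniq_perm => // [|y].
    rewrite cat_uniq filter_uniq // UI andbT; apply/hasPn => y yI.
    by rewrite /= mem_filter yI.
  by rewrite mem_cat mem_filter; case: (boolP (y \in reps I)) => //= [/repsX|]; rewrite ?orbF.
have WX : {subset W <= X} by move=> y; rewrite mem_filter => /andP[].
have UWI : uniq (W ++ reps I) by rewrite -(perm_uniq pX).
have UW : uniq W by move: UWI; rewrite cat_uniq => /and3P[].
have oW : odd (size W) by move: oX; rewrite (perm_size pX) size_cat size_reps oddD odd_double addbF.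
clearbody W.
have totE F : outer F + \sum_(h <- X) spokes F h + \sum_(i <- I) csum F i.2 =
    outer F + \sum_(w <- W) spokes F w + \sum_(i <- I) item_sum F i.
  by rewrite (perm_big _ pX) big_cat -sum_reps /=; clear; lia.
pose M := filter mono I; pose N := filter (predC mono) I.
have pI : perm_eq I (M ++ N) by rewrite perm_sym; apply/permPl/perm_filterC.
have mM : all mono M by apply: filter_all.
have nN : all (predC mono) N by apply: filter_all.
have okM : all item_ok M by apply/allP => i; rewrite mem_filter => /andP[_ /okP].
have okN : all item_ok N by apply/allP => i; rewrite mem_filter => /andP[_ /okP].
have aM : pairwise attached M by apply: subseq_pairwise aI; apply: filter_subseq.
have sumI F : \sum_(i <- I) item_sum F i = \sum_(i <- M) item_sum F i + \sum_(i <- N) item_sum F i.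
  by rewrite (perm_big _ pI) big_cat.
have URI : uniq (reps (M ++ N) ++ W).
  rewrite (perm_uniq (permEl (perm_catC _ _))) (perm_uniq (s2 := W ++ reps I)) // perm_cat2l.
  by apply: perm_flatten; apply: perm_map; rewrite perm_sym.
have UiW i : i \in M -> uniq [:: i.1.1, i.1.2 & W].
  move=> /perm_to_rem iM.
  have : uniq (reps (i :: rem i M ++ N) ++ W).
    rewrite (perm_uniq (s2 := reps (M ++ N) ++ W)) // perm_cat2r.
    by apply: perm_flatten; apply: perm_map; rewrite -cat_cons perm_cat2r perm_sym.
  have -> : reps (i :: rem i M ++ N) = [:: i.1.1; i.1.2] ++ reps (rem i M ++ N) by [].
  rewrite -catA (perm_uniq (s2 := [:: i.1.1, i.1.2 & W] ++ reps (rem i M ++ N))).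
    by rewrite cat_uniq => /and3P[].
  by rewrite -[[:: _, _ & W]]/([:: _; _] ++ W) -catA perm_cat2l perm_catC.
(* Either all cycles that are not [mono] are split off, or one of them, [j], is kept to help the
   last [mono] cycle. *)
suff [mainM|[j jN mainM]] :
  (~~ odd (outer s + \sum_(w <- W) spokes s w + \sum_(i <- M) item_sum s i) ->
   dec s (fun F => outer F + \sum_(w <- W) spokes F w + \sum_(i <- M) item_sum F i)) \/
  (exists2 j, j \in N &
   ~~ odd (outer s + \sum_(w <- W) spokes s w + \sum_(i <- M) item_sum s i + item_sum s j) ->
   dec s (fun F => outer F + \sum_(w <- W) spokes F w + \sum_(i <- M) item_sum F i + item_sum F j)).
- apply: (dec_split sC (dec_items okN nN) _ even_s mainM) => F _.
  by rewrite totE sumI; clear; lia.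
- have jN' := perm_to_rem jN.
  have sub : {subset rem j N <= N} by move=> y /mem_rem.
  apply: (dec_split sC (dec_items (N := rem j N) _ _) _ even_s mainM) => [||F _].
  + by apply/allP => y /sub /(allP okN).
  + by apply/allP => y /sub /(allP nN).
  by rewrite totE sumI (perm_big _ jN') /= big_cons !addnA.
have [oM|eM] := boolP (odd (size M)); last first.
  left=> even_M; apply: (dec_split sC (dec_mono_items okM mM aM eM) _ even_M _) => [F _|even_W] //.
  by apply: dec_outer_spokes => //; apply: uniq_sub.
have lastM i g : i \in M -> ~~ odd (outer s + \sum_(w <- W) spokes s w + \sum_(i <- M) item_sum s i) ->
  (forall F, g F = outer F + csum F i.2 + (spokes F i.1.1 + spokes F i.1.2) + \sum_(w <- W) spokes F w) ->
  (~~ odd (g s) -> dec s g) ->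
  dec s (fun F => outer F + \sum_(w <- W) spokes F w + \sum_(i <- M) item_sum F i).
  move=> iM even_M gE dg; have iM' := perm_to_rem iM.
  have sub : {subset rem i M <= M} by move=> y /mem_rem.
  apply: (dec_split sC (dec_mono_items (M := rem i M) _ _ _ _) _ even_M dg).
  - by apply/allP => y /sub /(allP okM).
  - by apply/allP => y /sub /(allP mM).
  - by apply: subseq_pairwise aM; apply: rem_subseq.
  - by move: oM; rewrite (perm_size iM').
  move=> F _; rewrite gE (perm_big _ iM') /= big_cons /item_sum.
  by set S := (X in _ + (_ + X) = _); rewrite -[X in _ = _ + X]/S; clearbody S; clear; lia.
(* Any [mono] cycle may be chosen as the last one, so one that misses a free vertex is preferred.
   Otherwise every free vertex lies on all [mono] cycles. *)
have [/hasP[i iM /allPn[r rW ri]]|] := boolP (has (fun i => ~~ all (mem i.2) W) M).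
  left=> even_M; apply: (lastM i _ iM even_M (fun F => erefl)) => even_i.
  case/and5P: (allP okM i iM) => ai bi abi i3 /and3P[Ui /allP iX io].
  by apply: (last_cycle_outside _ _ _ io) rW ri => //; apply: UiW.
rewrite -all_predC => /allP WM.
have {}WM i : i \in M -> {subset W <= i.2} by move=> /WM /=; rewrite negbK => /allP.
case ME: M oM => [|i [|j [|m M']]] //.
  move=> _; have iM : i \in M by rewrite ME mem_head.
  have oki := allP okM i iM; have Wi := WM i iM; have Ui := UiW i iM.
  case/and5P: (oki) => ai bi abi i3 /and3P[Uci /allP iX io].
  have [W3|] := boolP (2 < size W).
    left; rewrite -ME => even_M; apply: (lastM i _ iM even_M (fun F => erefl)) => even_i.
    exact: (last_cycle_inside Uci i3 iX io ai bi Ui WX oW even_i Wi W3).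
  case: W oW WX Wi Ui pX {UWI UW totE URI UiW lastM WM} => [|l [|? []]] //= _ WX Wi Ui pX _.
  right; have iI : i \in I by move: iM; rewrite mem_filter => /andP[].
  have [j [z [jN zj [az bz z3]]]] : exists j z, [/\ j \in N, z \in j.2 &
      [/\ j.1.1 != z, j.1.2 != z & z \in [:: l; i.1.1; i.1.2]]].
    (* The third vertex [z] of [j] is [l] or private to a cycle of [J]: the cycles in [I1] are
       attached to [j], so their private vertices lie off it. *)
    have third j I1 J : I = I1 ++ j :: J -> exists z, [/\ z \in j.2,
        j.1.1 != z, j.1.2 != z & (z == l) || (z \in reps J)].
      move=> IE; have jI : j \in I by rewrite IE mem_cat mem_head orbT.
      case/and5P: (okP j jI) => aj bj abj j3 /and3P[Uj /allP jX jo].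
      have [z [zj az bz]] := third_vertex j.1.1 j.1.2 Uj j3.
      exists z; split=> //; have : z \in X by apply: jX.
      rewrite (perm_mem pX) inE; case: (z == l) => //=.
      rewrite IE /reps map_cat flatten_cat mem_cat /= !inE.
      rewrite ![z == _]eq_sym (negPf az) (negPf bz) /= => /orP[|//].
      case/flatten_mapP => m mI1; rewrite !inE.
      move: aI; rewrite IE pairwise_cat /= => /and3P[/allrelP H _ _].
      have /and3P[_ nma nmb] := H m j mI1 (mem_head _ _).
      by case/orP=> /eqP zE; move: zj; rewrite zE (negPf nma, negPf nmb).
    have I2 : 1 < size I.
      have : 0 < size I by case: (I) iI.
      move: size_X; rewrite (perm_size pX) /= size_reps -size_eq0.
      by case: (size I) => [|[|n]].
    (* [B] and [D] are the two oldest cycles of the cactus. The third vertex of [B] can only be [l].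
       If [B] is not [mono] it serves as [j]; otherwise [B] is [i], the third vertex of [D] is [l]
       or private to [i], and [D] serves, as no second cycle is [mono]. *)
    have [I1 [D [B IE]]] : exists (I1 : seq item) (D B : item), I = I1 ++ [:: D; B].
      move: I2; case/lastP: (I) => [|I1 B] //; case/lastP: I1 => // I1 D _.
      by exists I1, D, B; rewrite -!cats1 -catA.
    have DI : D \in I by rewrite IE mem_cat mem_head orbT.
    have BI : B \in I by rewrite IE mem_cat !inE eqxx !orbT.
    have [mB|mB] := boolP (mono B); last first.
      have [|z [zB az bz zl]] := third B (I1 ++ [:: D]) [::]; first by rewrite -catA.
      exists B, z; split=> //; first by rewrite mem_filter /= mB.
      by split=> //; rewrite orbF in zl; rewrite inE zl.
    have [z [zD az bz zl]] := third D I1 [:: B] IE.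
    move: ME; rewrite /M IE filter_cat /= mB.
    case: ifPn => [_|mD ME']; first by move/(congr1 size); rewrite size_cat /= addn2.
    have Bi : B = i by have := congr1 (last i) ME'; rewrite last_cat.
    exists D, z; split=> //; first by rewrite mem_filter /= mD.
    by split=> //; move: zl; rewrite Bi !inE.
  exists j => //; rewrite !big_seq1 => even_j.
  have ij : i != j by apply: contraTneq jN => <-; rewrite mem_filter /= (allP mM).
  have [jI mj] : j \in I /\ ~~ mono j by move: jN; rewrite mem_filter => /andP[].
  have okj := okP j jI; have Uj : uniq j.2 by case/and5P: okj => _ _ _ _ /and3P[].
  have lsub : {subset [:: l; i.1.1; i.1.2] <= i.2}.
    by move=> y; rewrite !inE => /or3P[] /eqP-> //; apply: Wi; rewrite mem_head.
  have meet y : y \in i.2 -> y \in j.2 -> y = z.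
    move=> yi yj; case/orP: (pairwise_in aI iI jI ij) => aij.
      exact: (attached_meet Uci aij (lsub z z3) zj yi yj).
    exact: (attached_meet Uj aij zj (lsub z z3) yj yi).
  apply: eq_dec (dec_last_bowtie (l := l) oki okj _ _ meet zj az bz z3 _) => [F _|||].
  - by rewrite !big_seq1; clear; lia.
  - by rewrite (perm_uniq (s2 := [:: i.1.1; i.1.2; l])) //; perm_count.
  - by apply: lsub; rewrite mem_head.
  by move: even_j; clear; lia.
case=> // oM; left; rewrite -ME => even_M.
have [iM jM mM'] : [/\ i \in M, j \in M & m \in M] by rewrite ME !inE !eqxx !orbT.
have [r rW] : exists r, r \in W by case: (W) oW => // r ? _; exists r; apply: mem_head.
move: (okM) (mM) (aM); rewrite ME /= => /and4P[oki okj okm okM'] /and4P[mi mj mm mM''].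
case/andP=> /and3P[ij im _] /andP[/andP[jm _] /andP[_ aM']].
have eM' : ~~ odd (size M') by move: oM; rewrite /= negbK.
have [/(WM i) ri /(WM j) rj /(WM m) rm] := And3 iM jM mM'.
have itemU (x : item) : item_ok x -> uniq x.2 by case/and5P=> _ _ _ _ /and3P[].
have meet (x y : item) : item_ok x -> r \in x.2 -> r \in y.2 -> attached x y ->
    forall z, z \in x.2 -> z \in y.2 -> z = r.
  by move=> okx rx ry xy z zx zy; apply: (attached_meet (itemU x okx) xy rx ry zx zy).
have mij := meet _ _ oki (ri _ rW) (rj _ rW) ij.
have mim := meet _ _ oki (ri _ rW) (rm _ rW) im.
have mjm := meet _ _ okj (rj _ rW) (rm _ rW) jm.
have Uijm : uniq (reps [:: i; j; m] ++ W).
  move: URI; rewrite ME (perm_uniq (s2 := (reps [:: i; j; m] ++ W) ++ reps (M' ++ N))).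
    by rewrite cat_uniq => /and3P[].
  have -> : reps ((i :: j :: m :: M') ++ N) = reps [:: i; j; m] ++ reps (M' ++ N) by [].
  by apply/permP => a; rewrite 2!count_cat [RHS]count_cat [in RHS]count_cat addnAC.
rewrite -ME; apply: (dec_split
  (g1 := fun F => outer F + item_sum F i + item_sum F j + item_sum F m + \sum_(w <- W) spokes F w)
  sC (dec_mono_items okM' mM'' aM' eM')) => // [F _|even_g].
  by rewrite ME !big_cons; clear; lia.
(* Two of three parities agree; the corresponding cycles are absorbed together. *)
have [eij|nij] := eqVneq (spar i.1.1) (spar j.1.1).
  by apply: (dec_three_cycles oki okj okm mi mj mm eij Uijm WX oW rW); auto.
have [eim|nim] := eqVneq (spar i.1.1) (spar m.1.1).
  apply: eq_dec (dec_three_cycles oki okm okj mi mm mj eim _ WX oW rW (ri _ rW) (rm _ rW) (rj _ rW) mim mij _) => [F _||].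
  - by clear; lia.
  - by rewrite -(perm_uniq (_ : perm_eq (reps [:: i; j; m] ++ W) _)) //; perm_count.
  by move: even_g; clear; lia.
have ejm : spar j.1.1 = spar m.1.1 by move: nij nim; do 3!case: (spar _).
apply: eq_dec (dec_three_cycles okj okm oki mj mm mi ejm _ WX oW rW (rj _ rW) (rm _ rW) (ri _ rW) mjm _ _) => [F _|||].
- by clear; lia.
- by rewrite -(perm_uniq (_ : perm_eq (reps [:: i; j; m] ++ W) _)) //; perm_count.
- by move=> y yj yi; apply: mij.
by move: even_g; clear; lia.
Qed.


End Core.

(** * Eulerian graphs without even cycles are cacti *)

Section DoubleSums.
Variable V : finType.
Implicit Types (e : rel V) (F G : V -> V -> nat) (c p : seq V) (x y u v : V).

(** A sum over ordered pairs: for a symmetric [e] each edge counts twice, whence the doubled sums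
    over cycles below. *)
Definition dsum e F := \sum_x \sum_(y | e x y) F x y.

Lemma double_sum G : commutative G -> \sum_x \sum_y G x y =
  (\sum_x \sum_(y | enum_rank x < enum_rank y) G x y).*2 + \sum_x G x x.
Proof.
move=> GC; have -> : \sum_x \sum_y G x y =
    \sum_x (\sum_(y | enum_rank x < enum_rank y) G x y +
      \sum_(y | enum_rank y < enum_rank x) G x y + G x x).
  apply: eq_bigr => x _; rewrite (bigID (fun y => enum_rank x < enum_rank y)) /= -addnA.
  congr (_ + _); rewrite (bigID (fun y => enum_rank y < enum_rank x)) /=; congr (_ + _).
    by apply: eq_bigl => y; rewrite -leqNgt; case: ltnP => [/ltnW->|]; rewrite ?andbF.
  rewrite (big_pred1 x) // => y; rewrite -!leqNgt -eqn_leq eq_sym.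
  by rewrite (inj_eq val_inj) (inj_eq enum_rank_inj).
rewrite !big_split /=; congr (_ + _); rewrite -addnn; congr (_ + _).
rewrite (exchange_big_dep predT) //=; apply: eq_bigr => x _.
by apply: eq_bigr => y _.
Qed.

Lemma dsumE e F : dsum e F = \sum_x \sum_y e x y * F x y.
Proof.
apply: eq_bigr => x _; rewrite big_mkcond; apply: eq_bigr => y _.
by case: (e x y); rewrite ?mul1n.
Qed.

Lemma dsum_even e F : symmetric e -> irreflexive e -> commutative F -> ~~ odd (dsum e F).
Proof.
move=> eS eI FC; rewrite dsumE double_sum => [|x y]; last by rewrite eS FC.
by rewrite oddD odd_double big1 // => x _; rewrite eI.
Qed.

Lemma sum_ew F u v : u != v -> \sum_x \sum_y ew x y u v * F x y = F u v + F v u.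
Proof.
move=> uv; have ewE x y : ew x y u v = (x == u) * (y == v) + (x == v) * (y == u).
  have : ~~ ((x == u) && (x == v)) by case: (x =P u) => //= ->.
  rewrite /ew ![u == _]eq_sym ![v == _]eq_sym.
  by case: (x == u); case: (x == v); case: (y == u); case: (y == v).
under eq_bigr => x _ do under eq_bigr => y _ do rewrite ewE mulnDl.
under eq_bigr => x _ do rewrite big_split /=.
rewrite big_split /=; congr (_ + _).
  rewrite (bigD1 u) //= (bigD1 v) //= !eqxx !mul1n !big1 ?addn0 // => [x /negPf xu|y /negPf yv].
    by rewrite big1 // => y _; rewrite xu.
  by rewrite yv.
rewrite (bigD1 v) //= (bigD1 u) //= !eqxx !mul1n !big1 ?addn0 // => [x /negPf xu|y /negPf yv].
  by rewrite big1 // => y _; rewrite xu.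
by rewrite yv.
Qed.

Lemma path_ppairs e x p : path e x p = all (fun z => e z.1 z.2) (ppairs x p).
Proof. by elim: p x => //= y p IH x; rewrite IH. Qed.

Lemma cycle_cpairs e c : cycle e c = all (fun z => e z.1 z.2) (cpairs c).
Proof. by case: c => //= x p; rewrite path_ppairs. Qed.

Lemma sum_csum_ew F c : {in cpairs c, forall z, z.1 != z.2} ->
  \sum_x \sum_y csum (ew x y) c * F x y = csum (fun u v => F u v + F v u) c.
Proof.
move=> cP; rewrite csum_cpairs.
transitivity (\sum_x \sum_(z <- cpairs c) \sum_y ew x y z.1 z.2 * F x y).
  apply: eq_bigr => x _; rewrite exchange_big; apply: eq_bigr => y _.
  by rewrite csum_cpairs big_distrl.
rewrite exchange_big !big_seq; apply: eq_bigr => z zc.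
by rewrite sum_ew ?cP.
Qed.

Lemma csum_ew_edge e c x y : symmetric e -> cycle e c -> csum (ew x y) c != 0 -> e x y.
Proof.
move=> eS; rewrite cycle_cpairs csum_cpairs => /allP ce; apply: contraNT => nexy.
rewrite big1_seq // => z /andP[_ /ce ez]; rewrite /ew.
apply/eqP; rewrite eqb0; apply/negP => /orP[] /andP[/eqP zx /eqP zy].
  by move: nexy; rewrite -zx -zy ez.
by move: nexy; rewrite -zx -zy eS ez.
Qed.

Definition without e c : rel V := fun x y => e x y && (csum (ew x y) c == 0).

Lemma dsum_without e c F : symmetric e -> irreflexive e ->
  2 < size c -> uniq c -> cycle e c ->
  dsum e F = dsum (without e c) F + csum (fun u v => F u v + F v u) c.
Proof.
move=> eS eI c3 Uc ce; rewrite -sum_csum_ew; last first.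
  by move: ce; rewrite cycle_cpairs => /allP ce [u v] /ce /=; apply: contraTneq => ->; rewrite eI.
rewrite !dsumE -big_split; apply: eq_bigr => x _; rewrite -big_split.
apply: eq_bigr => y _ /=; rewrite -mulnDl /without; congr (_ * _).
have := csum_ew_le1 x y c3 Uc; have := csum_ew_edge (x := x) (y := y) eS ce.
by case: (csum _ _) => [|[|n]] //= => [_|->]; rewrite ?andbT ?andbF ?addn0.
Qed.

Lemma without_sym e c : symmetric e -> symmetric (without e c).
Proof.
by move=> eS x y; rewrite /without eS; congr (_ && (_ == _)); apply: eq_csum => u v; apply: ew_sym.
Qed.

Lemma without_sub e c : subrel (without e c) e.
Proof. by move=> x y /andP[]. Qed.

Definition even_degrees e := forall x, ~~ odd #|e x|.

Lemma degree_dsum e x : #|e x| = dsum e (fun u _ => u == x).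
Proof.
rewrite /dsum (bigD1 x) //= eqxx [X in _ = _ + X]big1 ?addn0 ?sum1_card // => u /negPf ux.
by rewrite big1 // ux.
Qed.

Lemma without_degrees e c : symmetric e -> irreflexive e -> even_degrees e ->
  2 < size c -> uniq c -> cycle e c -> even_degrees (without e c).
Proof.
move=> eS eI eD c3 Uc ce x; have := eD x.
rewrite !degree_dsum (dsum_without _ eS eI c3 Uc ce) (csum_vertex (fun u => u == x : nat)).
by rewrite oddD odd_double addbF.
Qed.

(** Delete the edge [u v]. If [u] were not reachable from [v], the component of [v] would have [v]
    as its only vertex of odd degree, against the handshake lemma. A simple path from [v] to [u] and
    the deleted edge form the cycle. *)
Lemma edge_in_cycle e u v : symmetric e -> irreflexive e -> even_degrees e -> e u v ->
  exists c, [/\ 2 < size c, uniq c, cycle e c & v \in c].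
Proof.
move=> eS eI eD euv; have uv : u != v by apply: contraTneq euv => ->; rewrite eI.
pose e' : rel V := fun x y => e x y && (ew u v x y == 0).
have e'S : symmetric e' by move=> x y; rewrite /e' eS ewC.
have deg' x : #|e x| = #|e' x| + ((x == u) + (x == v)).
  rewrite !degree_dsum !dsumE.
  have -> : ((x == u) + (x == v)) = \sum_y \sum_z ew y z u v * (y == x).
    by rewrite sum_ew // ![x == _]eq_sym.
  rewrite -big_split; apply: eq_bigr => y _; rewrite -big_split; apply: eq_bigr => z _.
  rewrite /= -mulnDl; congr (_ * _); rewrite /e' [ew u v y z]ew_flip.
  rewrite /ew; case: (boolP (_ || _)) => [|_]; last by rewrite andbT addn0.
  by rewrite andbF; case/orP=> /andP[/eqP<- /eqP<-]; rewrite ?euv // eS euv.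
have conn_vu : connect e' v u.
  apply/negPn/negP => nvu.
  have clX x y : e' x y -> connect e' v x = connect e' v y.
    by move=> xy; apply/idP/idP => /connect_trans; apply; apply: connect1; rewrite // e'S.
  pose G x y : nat := connect e' v x && e' x y.
  have GC : commutative G.
    move=> x y; rewrite /G e'S; case: (boolP (e' y x)) => [yx|]; rewrite ?andbF //.
    by rewrite (clX _ _ yx).
  have : ~~ odd (\sum_x \sum_y G x y).
    rewrite double_sum // oddD odd_double big1 // => x _.
    by rewrite /G /e' eI andbF.
  have -> : \sum_x \sum_y G x y = \sum_(x | connect e' v x) #|e' x|.
    rewrite [RHS]big_mkcond; apply: eq_bigr => x _; rewrite /G.
    case: (connect _ _ _); last by rewrite big1.
    by rewrite -sum1_card [RHS]big_mkcond.
  rewrite (bigD1 v) ?connect0 //= oddD.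
  have -> : odd (\sum_(i | connect e' v i && (i != v)) #|e' i|) = false.
    apply/negbTE; elim/big_rec: _ => // x n /andP[vx xv] nE.
    rewrite oddD (negPf nE) addbF; have := eD x; rewrite deg' (negPf xv).
    by have /negPf-> : x != u; [apply: contraTneq vx => -> | rewrite !addn0].
  have := eD v; rewrite deg' eqxx eq_sym (negPf uv) /= addn1 addbF.
  by rewrite oddD addbT negbK => ->.
case/connectP: conn_vu => p vp uE; case: (shortenP vp) uE => p' vp' Up' _ uE.
exists (v :: p'); rewrite mem_head; split=> //.
  case: p' vp' uE {Up'} => [|y [|z p']] //= => [_ vu|/andP[/andP[_ vu] _] uy].
    by rewrite vu eqxx in uv.
  by move: vu; rewrite -uy /ew !eqxx orbT.
rewrite /= rcons_path -uE euv andbT.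
by apply: sub_path vp' => x y /andP[].
Qed.

End DoubleSums.

(** The head is the cycle found last. It has at most one vertex on the cycles after it in the list,
    so at least two vertices are its own. *)
Fixpoint cactus (T : eqType) (L : seq (seq T)) := if L is c :: L' then
  [&& 2 < size c, uniq c, count (mem (flatten L')) c <= 1 & cactus L'] else true.

Section Cactus.
Variables (V : finType) (e : rel V) (s : V -> V -> nat).
Hypotheses (eS : symmetric e) (eI : irreflexive e) (sC : commutative s).
Hypothesis no_even_cycle : forall c, 2 < size c -> uniq c -> cycle e c -> odd (csum s c).
Implicit Types (R : rel V) (S : {set V}) (L : seq (seq V)).

Definition linked R S u v b := exists p, [/\ path R u p, last u p = v, uniq (u :: p),
  {subset p <= S} & odd (psum s u p) = b].

Lemma path_rcons_rev R u v p : symmetric R ->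
  path R v (rcons (rev p) u) = path R u (rcons p v).
Proof.
move=> RS; elim: p u v => [|w p IH] u v /=; first by rewrite RS.
by rewrite rev_cons rcons_path last_rcons IH RS andbC.
Qed.

Lemma linked_sym R S u v b : symmetric R -> u \in S -> linked R S u v b -> linked R S v u b.
Proof.
move=> RS uS [p [pP pv Up pS sp]].
case/lastP: p pP pv Up pS sp => [|p w] pP; first by move=> /= <- _ _ <-; exists [::].
rewrite last_rcons => wv; rewrite {}wv in pP * => Up pS sp; exists (rcons (rev p) u); split.
- by rewrite path_rcons_rev.
- by rewrite last_rcons.
- by rewrite -rcons_cons rcons_uniq -rev_rcons mem_rev rev_uniq.
- by move=> x; rewrite mem_rcons inE mem_rev => /predU1P[-> //|xp]; apply: pS; rewrite mem_rcons inE xp orbT.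
by rewrite psum_rev.
Qed.

(** The invariant of the part already built. As both parities are available, an arc outside closes
    to an even cycle whatever its sign. *)
Definition spread R S := {in S &, forall u v, u != v -> forall b, linked R S u v b}.

(** The two arcs between [u] and [v] of an odd cycle have different parities. *)
Lemma linked_arc R S c u v b : symmetric R -> cycle R c -> uniq c -> {subset c <= S} ->
  odd (csum s c) -> u \in c -> v \in c -> u != v -> linked R S u v b.
Proof.
move=> RS cR Uc cS oc uc vc uv.
case: (rot_to uc) => i p cE.
have {}cR : cycle R (u :: p) by rewrite -cE rot_cycle.
have {}Uc : uniq (u :: p) by rewrite -cE rot_uniq.
have {}oc : odd (csum s (u :: p)) by rewrite -cE csum_rot.
have {}cS : {subset u :: p <= S} by move=> x; rewrite -cE mem_rot => /cS.
have vp : v \in p by move: vc; rewrite -(mem_rot i) cE inE eq_sym (negPf uv).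
case/splitPr: vp cR Uc oc cS => p1 p2 cR Uc oc cS.
move: cR; rewrite /= rcons_cat -cat_rcons cat_path last_rcons => /andP[R1 R2].
move: oc; rewrite /= rcons_cat -cat_rcons psum_cat last_rcons oddD => oc.
have [b1|b1] := eqVneq (odd (psum s u (rcons p1 v))) b.
  exists (rcons p1 v); split=> //; first by rewrite last_rcons.
    by move: Uc; rewrite -cat_rcons -cat_cons cat_uniq => /andP[].
  by move=> x; rewrite mem_rcons => xv; apply: cS; rewrite inE -cat_rcons mem_cat mem_rcons xv orbT.
exists (rcons (rev p2) v); split.
- by rewrite path_rcons_rev.
- by rewrite last_rcons.
- move: Uc; rewrite cons_uniq mem_cat negb_or cat_uniq => /andP[/andP[_ up] /and3P[_ _ Up]].
  by rewrite -rev_cons cons_uniq mem_rev rev_uniq up.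
- move=> x; rewrite mem_rcons inE mem_rev => xv; apply: cS.
  by rewrite !inE mem_cat inE; case/orP: xv => ->; rewrite ?orbT.
rewrite psum_rev //.
by move: oc b1; do 2!case: (odd _); case: b.
Qed.

Lemma linked_sub R R' S S' u v b : subrel R R' -> {subset S <= S'} ->
  linked R S u v b -> linked R' S' u v b.
Proof.
move=> RR SS [p [pP pv Up pS sp]]; exists p; split=> //; first exact: sub_path pP.
by move=> x /pS /SS.
Qed.

Lemma linked_trans R S S' u x v b b' :
  linked R S u x b -> linked R S' x v b' -> u \in S ->
  (forall y, y \in S -> y \in S' -> y = x) ->
  linked R (S :|: S') u v (b (+) b').
Proof.
move=> [p [pP pv Up pS sp]] [p' [pP' pv' Up' pS' sp']] uS meet.
exists (p ++ p'); split.
- by rewrite cat_path pP pv.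
- by rewrite last_cat pv.
- rewrite -cat_cons cat_uniq Up; move: Up'; rewrite cons_uniq => /andP[xp' ->].
  rewrite andbT /=; apply/hasPn => y yp'; apply/negP => yp.
  have yS : y \in S by move: yp; rewrite inE => /predU1P[->|/pS].
  by move: xp'; rewrite -(meet y yS (pS' y yp')) yp'.
- by move=> y; rewrite mem_cat inE => /orP[/pS|/pS'] ->; rewrite ?orbT.
by rewrite psum_cat oddD sp pv sp'.
Qed.

(** [R] holds the edges not yet consumed, so these are the edges of the cycles already found. *)
Definition used R : rel V := fun u v => e u v && ~~ R u v.

(* A cycle of [R] through a vertex of the part [S] already built meets [S]
   nowhere else: otherwise an arc of it closes to an even cycle through [S]. *)
Lemma new_cycle R S x p : symmetric R -> subrel R e -> spread (used R) S ->
  uniq (x :: p) -> cycle R (x :: p) -> x \in S -> {in p, forall y, y \notin S}.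
Proof.
move=> RS Re spr Uc cR xS y0 y0p; apply/negP => y0S.
have : has (mem S) p by apply/hasP; exists y0.
move=> hp; case/split_find: hp Uc cR y0p => y p1 p2 yS p1S Uc cR y0p.
rewrite /= in yS p1S.
have xy : x != y by apply: contraTneq Uc => ->; rewrite cat_rcons /= mem_cat mem_head orbT.
have [q [qP qx Uq qS sq]] := spr y x yS xS (negbT (etrans (eq_sym _ _) (negPf xy)))
  (odd (psum s x (rcons p1 y))).
move: cR; rewrite /= rcons_cat cat_path => /andP[R1 _].
case/lastP: q qP qx Uq qS sq => [|q w] qP /=; first by move=> yx; rewrite yx eqxx in xy.
rewrite last_rcons => wx; rewrite {}wx in qP * => Uq qS sq.
have Ux : uniq (x :: p1) by move: Uc; rewrite cat_rcons -cat_cons cat_uniq => /andP[].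
have uq : path e y (rcons q x) by apply: sub_path qP => u v /andP[].
have cyc : cycle e (x :: p1 ++ y :: q).
  by rewrite /= rcons_cat /= -cat_rcons cat_path last_rcons uq (sub_path Re R1).
have even_c : ~~ odd (csum s (x :: p1 ++ y :: q)).
  by rewrite /= rcons_cat /= -cat_rcons psum_cat last_rcons oddD sq addbb.
apply: (negP even_c); apply: no_even_cycle cyc.
  (* The arc consists of edges of [R] and the path through [S] of used ones, so they are not the
     same single edge and the cycle has more than two vertices. *)
  rewrite /= size_cat /= addnS; case: p1 R1 {y0p Ux Uc p1S sq even_c} => [|? ?] //= /andP[Rxy _].
  by case: q qP {Uq qS uq} => //= /andP[/andP[_]]; rewrite RS Rxy.
have sub z : z \in y :: q -> z \in S.
  by rewrite inE => /predU1P[->//|zq]; apply: qS; rewrite mem_rcons inE zq orbT.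
rewrite -cat_cons cat_uniq Ux.
have [-> xyq] : uniq (y :: q) /\ x \notin y :: q.
  have : uniq (rcons (y :: q) x) by [].
  by rewrite rcons_uniq => /andP[].
rewrite andbT; apply/hasPn => z zyq; rewrite /= inE negb_or; apply/andP; split.
  by apply: contraTneq zyq => ->.
by apply: contraL (sub z zyq) => zp1; move/hasPn: p1S => /(_ z zp1).
Qed.

Lemma csum_const (T : Type) k (c : seq T) : csum (fun _ _ => k) c = k * size c.
Proof.
case: c => [|x p] /=; first by rewrite muln0.
rewrite -(size_rcons p x); move: (rcons p x) => r.
by elim: r x => [|y q IH] z /=; rewrite ?muln0 // mulnS IH.
Qed.

Lemma cycle_edge R c x : cycle R c -> x \in c -> exists y, R x y.
Proof.
move=> cR /rot_to[i p cE]; have : cycle R (x :: p) by rewrite -cE rot_cycle.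
by case: p {cE} => [|y p] /= /andP[Rxy _]; [exists x | exists y].
Qed.

Lemma cycle_used R c : symmetric R -> subrel R e -> 2 < size c -> uniq c -> cycle R c ->
  cycle (used (without R c)) c.
Proof.
move=> RS Re c3 Uc; rewrite !cycle_cpairs => /allP cR; apply/allP => z zc.
rewrite /used /without (Re _ _ (cR z zc)) (cR z zc) /=.
by rewrite csum_cpairs (big_rem z zc) /= /ew !eqxx.
Qed.

(** The new cycle meets [S] in [x] only. From [S] to the cycle a path passes through [x]; the parity
    of the part on one side can be fixed, the other side adjusts the total. *)
Lemma spread_cycle R S x p : symmetric R -> subrel R e -> spread (used R) S ->
  2 < size (x :: p) -> uniq (x :: p) -> cycle R (x :: p) -> x \in S ->
  spread (used (without R (x :: p))) (S :|: [set y in x :: p]).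
Proof.
move=> RS Re spr c3 Uc cR xS; have pS := new_cycle RS Re spr Uc cR xS.
set c := x :: p in c3 Uc cR pS *; set R' := without R c; set C := [set y in c].
have RS' : symmetric (used R') by move=> u v; rewrite /used eS /R' without_sym.
have CE y : (y \in C) = (y \in c) by rewrite /C in_set.
have cC : {subset c <= C} by move=> y; rewrite CE.
have xc : x \in c by rewrite mem_head.
have oc : odd (csum s c) by apply: no_even_cycle => //; move: cR; rewrite !cycle_cpairs; apply: sub_all => z; apply: Re.
have arc u v b : u \in c -> v \in c -> u != v -> linked (used R') C u v b.
  by apply: linked_arc => //; apply: cycle_used.
have old u v b : u \in S -> v \in S -> u != v -> linked (used R') S u v b.
  move=> uS vS uv; apply: linked_sub (spr u v uS vS uv b) => // y z /andP[eyz nR].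
  by rewrite /used eyz (contra (@without_sub _ _ _ y z)).
have meet y : y \in S -> y \in C -> y = x.
  move=> yS; rewrite CE inE => /predU1P[//|yp].
  by have := pS y yp; rewrite yS.
have mixed u v b : u \in S -> v \in c -> u != v -> linked (used R') (S :|: C) u v b.
  move=> uS vc uv; have [ux|ux] := eqVneq u x.
    by apply: linked_sub (arc u v b _ vc uv) => [//|y yC|]; rewrite ?ux // in_setU yC orbT.
  have [vx|vx] := eqVneq v x.
    by apply: linked_sub (old u v b uS _ uv) => [//|y yS|]; rewrite ?vx // in_setU yS.
  have -> : b = b (+) true (+) true by case: b.
  apply: linked_trans (old u x (b (+) true) uS xS ux) (arc x v true xc vc _) uS meet.
  by rewrite eq_sym.
move=> u v; rewrite !in_setU => /orP[uS|uC] /orP[vS|vC] uv b.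
- by apply: linked_sub (old u v b uS vS uv) => // y yS; rewrite in_setU yS.
- by apply: mixed => //; rewrite -CE.
- apply: linked_sym => //; first by rewrite in_setU vS.
  by apply: mixed; rewrite // 1?eq_sym //; rewrite -CE.
- apply: linked_sub (arc u v b _ _ uv) => [//|y yC||]; first by rewrite in_setU yC orbT.
    by rewrite -CE.
  by rewrite -CE.
Qed.

(** [S] is the component under construction. A vertex of an earlier cycle lies in [S] or has no edge
    left in [R], so the next cycle, grown at a vertex [x] of [S], meets the earlier ones at most in
    [x]. The induction is on the number of edges left. *)
Lemma cactus_grow n R S L : dsum R (fun _ _ => 1) < n ->
  symmetric R -> subrel R e -> even_degrees R -> spread (used R) S ->
  {in flatten L, forall x, x \in S \/ forall y, ~~ R x y} -> cactus L ->
  exists L', [/\ cactus (L' ++ L), all (fun c => odd (csum s c)) L' &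
    forall F, commutative F -> dsum R F = (\sum_(c <- L') csum F c).*2].
Proof.
elim: n R S L => // n IH R S L; rewrite ltnS => Rn RS Re RD spr LS Lc.
have RI : irreflexive R by move=> x; apply: contraFF (eI x); apply: Re.
have [/existsP[a /existsP[a' Raa']]|/existsPn R0] := boolP [exists x, exists y, R x y]; last first.
  exists [::]; split=> // F _; rewrite big_nil /dsum big1 // => x _.
  by rewrite big_pred0 // => y; apply/negbTE; have /existsPn := R0 x; apply.
have [S' [x [y [sprS' LS' xS' Rxy]]]] : exists S' x y, [/\ spread (used R) S',
    {in flatten L, forall x, x \in S' \/ forall y, ~~ R x y}, x \in S' & R x y].
  have [/existsP[x /existsP[y /andP[xS Rxy]]]|/existsPn S0] :=
    boolP [exists x, exists y, (x \in S) && R x y]; first by exists S, x, y.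
  (* No edge is left at [S], so all earlier cycles are exhausted and a new component starts from a
     single vertex, which is trivially spread. *)
  exists [set a], a, a'; split; rewrite ?set11 //.
    by move=> u v; rewrite !inE => /eqP-> /eqP->; rewrite eqxx.
  move=> z zL; right=> y; case: (LS z zL) => [zS|]; last exact.
  by have /existsPn/(_ y) := S0 z; rewrite zS.
have [c [c3 Uc cR xc]] : exists c, [/\ 2 < size c, uniq c, cycle R c & x \in c].
  by apply: (@edge_in_cycle _ R y); rewrite // RS.
case/rot_to: (xc) => i p cE; move: c3 Uc cR; rewrite -(size_rot i) -(rot_uniq i) -(rot_cycle i) cE => {cE xc i c}c3 Uc cR.
set c := x :: p in c3 Uc cR *.
have meet := new_cycle RS Re sprS' Uc cR xS'.
have [] := IH (without R c) (S' :|: [set y in c]) (c :: L).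
- apply: leq_trans Rn; rewrite (dsum_without _ RS RI c3 Uc cR) csum_const.
  by rewrite -[X in X < _]addn0 ltn_add2l muln_gt0.
- exact: without_sym.
- by move=> u v /without_sub /Re.
- exact: without_degrees.
- exact: spread_cycle.
- move=> z; rewrite /= -[_ :: _]/((x :: p) ++ flatten L) mem_cat => /orP[zc|/LS'[zS|zR]].
  + by left; rewrite !inE in zc *; rewrite zc orbT.
  + by left; rewrite inE zS.
  by right=> v; rewrite /without (negPf (zR v)).
- apply/and4P; split=> //; rewrite -size_filter.
  apply: (@uniq_leq_size _ _ [:: x]); first exact: filter_uniq.
  move=> z; rewrite mem_filter /= => /andP[/LS' zL zc]; rewrite inE.
  case: zL => [zS|zR]; last by have [v] := cycle_edge cR zc; rewrite (negPf (zR v)).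
  by move: zc; rewrite inE => /predU1P[->//|zp]; have := meet z zp; rewrite zS.
move=> L' [L'c L'o L'F]; exists (rcons L' c); rewrite cat_rcons; split=> // [|F FC].
  rewrite all_rcons L'o andbT; apply: no_even_cycle => //.
  by move: cR; rewrite !cycle_cpairs; apply: sub_all => z; apply: Re.
have -> : \sum_(d <- rcons L' c) csum F d = \sum_(d <- L') csum F d + csum F c.
  by rewrite -cats1 big_cat big_seq1.
rewrite (dsum_without _ RS RI c3 Uc cR) L'F // doubleD; congr (_ + _).
rewrite (eq_csum (F' := fun u v => 2 * F u v)) => [|u v]; last by rewrite [F v u]FC mul2n addnn.
by rewrite csumM mul2n.
Qed.

End Cactus.

(** A sequence without repetition is no longer than the number of vertices, so a finite search
    decides existence without excluded middle. *)
Lemma uniq_seq_em (V : finType) (P : pred (seq V)) : {in P, forall c, uniq c} ->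
  (exists c, P c) \/ forall c, ~~ P c.
Proof.
move=> PU.
have [/existsP[n /existsP[t Pt]]|none] :=
  boolP [exists n : 'I_#|V|.+1, exists t : n.-tuple V, P t]; first by left; exists t.
right=> c; apply: contra none => Pc.
have lec : size c < #|V|.+1 by rewrite ltnS -(card_uniqP (PU c Pc)) max_card.
by apply/existsP; exists (Ordinal lec); apply/existsP; exists (in_tuple c).
Qed.

Theorem eulerian_decomposition (V : finType) (e : rel V) (s : V -> V -> nat) :
  symmetric e -> irreflexive e -> commutative s -> even_degrees e ->
  exists L0 L, [/\ all (even_cycle s) L0, cactus L, all (fun c => odd (csum s c)) L &
    forall F, commutative F -> dsum e F = (\sum_(c <- L0) csum F c + \sum_(c <- L) csum F c).*2].
Proof.
move=> + + sC; have [n] := ubnP (dsum e (fun _ _ => 1)).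
elim: n e => // n IH e en eS eI eD; rewrite ltnS in en.
have [c|[c /andP[/and3P[c3 Uc ec] cc]]|noc] :=
  @uniq_seq_em _ (fun c => even_cycle s c && cycle e c).
- by move=> /andP[/and3P[]].
- have [||||L0 [L [L0e Lc Lo LF]]] := IH (without e c).
  + apply: leq_trans en; rewrite (dsum_without _ eS eI c3 Uc cc) csum_const.
    by rewrite -[X in X < _]addn0 ltn_add2l muln_gt0 /=; case: c c3 {Uc ec cc}.
  + exact: without_sym.
  + by move=> x; apply: contraFF (eI x); apply: without_sub.
  + exact: without_degrees.
  exists (c :: L0), L; split=> //; first by rewrite /= L0e /even_cycle c3 Uc ec.
  move=> F FC; rewrite (dsum_without _ eS eI c3 Uc cc) LF // big_cons.
  rewrite (eq_csum (F' := fun u v => 2 * F u v)) => [|u v]; last by rewrite [F v u]FC mul2n addnn.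
  by rewrite csumM mul2n -doubleD; rewrite addnC addnA.
have no_even c : 2 < size c -> uniq c -> cycle e c -> odd (csum s c).
  by move=> c3 Uc cc; have := noc c; rewrite /even_cycle c3 Uc cc andbT negbK.
have spr0 : spread s (used e e) set0 by move=> u v; rewrite inE.
have old0 : {in flatten [::], forall x : V, x \in (set0 : {set V}) \/ forall y, ~~ e x y} by [].
have [L [Lc Lo LF]] :=
  cactus_grow eS eI sC no_even (ltnSn _) eS (fun _ _ => id) eD spr0 old0 isT.
rewrite cats0 in Lc; exists [::], L; split=> // F FC.
by rewrite LF // big_nil.
Qed.

(** * Private vertices for the cycles of a cactus *)

Section CactusRepresentatives.
Variables (T : eqType) (s : T -> T -> nat) (X : seq T).

Lemma cactus_items L : cactus L -> all (fun c => odd (csum s c)) L ->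
  {subset flatten L <= X} -> exists I : seq (item T),
  [/\ map snd I = L, all (item_ok s X) I, pairwise (@attached T) I & uniq (reps I)].
Proof.
elim: L => [|C L IH] /=; first by exists [::].
case/and4P=> C3 UC le1 Lc /andP[oC oL] LX.
have [|I [IL Iok Iatt UI]] := IH Lc oL.
  by move=> y yL; apply: LX; rewrite mem_cat yL orbT.
have IsubL : {subset reps I <= flatten L}.
  move=> y /flatten_mapP[i iI yi]; apply/flattenP; exists i.2; first by rewrite -IL map_f.
  case/and5P: (allP Iok i iI) => ai bi _ _ _.
  by move: yi; rewrite !inE => /orP[] /eqP->.
(* At least three vertices, at most one of them on the older cycles: two remain to be made
   private. *)
have : 2 <= size [seq y <- C | y \notin flatten L].
  rewrite size_filter; have := count_predC (mem (flatten L)) C.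
  by rewrite -[count (predC _) _]/(count (fun y => y \notin flatten L) C); lia.
have : uniq [seq y <- C | y \notin flatten L] by apply: filter_uniq.
have : {subset [seq y <- C | y \notin flatten L] <= [predI C & [predC flatten L]]}.
  by move=> y; rewrite mem_filter inE /= andbC.
case: [seq y <- C | _] => [|a [|a' r]] // sub U _.
have /andP[aC aL] := sub a (mem_head _ _).
have /andP[a'C a'L] : a' \in [predI C & [predC flatten L]] by apply: sub; rewrite !inE eqxx orbT.
have aa' : a != a' by move: U; rewrite /= inE negb_or => /andP[/andP[]].
exists ((a, a', C) :: I); split; first by rewrite /= IL.
- rewrite /= Iok andbT; apply/and5P; split=> //; apply/and3P; split=> //.
  by apply/allP => y yC; apply: LX; rewrite mem_cat yC.
- rewrite /= Iatt andbT; apply/allP => i iI.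
  have sub_i : {subset i.2 <= flatten L} by move=> y yi; apply/flattenP; exists i.2; rewrite // -IL map_f.
  apply/and3P; split; rewrite /= ?(contra (sub_i _)) //.
  by apply: leq_trans le1; apply: sub_count => y /sub_i.
rewrite -[uniq _]/([&& a \notin a' :: reps I, a' \notin reps I & uniq (reps I)]).
by rewrite UI inE negb_or aa' !(contra (IsubL _)).
Qed.

Theorem dec_piece b c q L : commutative s -> uniq (b :: c :: q ++ X) -> odd (size X) ->
  cactus L -> all (fun c => odd (csum s c)) L -> {subset flatten L <= X} ->
  (3 < size X) || (L == [::]) ->
  ~~ odd (outer b c q s + \sum_(h <- X) spoke_sum b c s h + \sum_(d <- L) csum s d) ->
  dec s (fun F => outer b c q F + \sum_(h <- X) spoke_sum b c F h + \sum_(d <- L) csum F d).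
Proof.
move=> sC U oX Lc oL LX size_X.
have [I [IL Iok Iatt UI]] := cactus_items Lc oL LX.
have sumL F : \sum_(d <- L) csum F d = \sum_(i <- I) csum F i.2 by rewrite -IL big_map.
rewrite sumL => even_s.
apply: eq_dec (dec_core sC U oX Iok Iatt UI _ even_s) => [F _|]; first by rewrite sumL.
by move: size_X; rewrite -IL -!size_eq0 size_map.
Qed.

End CactusRepresentatives.

(** One piece leaves no room to absorb a triangle that is all of [H], so two pieces share it. Each
    has even sign, the triangle being counted with the first; these are the two parity conditions of
    the template. *)
Lemma dec_two_pieces_triangle (T : eqType) (s : T -> T -> nat) b c q b' c' q' h k l :
  commutative s -> uniq [:: b; c; b'; c'; h; k; l] ->
  uniq ([:: b; c; h; k; l] ++ q) -> uniq ([:: b'; c'; h; k; l] ++ q') ->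
  ~~ odd (outer b c q s + \sum_(y <- [:: h; k; l]) spoke_sum b c s y + csum s [:: h; k; l]) ->
  ~~ odd (outer b' c' q' s + \sum_(y <- [:: h; k; l]) spoke_sum b' c' s y) ->
  dec s (fun F => outer b c q F + \sum_(y <- [:: h; k; l]) spoke_sum b c F y +
    (outer b' c' q' F + \sum_(y <- [:: h; k; l]) spoke_sum b' c' F y) + csum F [:: h; k; l]).
Proof.
move=> sC U Uq Uq' even1 even2.
pose vs := [:: b; h; k; l; c; b'; c']; pose ps := q :: q' :: nseq 15 [::].
apply: eq_dec (template_dec_ids (x0 := b) (vs := vs) (ps := ps) two_paths_triangle_template sC _ _ _).
- move=> F _; rewrite /tedge /outer /spoke_sum !big_cons !big_nil /=; nat_linear.
- by [].
- apply/allP => u; rewrite !inE => /or3P[] /eqP->.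
  + by rewrite (perm_uniq (s2 := [:: b; c; h; k; l] ++ q)) //; perm_count.
  + by rewrite (perm_uniq (s2 := [:: b'; c'; h; k; l] ++ q')) //; perm_count.
  + by rewrite (perm_uniq (s2 := [:: b; c; b'; c'; h; k; l])) //; perm_count.
rewrite /= andbT; apply/andP; split.
- move: even1; rewrite /tedge /outer /spoke_sum !big_cons !big_nil /=; nat_linear.
- move: even2; rewrite /tedge /outer /spoke_sum !big_cons !big_nil /=; nat_linear.
Qed.

(** * Signed decompositions of simple graphs and of subdivisions *)

Lemma set2_eqE (T : finType) (x y u v : T) :
  ([set x; y] == [set u; v]) = (ew u v x y == 1).
Proof.
have -> : (ew u v x y == 1) = (x == u) && (y == v) || (x == v) && (y == u).
  by rewrite /ew; case: (_ || _).
apply/eqP/orP => [/setP xyuv|[] /andP[/eqP-> /eqP->] //]; last by rewrite setUC.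
have := xyuv x; have := xyuv y; have := xyuv u; have := xyuv v.
rewrite !inE !eqxx ?orbT /=.
rewrite ![u == _]eq_sym ![v == _]eq_sym.
by case: (x == u); case: (x == v); case: (y == u); case: (y == v); auto.
Qed.

Lemma ppairs_zip (T : Type) (x : T) p : ppairs x p = zip (belast x p) p.
Proof. by elim: p x => //= y p IH x; rewrite IH. Qed.

Lemma cpairs_next (T : eqType) (c : seq T) : uniq c -> cpairs c = [seq (x, next c x) | x <- c].
Proof.
case: c => // x p Uc; rewrite /cpairs ppairs_zip belast_rcons.
have sz : size (x :: p) = size (rcons p x) by rewrite size_rcons.
apply: (@eq_from_nth _ (x, x)) => [|i].
  by rewrite size_zip -sz minnn size_map.
rewrite size_zip -sz minnn => lti.
rewrite nth_zip // (nth_map x) //; congr (_, _).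
rewrite next_nth mem_nth // index_uniq // nth_rcons.
move: lti; rewrite [size (_ :: _)]/= ltnS leq_eqVlt => /predU1P[->|lti].
  by rewrite ltnn eqxx nth_default.
by rewrite lti; apply: set_nth_default.
Qed.

Section SimpleGraphs.
Variable G : sgraph.
Implicit Types (F s : G -> G -> nat) (c : seq G) (L : seq (seq G)).

Definition esum F := (dsum (@adj G) F)./2.

Lemma esumK F : commutative F -> (esum F).*2 = dsum (@adj G) F.
Proof.
move=> FC; rewrite -[RHS]odd_double_half (negPf (dsum_even (@adj_sym G) (@adj_irrefl G) FC)).
by rewrite add0n.
Qed.

Lemma eq_dsum F F' : (forall x y : G, adj x y -> F x y = F' x y) ->
  dsum (@adj G) F = dsum (@adj G) F'.
Proof. by move=> FF'; apply: eq_bigr => x _; apply: eq_bigr => y /FF'. Qed.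

Lemma eq_esum F F' : (forall x y : G, adj x y -> F x y = F' x y) -> esum F = esum F'.
Proof. by move=> FF'; rewrite /esum (eq_dsum FF'). Qed.

Lemma esum_half F : commutative F ->
  esum F = \sum_(x : G) \sum_(y : G | enum_rank x < enum_rank y) adj x y * F x y.
Proof.
move=> FC; apply: double_inj; rewrite esumK // dsumE double_sum => [|x y].
  by rewrite [X in _ + X]big1 ?addn0 // => x _; rewrite adj_irrefl.
by rewrite adj_sym FC.
Qed.

Lemma odd_esum F F' : commutative F -> commutative F' ->
  (forall x y : G, adj x y -> odd (F x y) = odd (F' x y)) -> odd (esum F) = odd (esum F').
Proof.
move=> FC FC' FF'; rewrite !esum_half //.
elim/big_rec2: _ => // x m n _ mn; rewrite !oddD mn; congr (_ (+) _).
elim/big_rec2: _ => // y m' n' _ mn'; rewrite !oddD mn'; congr (_ (+) _).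
by rewrite !oddM; case: (boolP (adj x y)) => // /FF' ->.
Qed.

Lemma esumD F F' : commutative F -> commutative F' ->
  esum (fun x y => F x y + F' x y) = esum F + esum F'.
Proof.
move=> FC FC'; apply: double_inj; rewrite doubleD !esumK //; last by move=> x y; rewrite FC FC'.
by rewrite !dsumE -big_split; apply: eq_bigr => x _; rewrite -big_split; apply: eq_bigr => y _ /=; rewrite mulnDr.
Qed.

Lemma esum_ew u v : esum (ew u v) = adj u v.
Proof.
apply: double_inj; rewrite esumK; last exact: ewC.
have -> : dsum (@adj G) (ew u v) = \sum_(x : G) \sum_(y : G) ew x y u v * adj x y.
  by rewrite dsumE; apply: eq_bigr => x _; apply: eq_bigr => y _; rewrite ew_flip mulnC.
have [<-|uv] := eqVneq u v; last by rewrite (sum_ew (fun x y : G => adj x y : nat) uv) [adj v u]adj_sym addnn.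
rewrite adj_irrefl !big1 // => x _; rewrite big1 // => y _; rewrite /ew.
by case: eqP => [<-|_]; case: eqP => [<-|_]; rewrite ?adj_irrefl ?andbF ?muln0.
Qed.

Lemma edgesP u v : ([set u; v] \in edges G) = adj u v.
Proof.
apply/imset2P/idP => [[x y _]|uv]; last by exists u v; rewrite ?inE //= uv.
rewrite inE => /andP[_ xy] /eqP; rewrite eq_sym set2_eqE /ew.
by case: orP => // -[] /andP[/eqP<- /eqP<-] _; rewrite // adj_sym.
Qed.

Lemma card_edges : #|edges G| = esum (fun _ _ => 1).
Proof.
pose D := [set z : G * G | (enum_rank z.1 < enum_rank z.2) && adj z.1 z.2].
have -> : edges G = [set [set z.1; z.2] | z in D].
  apply/setP => B; apply/imset2P/imsetP => [[x y _]|[[x y]]].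
    rewrite inE => /andP[_ xy] ->.
    have [lt|gt|/val_inj/enum_rank_inj exy] := ltngtP (enum_rank x) (enum_rank y).
    - by exists (x, y); rewrite // inE lt.
    - by exists (y, x); rewrite ?inE ?gt 1?adj_sym //= setUC.
    - by rewrite exy adj_irrefl in xy.
  by rewrite inE => /andP[_ xy] ->; exists x y; rewrite ?inE.
rewrite card_in_imset => [|[x y] [u v]].
  rewrite esum_half // -sum1_card (eq_bigl (fun z => (enum_rank z.1 < enum_rank z.2) && adj z.1 z.2)); last by move=> z; rewrite inE.
  rewrite big_mkcondr pair_big_dep /=; apply: eq_bigr => z _.
  by case: (adj _ _).
rewrite !inE /= => /andP[xy _] /andP[uv _] /eqP; rewrite set2_eqE /ew.
case: orP => // -[] /andP[/eqP xu /eqP yv] _; first by rewrite xu yv.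
by move: xy; rewrite xu yv ltnNge ltnW.
Qed.

Lemma csum_ew_mem c u v : 2 < size c -> uniq c ->
  csum (ew u v) c = ([set u; v] \in cycle_edges c).
Proof.
move=> c3 Uc; have := csum_ew_le1 u v c3 Uc.
have : (csum (ew u v) c == 0) = ([set u; v] \notin cycle_edges c).
  rewrite csum_cpairs cpairs_next // big_map sum_nat_seq_eq0 -[LHS]negbK -has_predC.
  congr (~~ _); apply/hasP/imsetP => [[x xc]|[x xc /eqP]]; rewrite /= ?implyTb.
    by rewrite -lt0n /= => ew_x; exists x => //; apply/eqP; rewrite eq_sym set2_eqE eqn_leq ew_x andbT leq_b1.
  by rewrite eq_sym set2_eqE => /eqP ew_x; exists x; rewrite //= ew_x.
by case: (csum _ _) => [|[|n]] //=; case: (_ \in _).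
Qed.

(** Evaluation on indicators: an edge is covered exactly once, a non-edge never. *)
Lemma decomposition_weights L : (forall F, commutative F -> esum F = \sum_(c <- L) csum F c) ->
  forall u v, \sum_(c <- L) csum (ew u v) c = adj u v.
Proof. by move=> LF u v; rewrite -LF ?esum_ew //; apply: ewC. Qed.

(** All terms are nonnegative, so a pair on a cycle of [L] has positive weight and is an edge of
    [G]. *)
Lemma decomposition_cycle L c : (forall F, commutative F -> esum F = \sum_(c <- L) csum F c) ->
  c \in L -> cycle (@adj G) c.
Proof.
move=> LF cL; rewrite cycle_cpairs; apply/allP => z zc.
have := decomposition_weights LF z.1 z.2; rewrite (big_rem c cL) /=.
rewrite csum_cpairs (big_rem z zc) /= {1}/ew !eqxx /=.
by case: (adj _ _) => // /eqP; rewrite !addn_eq0.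
Qed.

Lemma weights_decomposition L : {in L, forall c, cycle (@adj G) c} ->
  (forall u v, \sum_(c <- L) csum (ew u v) c = adj u v) ->
  forall F, commutative F -> esum F = \sum_(c <- L) csum F c.
Proof.
move=> Lcyc LW F FC; apply: double_inj; rewrite esumK // dsumE.
transitivity (\sum_(c <- L) \sum_u \sum_v csum (ew u v) c * F u v).
  rewrite [RHS]exchange_big; apply: eq_bigr => u _; rewrite [RHS]exchange_big; apply: eq_bigr => v _.
  by rewrite -LW big_distrl.
rewrite -mul2n big_distrr !big_seq; apply: eq_bigr => c cL /=.
rewrite sum_csum_ew => [|z zc]; last first.
  move: (Lcyc c cL); rewrite cycle_cpairs => /allP /(_ z zc).
  by apply: contraTneq => ->; rewrite adj_irrefl.
by rewrite -csumM; apply: eq_csum => u v; rewrite [F v u]FC mul2n addnn.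
Qed.

(** With sign 1 everywhere the sign of a cycle is its length. On indicators the identity of sums
    says that each edge is covered once, as by a partition; the converse is linearity. *)
Lemma even_cycle_decomposableP :
  even_cycle_decomposable G <-> dec (fun _ _ => 1) esum.
Proof.
split=> [[P /and3P[/eqP covP tP _] Pc]|[L Le LF]].
  (* The cycle of a block is only known to exist, so the cycles are collected by induction on a list
     of blocks. *)
  have choose r : {subset r <= P} ->
      exists2 L, all (fun c => is_cycle c && ~~ odd (size c)) L &
      forall u v, \sum_(c <- L) csum (ew u v) c = \sum_(B <- r) ([set u; v] \in B).
    elim: r => [|B r IH] rP; first by exists [::] => // u v; rewrite !big_nil.
    have [L Lok LE] := IH (fun B' rB' => rP B' (mem_behead (s := B :: r) rB')).
    have [c [cc ec BE]] := Pc B (rP B (mem_head _ _)).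
    exists (c :: L) => /= [|u v]; first by rewrite cc ec.
    have /and3P[c3 _ Uc] := cc.
    by rewrite !big_cons LE csum_ew_mem // BE.
  have [|L /allP Lok LE] := choose (enum P); first by move=> B; rewrite mem_enum.
  exists L.
    apply/allP => c /Lok /andP[/and3P[c3 _ Uc] ec].
    by rewrite /even_cycle c3 Uc csum_const mul1n.
  apply: weights_decomposition => [c /Lok /andP[/and3P[]]|u v] //.
  rewrite LE big_enum /= -edgesP -covP; case: bigcupP => [[B BP uvB]|nuv].
    rewrite (bigD1 B) //= uvB big1 // => B' /andP[B'P B'B]; apply/eqP; rewrite eqb0.
    have /trivIsetP/(_ B' B B'P BP B'B)/disjoint_setI0/setP/(_ [set u; v]) := tP.
    by rewrite !inE uvB andbT => ->.
  by rewrite big1 // => B BP; apply/eqP; rewrite eqb0; apply/negP => uvB; case: nuv; exists B.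
have Lok c : c \in L -> [/\ 2 < size c, uniq c, cycle (@adj G) c & ~~ odd (size c)].
  move=> cL; have /and3P[c3 Uc] := allP Le c cL; rewrite csum_const mul1n => ec.
  by split=> //; apply: decomposition_cycle LF cL.
have LW := decomposition_weights LF.
have edgeE x c : c \in L -> x \in c -> adj x (next c x).
  by move=> /Lok[_ _ cc _] xc; apply: next_cycle.
exists [set B in [seq cycle_edges c | c <- L]]; last first.
  move=> B; rewrite inE => /mapP[c cL ->]; have [c3 Uc cc ec] := Lok c cL.
  by exists c; rewrite /is_cycle c3 Uc cc.
have memP B : B \in [set B in [seq cycle_edges c | c <- L]] -> exists2 c, c \in L & B = cycle_edges c.
  by rewrite inE => /mapP.
apply/and3P; split.
- apply/eqP/setP => B; apply/bigcupP/idP.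
    move=> [_ /memP[c cL ->] /imsetP[x xc ->]].
    by rewrite edgesP edgeE.
  move=> BG; have [u [v [uv BE]]] : exists u v, adj u v /\ B = [set u; v].
    by case/imset2P: BG => u v _; rewrite inE => /andP[_ uv] ->; exists u, v.
  have [/hasP[c cL Bc]|/hasPn nB] := boolP (has (fun c => B \in cycle_edges c) L).
    by exists (cycle_edges c); rewrite // inE map_f.
  have := LW u v; rewrite uv big1_seq // => c /andP[_ cL]; have [c3 Uc _ _] := Lok c cL.
  by rewrite csum_ew_mem // -BE (negPf (nB c cL)).
- apply/trivIsetP => _ _ /memP[c cL ->] /memP[c' c'L ->] cc'.
  rewrite -setI_eq0; apply/eqP/setP => B; rewrite !inE; apply/negP => /andP[Bc Bc'].
  case/imsetP: (Bc) => x xc BE; have := LW x (next c x).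
  have c'L2 : c' \in rem c L.
    have ncc' : c' != c by apply: contraNneq cc' => ->.
    by move: c'L; rewrite (perm_mem (perm_to_rem cL)) inE (negPf ncc').
  have [c3 Uc _ _] := Lok c cL; have [c3' Uc' _ _] := Lok c' c'L.
  rewrite (big_rem c cL) (big_rem c' c'L2) /= !csum_ew_mem // -BE Bc Bc'.
  by case: (adj _ _).
apply/negP => /memP[c cL c0]; have [c3 _ _ _] := Lok c cL.
case: c c3 cL c0 => // x c _ _ c0.
have : [set x; next (x :: c) x] \in cycle_edges (x :: c) by apply: imset_f; rewrite mem_head.
by rewrite -c0 in_set0.
Qed.

End SimpleGraphs.

(** The formulation by an edge set of even size: the edges with odd sign form that set. *)
Definition signed_decomposable (G : sgraph) := forall s : G -> G -> nat,
  commutative s -> ~~ odd (@esum G s) -> dec s (@esum G).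

(** * From signs to subdivisions *)

Lemma infix_ppairs (T : eqType) (x : T) r u v :
  infix [:: u; v] (x :: r) = ((u, v) \in ppairs x r).
Proof.
elim: r x => [|y r IH] x; first by rewrite /= andbF.
have -> : infix [:: u; v] (x :: y :: r) = prefix [:: u; v] (x :: y :: r) || infix [:: u; v] (y :: r) by [].
by rewrite IH inE xpair_eqE /= prefix0s andbT.
Qed.

Lemma ppairs_mem (T : eqType) (x : T) r u v :
  (u, v) \in ppairs x r -> u \in belast x r /\ v \in r.
Proof.
elim: r x => //= y r IH x; rewrite inE => /predU1P[[-> ->]|/IH[ur vr]]; first by split; apply: mem_head.
by rewrite !inE ur vr !orbT.
Qed.

Lemma ppairs_asym (T : eqType) (x : T) r u v : uniq (x :: r) ->
  (u, v) \in ppairs x r -> (v, u) \notin ppairs x r.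
Proof.
elim: r x => //= y r IH x /andP[xr Ur]; rewrite !inE negb_or => /predU1P[[-> ->]|uv].
  apply/andP; split; first by apply: contraNneq xr => -[-> _]; rewrite mem_head.
  by apply: contra xr => /ppairs_mem[_ xr]; rewrite inE xr orbT.
rewrite (IH y Ur uv) andbT; apply: contraNneq xr => -[vx uy].
by have [_ vr] := ppairs_mem uv; rewrite -vx inE vr orbT.
Qed.

Lemma ppairs_uniq (T : eqType) (x : T) r : uniq (x :: r) -> uniq (ppairs x r).
Proof.
elim: r x => //= y r IH x /andP[xr Ur]; rewrite IH // andbT.
by apply: contra xr => /ppairs_mem[/mem_belast].
Qed.

Lemma ppairs_rcons (T : Type) (x : T) r y :
  ppairs x (rcons r y) = rcons (ppairs x r) (last x r, y).
Proof. by elim: r x => //= z r IH x; rewrite IH. Qed.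

Lemma ppairs_rev (T : eqType) (x y : T) r u v :
  ((u, v) \in ppairs y (rcons (rev r) x)) = ((v, u) \in ppairs x (rcons r y)).
Proof.
elim: r x => [|z r IH] x /=; first by rewrite !inE !xpair_eqE andbC.
by rewrite rev_cons ppairs_rcons last_rcons mem_rcons !inE IH !xpair_eqE andbC.
Qed.

Lemma sum_count_pairs (T : finType) (r : seq (T * T)) (F : T -> T -> nat) :
  \sum_u \sum_v count_mem (u, v) r * F u v = \sum_(z <- r) F z.1 z.2.
Proof.
elim: r => [|[x y] r IH]; first by rewrite big_nil big1 // => u _; rewrite big1.
rewrite big_cons -IH /= (bigD1 x) //= [in RHS](bigD1 x) //= addnA.
congr (_ + _); last first.
  apply: eq_bigr => u ux; apply: eq_bigr => v _.
  by rewrite xpair_eqE eq_sym (negPf ux).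
rewrite (bigD1 y) //= [in RHS](bigD1 y) //= eqxx mulnDl mul1n -!addnA; congr (_ + (_ + _)).
by apply: eq_bigr => v vy; rewrite xpair_eqE [y == v]eq_sym (negPf vy) andbF.
Qed.

(** The body of [subdivision] with its two witnesses exposed, so that a concrete subdivision can be
    used through them. *)
Definition subdivides (G S : sgraph) (f : G -> S) (p : G -> G -> seq S) : Prop :=
  injective f /\
  (forall x y, adj x y -> [/\ uniq (p x y), p y x = rev (p x y)
                            & forall z, f z \notin p x y]) /\
  (forall x y x' y' s, adj x y -> adj x' y' ->
     s \in p x y -> s \in p x' y' -> [set x; y] = [set x'; y']) /\
  (forall s, (exists x, s = f x) \/ (exists x y, adj x y /\ s \in p x y)) /\
  (forall s t, adj s t <->
     exists x y, adj x y /\ infix [:: s; t] (f x :: rcons (p x y) (f y))).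

Section Subdivisions.
Variables (G S : sgraph) (f : G -> S) (p : G -> G -> seq S).
Hypotheses (f_inj : injective f)
  (p_path : forall x y, adj x y -> [/\ uniq (p x y), p y x = rev (p x y)
                              & forall z, f z \notin p x y])
  (p_disj : forall x y x' y' s, adj x y -> adj x' y' ->
       s \in p x y -> s \in p x' y' -> [set x; y] = [set x'; y'])
  (p_adj : forall s t, adj s t <->
       exists x y, adj x y /\ infix [:: s; t] (f x :: rcons (p x y) (f y))).

(** The values of [p] at non-adjacent pairs are arbitrary; replacing them by the empty path makes
    [innerC] hold for all pairs. *)
Definition inner x y := if adj x y then p x y else [::].

Lemma innerC x y : inner y x = rev (inner x y).
Proof. by rewrite /inner adj_sym; case: ifP => // /p_path[]. Qed.

Lemma inner_uniq x y : adj x y -> uniq (f x :: rcons (inner x y) (f y)).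
Proof.
rewrite /inner => xy; rewrite xy; have [Up _ fp] := p_path xy.
rewrite /= mem_rcons inE negb_or fp rcons_uniq fp Up !andbT inj_eq //.
by apply: contraTneq xy => ->; rewrite adj_irrefl.
Qed.

(** Paths of different edges share no inner vertex, and a simple path takes no step in both
    directions. Hence [subdivision_adj] counts each step once. *)
Lemma inner_pair_inj x y x' y' s t : adj x y -> adj x' y' ->
  (s, t) \in ppairs (f x) (rcons (inner x y) (f y)) ->
  (s, t) \in ppairs (f x') (rcons (inner x' y') (f y')) -> (x, y) = (x', y').
Proof.
move=> xy xy' st st'; have [s1 t1] := ppairs_mem st; have [s2 t2] := ppairs_mem st'.
move: s1 s2 t1 t2; rewrite !belast_rcons !mem_rcons !inE.
have [Up pr fp] := p_path xy; have [Up' pr' fp'] := p_path xy'.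
have swap : [set x; y] = [set x'; y'] -> (x, y) = (x', y').
  move/eqP; rewrite set2_eqE /ew; case: orP => // -[] /andP[/eqP ex /eqP ey] _; first by rewrite ex ey.
  have /negP[] := ppairs_asym (inner_uniq xy) st.
  by move: st'; rewrite -ex -ey innerC ppairs_rev.
rewrite /inner xy xy' => /predU1P[sx|sp] /predU1P[sx'|sp'].
- have ex : x = x' by apply: f_inj; rewrite -sx.
  case/predU1P=> [ty|tp] /predU1P[ty'|tp'].
  + by rewrite ex; congr (_, _); apply: f_inj; rewrite -ty.
  + by move: tp'; rewrite ty (negPf (fp' _)).
  + by move: tp; rewrite ty' (negPf (fp _)).
  by move=> *; apply: swap; apply: p_disj tp tp'.
- by move: sp'; rewrite sx (negPf (fp' _)).
- by move: sp; rewrite sx' (negPf (fp _)).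
by move=> _ _; apply: swap; apply: p_disj sp sp'.
Qed.

Lemma subdivision_adj s t : adj s t = \sum_(x : G) \sum_(y : G | adj x y)
  count_mem (s, t) (ppairs (f x) (rcons (inner x y) (f y))) :> nat.
Proof.
have cnt x y : adj x y -> count_mem (s, t) (ppairs (f x) (rcons (inner x y) (f y))) =
    ((s, t) \in ppairs (f x) (rcons (inner x y) (f y))).
  by move=> /inner_uniq /ppairs_uniq /count_uniq_mem.
have [st|nst] := boolP (adj s t); last first.
  rewrite big1 // => x _; rewrite big1 // => y xy; rewrite cnt //.
  apply/eqP; rewrite eqb0; apply: contra nst => st; apply/p_adj; exists x, y.
  by rewrite infix_ppairs; move: st; rewrite /inner xy.
have [x [y [xy]]] := (p_adj s t).1 st; rewrite infix_ppairs => stp.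
have stxy : (s, t) \in ppairs (f x) (rcons (inner x y) (f y)) by rewrite /inner xy.
rewrite (bigD1 x) //= (bigD1 y) //= cnt // stxy !big1 // => [x' x'x|y' /andP[xy' y'y]].
  rewrite big1 // => y' xy'; rewrite cnt //; apply/eqP; rewrite eqb0.
  apply: contra x'x => st'; have [-> _] := inner_pair_inj xy xy' stxy st'.
  by rewrite eqxx.
rewrite cnt //; apply/eqP; rewrite eqb0.
apply: contra y'y => st'; have [->] := inner_pair_inj xy xy' stxy st'.
by rewrite eqxx.
Qed.

Lemma dsum_subdivision F : dsum (@adj S) F = dsum (@adj G) (seg f inner F).
Proof.
rewrite dsumE /dsum.
transitivity (\sum_(x : G) \sum_(y : G | adj x y) \sum_s \sum_t
   count_mem (s, t) (ppairs (f x) (rcons (inner x y) (f y))) * F s t).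
  rewrite [RHS](eq_bigr _ (fun x _ => exchange_big _ _ _ _ _ _)) /= [RHS]exchange_big.
  apply: eq_bigr => s _.
  rewrite [RHS](eq_bigr _ (fun x _ => exchange_big _ _ _ _ _ _)) /= [RHS]exchange_big.
  apply: eq_bigr => t _.
  rewrite subdivision_adj big_distrl; apply: eq_bigr => x _; rewrite big_distrl.
  by [].
apply: eq_bigr => x _; apply: eq_bigr => y _.
by rewrite sum_count_pairs /seg psum_ppairs.
Qed.

Lemma segC_inner F : commutative F -> commutative (seg f inner F).
Proof. by move=> FC; apply: segC => // x y; apply: innerC. Qed.

Lemma esum_subdivision F : esum F = esum (seg f inner F).
Proof. by rewrite /esum dsum_subdivision. Qed.

(** By [csum_ew_le1] no edge of [G] repeats on the cycle, so the paths that replace its edges have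
    disjoint interiors. *)
Lemma rcycle_uniq c : 2 < size c -> uniq c -> cycle (@adj G) c -> uniq (rcycle f inner c).
Proof.
move=> c3 Uc cc; rewrite (perm_uniq (perm_rcycle _ _ _)) cat_uniq map_inj_uniq // Uc /=.
have cadj : all (fun z => adj z.1 z.2) (cpairs c) by rewrite -cycle_cpairs.
have Uset : uniq [seq [set z.1; z.2] | z <- cpairs c].
  apply: count_mem_uniq => B; rewrite count_map.
  have [BE|nB] := boolP (B \in _); last first.
    by rewrite -count_map (count_memPn nB).
  have [z zc ->] := mapP BE; have := csum_ew_le1 z.1 z.2 c3 Uc; rewrite csum_cpairs.
  have -> : \sum_(w <- cpairs c) ew z.1 z.2 w.1 w.2 =
      count (preim (fun z => [set z.1; z.2]) (pred1 [set z.1; z.2])) (cpairs c).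
    rewrite -sum1_count [RHS]big_mkcond; apply: eq_bigr => w _ /=.
    by rewrite set2_eqE /ew; case: (_ || _).
  have : 0 < count (preim (fun z => [set z.1; z.2]) (pred1 [set z.1; z.2])) (cpairs c).
    by rewrite -has_count; apply/hasP; exists z; rewrite /=.
  by case: (count _ _) => [|[]].
apply/andP; split.
  apply/hasPn => s /flatten_mapP[z /(allP cadj) zadj]; rewrite /inner zadj => sp.
  have [_ _ fp] := p_path zadj.
  by apply/negP => /mapP[x _ sx]; move: sp; rewrite sx (negPf (fp x)).
elim: (cpairs c) cadj Uset => //= z r IH /andP[zadj radj] /andP[zr Ur].
rewrite cat_uniq IH // andbT; have [Up _ _] := p_path zadj; rewrite {1}/inner zadj Up /=.
apply/hasPn => s /flatten_mapP[z' z'r]; have z'adj := allP radj z' z'r.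
rewrite /inner z'adj zadj => sp'; apply: contra zr => sp.
by apply/mapP; exists z' => //; apply: p_disj sp sp'.
Qed.

(** The sign given to an edge of [G] is the length of its path in [S]. *)
Lemma subdivision_decomposable : signed_decomposable G -> ~~ odd #|edges S| ->
  even_cycle_decomposable S.
Proof.
move=> Gdec; rewrite card_edges esum_subdivision => even_S.
have [L Le LF] := Gdec _ (segC_inner (F := fun _ _ => 1) (fun _ _ => erefl)) even_S.
apply/even_cycle_decomposableP; exists [seq rcycle f inner c | c <- L] => [|F FC].
  rewrite all_map; apply/allP => c cL /=; have /and3P[c3 Uc ec] := allP Le c cL.
  rewrite /even_cycle (leq_trans c3 (size_rcycle _ _ _)) csum_rcycle ec andbT.
  by apply: rcycle_uniq => //; apply: decomposition_cycle LF cL.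
rewrite esum_subdivision LF ?big_map; last exact: segC_inner.
by apply: eq_bigr => c _; rewrite csum_rcycle.
Qed.

End Subdivisions.

Lemma signed_strongly_decomposable (G : sgraph) :
  signed_decomposable G -> strongly_even_cycle_decomposable G.
Proof.
move=> Gdec S [f [p [f_inj [p_path [p_disj [_ p_adj]]]]]].
exact: subdivision_decomposable f_inj p_path p_disj p_adj Gdec.
Qed.

(** * From subdivisions back to signs *)

Section HalfSubdivision.
Variables (G : sgraph) (s : G -> G -> nat).
Hypothesis sC : commutative s.

(** Each edge of even sign, in one orientation. Subdividing exactly these once gives paths of length
    1 or 2 whose parity is that of the sign. *)
Definition is_even_edge (z : G * G) :=
  [&& adj z.1 z.2, enum_rank z.1 < enum_rank z.2 & ~~ odd (s z.1 z.2)].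

Definition half_vert : finType := (G + {z | is_even_edge z})%type.

Definition half_adj (a b : half_vert) : bool :=
  match a, b with
  | inl x, inl y => adj x y && odd (s x y)
  | inl x, inr z => (x == (val z).1) || (x == (val z).2)
  | inr z, inl x => (x == (val z).1) || (x == (val z).2)
  | inr _, inr _ => false
  end.

Lemma half_sym : symmetric half_adj.
Proof. by move=> [x|z] [y|w] //=; rewrite adj_sym sC. Qed.

Lemma half_irrefl : irreflexive half_adj.
Proof. by move=> [x|z] //=; rewrite adj_irrefl. Qed.

Definition half_graph := SGraph half_sym half_irrefl.

Definition half_path (x y : G) : seq half_graph :=
  if insub (x, y) is Some z then [:: inr z] else
  if insub (y, x) is Some z then [:: inr z] else [::].

Variant half_path_spec x y : seq half_graph -> Prop :=
  | HalfDirect of odd (s x y) : half_path_spec x y [::]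
  | HalfForward z of val z = (x, y) & ~~ odd (s x y) : half_path_spec x y [:: inr z]
  | HalfBackward z of val z = (y, x) & ~~ odd (s x y) : half_path_spec x y [:: inr z].

Lemma half_pathP x y : adj x y -> half_path_spec x y (half_path x y).
Proof.
move=> xy; rewrite /half_path; case: insubP => [z /and3P[_ _ exy] zE|].
  by apply: HalfForward.
case: insubP => [z /and3P[_ _ eyx] zE _|].
  by apply: HalfBackward; rewrite // sC.
rewrite /is_even_edge /= [adj y x]adj_sym xy [s y x]sC /= => nyx nxy.
apply: HalfDirect; case: ltngtP nxy nyx => //= [_|_|/val_inj/enum_rank_inj exy]; rewrite ?negbK //.
by rewrite exy adj_irrefl in xy.
Qed.

Lemma half_pathC x y : adj x y -> half_path y x = half_path x y.
Proof.
rewrite /half_path => xy; case: insubP => [z /and3P[/= _ yx _]|_] //; case: insubP => //.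
by move=> w /and3P[/= _ xy' _]; move: (ltn_trans yx xy'); rewrite ltnn.
Qed.

Lemma half_path_mem x y w : adj x y -> w \in half_path x y ->
  exists2 z, w = inr z & (val z = (x, y) \/ val z = (y, x)).
Proof.
by case/half_pathP => // z zE _; rewrite inE => /eqP->; exists z; auto.
Qed.

Lemma half_subdivides : subdivides (inl : G -> half_graph) half_path.
Proof.
split; first by move=> x y [].
split.
  move=> x y xy; rewrite (half_pathC xy).
  by case: (half_pathP xy).
split.
  move=> x y x' y' w xy xy' /(half_path_mem xy)[z -> zE] /(half_path_mem xy')[z' [<-] zE'].
  by case: zE zE' => -> [] [-> ->] //; rewrite setUC.
split.
  case=> [x|z]; first by left; exists x.
  right; have /and3P[zadj _ _] := valP z; exists (val z).1, (val z).2; split=> //.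
  by rewrite /half_path -surjective_pairing valK inE.
move=> a b; split.
  case: a b => [x|z] [y|w] //.
  - move=> /andP[xy oxy]; exists x, y; split=> //; case: (half_pathP xy) => [_|? _ /negP//|? _ /negP//].
    rewrite infix_ppairs; exact: mem_head.
  - have /and3P[wadj _ _] := valP w; case/orP=> /eqP->.
      exists (val w).1, (val w).2; split=> //; rewrite /half_path -surjective_pairing valK.
      by rewrite infix_ppairs /= !inE eqxx.
    exists (val w).2, (val w).1; rewrite adj_sym (half_pathC wadj); split=> //.
    by rewrite /half_path -surjective_pairing valK infix_ppairs /= !inE eqxx.
  - have /and3P[zadj _ _] := valP z; case/orP=> /eqP->.
      exists (val z).2, (val z).1; rewrite adj_sym (half_pathC zadj); split=> //.
      by rewrite /half_path -surjective_pairing valK infix_ppairs /= !inE eqxx orbT.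
    exists (val z).1, (val z).2; split=> //; rewrite /half_path -surjective_pairing valK.
    by rewrite infix_ppairs /= !inE eqxx orbT.
case=> x [y [xy]]; rewrite infix_ppairs.
case: (half_pathP xy) => [oxy|z zE _|z zE _] /=; rewrite !inE.
- by case/eqP=> -> ->; rewrite /= xy oxy.
- by case/orP=> /eqP[-> ->] /=; rewrite zE eqxx ?orbT.
by case/orP=> /eqP[-> ->] /=; rewrite zE eqxx ?orbT.
Qed.

Definition left_vert (a : half_graph) : option G := if a is inl x then Some x else None.

Definition contract (c : seq half_graph) : seq G := pmap left_vert c.

(* The whole weight of a subdivided edge is put on one of its two halves. *)
Definition half_weight (F : G -> G -> nat) (a b : half_graph) : nat :=
  match a, b with
  | inl x, inl y => F x y
  | inl x, inr z | inr z, inl x => if x == (val z).1 then F (val z).1 (val z).2 else 0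
  | inr _, inr _ => 0
  end.

Lemma half_weightC F : commutative F -> commutative (half_weight F).
Proof. by move=> FC [x|z] [y|w] /=. Qed.

Lemma half_ends (z : {z | is_even_edge z}) : (val z).1 != (val z).2.
Proof. by have /and3P[+ _ _] := valP z; apply: contraTneq => ->; rewrite adj_irrefl. Qed.

Lemma half_weight_through F x z y : commutative F -> half_adj (inl x) (inr z) ->
  half_adj (inr z) (inl y) -> x != y ->
  half_weight F (inl x) (inr z) + half_weight F (inr z) (inl y) = F x y.
Proof.
move=> FC /= /orP[]/eqP-> /orP[]/eqP->; rewrite ?eqxx // => _.
  by rewrite eq_sym (negPf (half_ends z)) addn0.
by rewrite eq_sym (negPf (half_ends z)) FC.
Qed.

Lemma contract_left r y : contract (rcons r (inl y)) = rcons (contract r) y.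
Proof. by rewrite -!cats1 /contract pmap_cat. Qed.

Lemma contract_right r z : contract (rcons r (inr z)) = contract r.
Proof. by rewrite -cats1 /contract pmap_cat cats0. Qed.

Lemma last_contract x y r : last (inl x : half_graph) r = inl y -> last x (contract r) = y.
Proof.
case/lastP: r => [[]|r a] //; rewrite last_rcons => ->.
by rewrite contract_left last_rcons.
Qed.

Lemma psum_contract F x (r : seq half_graph) : commutative F ->
  path half_adj (inl x) r -> uniq (inl x :: r : seq half_graph) ->
  left_vert (last (inl x) r) ->
  psum (half_weight F) (inl x) r = psum F x (contract r).
Proof.
move=> FC; have [n] := ubnP (size r); elim: n r x => // n IH [|[y|z] r] x //= lt_r.
  move=> /andP[_ yr] /andP[_ Ur] lr; rewrite -(IH r y) //.
case: r lt_r => [_ _ _ //|[y|w] r lt_r]; last by rewrite /= andbF.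
move=> /= /and3P[xz zy yr] /and3P[xr _ Ur] lr.
rewrite addnA half_weight_through //; first by rewrite -(IH r y) // ltnW.
by apply: contra xr => /eqP->; rewrite !inE eqxx orbT.
Qed.

Lemma left_in_cycle (c : seq half_graph) : 2 < size c -> cycle half_adj c ->
  exists x, inl x \in c.
Proof.
case: c => [|[x|z] [|[y|w] c]] //= _ _; first by exists x; rewrite mem_head.
  by exists x; rewrite mem_head.
by exists y; rewrite !inE eqxx orbT.
Qed.

Lemma csum_contract F (c : seq half_graph) : commutative F -> 2 < size c -> uniq c ->
  cycle half_adj c -> csum (half_weight F) c = csum F (contract c).
Proof.
move=> FC c3 Uc cc.
have [x xc] := left_in_cycle c3 cc.
have [i r cE] := rot_to xc.
have pE : csum F (contract c) = csum F (contract (inl x :: r)).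
  by rewrite -cE /contract /rot pmap_cat csum_cat -pmap_cat cat_take_drop.
rewrite pE -(csum_rot _ i) cE; move: c3 Uc cc; rewrite -(size_rot i) -(rot_uniq i) -(rot_cycle i) cE.
move=> {pE cE xc i c}.
case/lastP: r => // r [y|z] c3 Uc cc.
  have -> : csum F (contract (inl x :: rcons r (inl y))) =
      psum F x (rcons (contract (rcons r (inl y))) x) by [].
  rewrite contract_left psum_rcons last_rcons -contract_left.
  rewrite -[csum _ _]/(psum _ (inl x) (rcons (rcons r (inl y)) (inl x))).
  rewrite psum_rcons last_rcons psum_contract // ?last_rcons //.
  by move: cc; rewrite /= rcons_path => /andP[].
have /andP[/andP[rp rz] zx] : path half_adj (inl x) r && half_adj (last (inl x) r) (inr z) &&
    half_adj (inr z) (inl x) by move: cc; rewrite /= !rcons_path last_rcons.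
move: Uc; rewrite -rcons_cons rcons_uniq => /andP[zr Ur].
case lr : (last (inl x) r) rz => [y|//] rz.
have -> : csum F (contract (inl x :: rcons r (inr z))) =
    psum F x (rcons (contract (rcons r (inr z))) x) by [].
rewrite contract_right psum_rcons (last_contract lr).
rewrite -[csum _ _]/(psum _ (inl x) (rcons (rcons r (inr z)) (inl x))).
rewrite 2!psum_rcons last_rcons lr.
rewrite psum_contract ?lr // -addnA half_weight_through //.
apply: contraTneq Ur => yx; case/lastP: r lr c3 {cc rp zr} => // r a.
by rewrite last_rcons => -> _; rewrite yx /= mem_rcons mem_head.
Qed.

Lemma odd_csum (T : Type) (e : rel T) (F F' : T -> T -> nat) (c : seq T) : cycle e c ->
  (forall a b, e a b -> odd (F a b) = odd (F' a b)) -> odd (csum F c) = odd (csum F' c).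
Proof.
move=> + FF'; case: c => //= x p; move: (rcons p x) => q.
elim: q x => //= y q IH z /andP[zy /IH {}IH].
by rewrite !oddD IH FF'.
Qed.

(** Modulo 2, the weight of an edge plus 1 is the number of its ends that are subdividing vertices.
    Round a cycle these numbers have an even sum, so weight and length agree in parity. *)
Lemma odd_contract c : 2 < size c -> uniq c -> cycle half_adj c ->
  odd (csum s (contract c)) = odd (size c).
Proof.
move=> c3 Uc cc; rewrite -csum_contract // -[size c]mul1n -csum_const.
pose g (a : half_graph) : nat := if a is inr _ then 1 else 0.
have par : odd (csum (fun a b => half_weight s a b + 1) c) = odd (csum (fun a b => g a + g b) c).
  apply: odd_csum cc _ => [[x|z] [y|w]] //=.
  - by move=> /andP[_ oxy]; rewrite addn1 /= oxy.
  - by have /and3P[_ _ /negPf ew] := valP w; case: ifP; rewrite oddD ?ew.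
  by have /and3P[_ _ /negPf ez] := valP z; case: ifP; rewrite oddD ?ez.
move: par; rewrite csumD csum_vertex odd_double oddD.
by case: (odd _); case: (odd _).
Qed.

End HalfSubdivision.

Lemma strongly_decomposable_signed (G : sgraph) :
  strongly_even_cycle_decomposable G -> signed_decomposable G.
Proof.
move=> Gdec s sC even_s.
have Ssub := half_subdivides sC; set S := half_graph sC in Ssub.
have [f_inj [p_path [p_disj [_ p_adj]]]] := Ssub.
have esumS F : commutative F -> @esum S (@half_weight _ _ sC F) = esum F.
  move=> FC; rewrite (esum_subdivision f_inj p_path p_disj p_adj); apply: eq_esum => x y xy.
  rewrite /seg /inner xy; case: (half_pathP sC xy) => [_|z zE _|z zE _] /=; rewrite ?addn0 //.
    by rewrite zE eqxx; case: eqP => [yx|]; rewrite ?addn0 //; move: xy; rewrite yx adj_irrefl.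
  by rewrite zE eqxx [F y x]FC; case: eqP => // yx; move: xy; rewrite yx adj_irrefl.
have /even_cycle_decomposableP[L Le LF] : even_cycle_decomposable S.
  apply: Gdec; first by exists inl, (half_path sC).
  rewrite card_edges (esum_subdivision f_inj p_path p_disj p_adj).
  rewrite (odd_esum (F' := s)) // => [|x y xy].
    exact: (segC_inner p_path (F := fun _ _ => 1)).
  rewrite /seg /inner xy; case: (half_pathP sC xy) => [->|z _ /negPf->|z _ /negPf->] //.
have Lok c : c \in L -> [/\ 2 < size c, uniq c, cycle (@adj S) c & ~~ odd (size c)].
  move=> cL; have /and3P[c3 Uc] := allP Le c cL; rewrite csum_const mul1n => ec.
  by split=> //; apply: decomposition_cycle LF cL.
have LF' F : commutative F -> esum F = \sum_(c <- [seq contract c | c <- L]) csum F c.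
  move=> FC; rewrite -esumS // LF; last exact: half_weightC.
  rewrite big_map !big_seq; apply: eq_bigr => c /Lok[c3 Uc cc _].
  by rewrite csum_contract.
exists [seq contract c | c <- L] => //; rewrite all_map; apply/allP => c cL /=.
have [c3 Uc cc ec] := Lok c cL; apply/and3P; split; last by rewrite odd_contract.
  (* No edge is covered twice and loops have weight 0. This excludes contracted cycles of length 1,
     a loop, and of length 2, an edge run twice. *)
  have le_adj u v : csum (ew u v) (contract c) <= adj u v.
    by rewrite -(decomposition_weights LF' u v) (big_rem (contract c)) ?map_f //= leq_addr.
  have [x xc] := left_in_cycle c3 cc.
  have : x \in contract c by rewrite mem_pmap; apply/mapP; exists (inl x).
  case: (contract c) le_adj => [|a [|b [|]]] // le_adj _.
    by have := le_adj a a; rewrite /= /ew !eqxx adj_irrefl.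
  by have := le_adj a b; rewrite /= /ew !eqxx orbT; case: (adj a b).
apply: (pmap_uniq (g := inl)) => //; by case.
Qed.

(** * Substitution *)

Section SubstitutionWeights.
Variables (G : sgraph) (v : G) (H : sgraph) (h0 : H).
Local Notation GH := (substitution v H).
Implicit Types (F : GH -> GH -> nat) (x y : G) (c q : seq G).

(** The vertex [v] goes to the default [h0], a vertex of [H], so the map is total and still
    injective. *)
Definition lift_vert x : GH := if insub x is Some u then inl u else inr h0.

Lemma lift_val (u : {x : G | x != v}) : lift_vert (val u) = inl u.
Proof. by rewrite /lift_vert valK. Qed.

Lemma lift_vert_inj : injective lift_vert.
Proof.
move=> x y; rewrite /lift_vert; case: insubP => [u _ <-|/negPn/eqP->]; case: insubP => [w _ <-|/negPn/eqP->] //.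
by case=> ->.
Qed.

Lemma lift_vert_left x k : x != v -> lift_vert x != inr k.
Proof. by move=> xv; rewrite /lift_vert insubT. Qed.

(* An edge [vy] of [G] stands for all the edges from [y] to [H]. *)
Definition pull F x y : nat :=
  if x == v then if y == v then 0 else \sum_(h : H) F (inr h) (lift_vert y)
  else if y == v then \sum_(h : H) F (inr h) (lift_vert x)
  else F (lift_vert x) (lift_vert y).

Lemma pullC F : commutative F -> commutative (pull F).
Proof. by move=> FC x y; rewrite /pull; case: eqP => _; case: eqP => _. Qed.

Lemma sum_not_v (g : G -> nat) : \sum_(x | x != v) g x = \sum_(u : {x : G | x != v}) g (val u).
Proof.
rewrite (reindex_omap (val : {x : G | x != v} -> G) insub); last by move=> x xv; rewrite insubT.
by apply: eq_bigl => u; rewrite (valP u) valK eqxx.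
Qed.

Lemma esum_substitution F : commutative F ->
  @esum GH F = esum (pull F) + @esum H (fun h k => F (inr h) (inr k)).
Proof.
move=> FC; apply: double_inj; rewrite doubleD !esumK //; last exact: pullC.
rewrite !dsumE big_sumType /=.
under eq_bigr => u _ do rewrite big_sumType /=.
under [X in _ + X = _]eq_bigr => h _ do rewrite big_sumType /=.
rewrite !big_split /= addnA; congr (_ + _).
rewrite [RHS](bigD1 v) //= (bigD1 v) //= adj_irrefl mul0n add0n.
have -> : \sum_(y | y != v) adj v y * pull F v y =
    \sum_(h : H) \sum_(u : {x : G | x != v}) adj v (val u) * F (inr h) (inl u).
  rewrite sum_not_v exchange_big; apply: eq_bigr => u _.
  by rewrite /pull eqxx (negPf (valP u)) lift_val big_distrr.
rewrite addnC; congr (_ + _); rewrite sum_not_v -big_split; apply: eq_bigr => u _ /=.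
rewrite (bigD1 v) //= addnC; congr (_ + _).
  rewrite /pull (negPf (valP u)) eqxx lift_val big_distrr; apply: eq_bigr => h _.
  by rewrite adj_sym [F (inl u) _]FC.
rewrite sum_not_v; apply: eq_bigr => w _.
by rewrite /pull (negPf (valP u)) (negPf (valP w)) !lift_val.
Qed.

Definition new_verts : seq GH := [seq inr h | h <- enum H].

Lemma sum_new_verts (g : GH -> nat) : \sum_(a <- new_verts) g a = \sum_(h : H) g (inr h).
Proof. by rewrite big_map big_enum. Qed.

Lemma pull_avoiding F c : v \notin c -> csum (pull F) c = csum F (map lift_vert c).
Proof.
move=> vc; rewrite csum_map; apply: (@eq_in_csum _ (predC1 v)) => [x y /negPf xv /negPf yv|].
  by rewrite /pull xv yv.
by apply/allP => x xc; apply: contraNneq vc => <-.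
Qed.

(** The positivity clauses record that [v x] and [v y] are edges of [c]; later they keep the ends of
    two pieces apart. *)
Lemma pull_through c : 2 < size c -> uniq c -> v \in c ->
  exists x y q, [/\ uniq (lift_vert y :: lift_vert x :: map lift_vert q ++ new_verts),
    0 < csum (ew v x) c, 0 < csum (ew v y) c &
    forall F, commutative F -> csum (pull F) c =
      outer (lift_vert y) (lift_vert x) (map lift_vert q) F +
      \sum_(a <- new_verts) spoke_sum (lift_vert y) (lift_vert x) F a].
Proof.
move=> c3 Uc /rot_to[i r cE].
have rE (F : G -> G -> nat) : csum F c = csum F (v :: r) by rewrite -cE csum_rot.
move: c3 Uc; rewrite -(size_rot i) -(rot_uniq i) cE {cE i}.
case: r rE => [|x r] // rE; case/lastP: r rE => [|q y] // rE _ Uc.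
exists x, y, q.
have [vr Ur] : v \notin x :: rcons q y /\ uniq (x :: rcons q y) by apply/andP.
have neq z : z \in x :: rcons q y -> z != v by move=> zr; apply: contraNneq vr => <-.
have xv : x != v by apply: neq; rewrite mem_head.
have yv : y != v by apply: neq; rewrite inE mem_rcons mem_head orbT.
have sE (F : G -> G -> nat) : csum F c = F v x + psum F x (rcons q y) + F y v.
  by rewrite rE /= psum_rcons last_rcons addnA.
split.
- have : uniq (map lift_vert (y :: x :: q) ++ new_verts).
    rewrite cat_uniq map_inj_uniq; last exact: lift_vert_inj.
    have -> : uniq (y :: x :: q).
      have : uniq (rcons (x :: q) y) := Ur.
      by rewrite rcons_uniq.
    rewrite map_inj_uniq ?enum_uniq; last by move=> ? ? [].
    rewrite andbT; apply/hasPn => a /mapP[h _ ->]; apply/negP => /mapP[z zq].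
    move/eqP; rewrite eq_sym; apply/negP/lift_vert_left/neq.
    by move: zq; rewrite !inE mem_rcons inE orbCA.
  by [].
- by rewrite sE /ew !eqxx.
- by rewrite sE /ew !eqxx orbT addn1.
move=> F FC; rewrite sE /outer -map_rcons psum_map sum_new_verts.
rewrite (eq_in_psum (P := predC1 v) (F' := fun u w => F (lift_vert u) (lift_vert w))); last first.
- by apply/allP => z /neq.
- by move=> z w /negPf zv /negPf wv; rewrite /pull zv wv.
have turn a : \sum_(h : H) F (inr h) a = \sum_(h : H) F a (inr h) by apply: eq_bigr.
rewrite /pull eqxx (negPf xv) (negPf yv) !turn /spoke_sum big_split /=.
by rewrite addnAC addnC [X in _ + X]addnC.
Qed.

End SubstitutionWeights.

(** * Assembling the decomposition of the substitution *)

Lemma esumM (G : sgraph) a (F : G -> G -> nat) : commutative F ->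
  esum (fun x y => a * F x y) = a * esum F.
Proof.
move=> FC; apply: double_inj; rewrite doubleMr !esumK //; last first.
  by move=> x y; rewrite FC.
rewrite !dsumE big_distrr; apply: eq_bigr => x _; rewrite big_distrr; apply: eq_bigr => y _ /=.
by rewrite mulnCA.
Qed.

Lemma graph_even_degrees (G : sgraph) : eulerian G -> even_degrees (@adj G).
Proof. by move=> eG x; have := eG x; rewrite /deg cardsE. Qed.

Lemma graph_decomposition (H : sgraph) (s : H -> H -> nat) : commutative s -> eulerian H ->
  exists L0 L, [/\ all (even_cycle s) L0, cactus L, all (fun c => odd (csum s c)) L &
    forall F, commutative F -> esum F = \sum_(c <- L0) csum F c + \sum_(c <- L) csum F c].
Proof.
move=> sC eH; have [L0 [L [L0e Lc Lo LF]]] :=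
  eulerian_decomposition (@adj_sym H) (@adj_irrefl H) sC (graph_even_degrees eH).
by exists L0, L; split=> // F FC; rewrite /esum LF // doubleK.
Qed.

Lemma esum_degree (G : sgraph) (v : G) : esum (fun x y => (x == v) + (y == v)) = deg v.
Proof.
apply: double_inj; rewrite esumK => [|x y]; last exact: addnC.
rewrite /deg cardsE degree_dsum !dsumE -addnn.
have {2}-> : \sum_x \sum_y adj x y * (x == v) = \sum_x \sum_y adj x y * (y == v).
  by rewrite exchange_big; apply: eq_bigr => x _; apply: eq_bigr => y _; rewrite adj_sym.
rewrite -big_split; apply: eq_bigr => x _; rewrite -big_split; apply: eq_bigr => y _ /=.
by rewrite mulnDr.
Qed.

(** With at most three vertices a cycle covers them all, so a second cycle would meet the first in
    three vertices. *)
Lemma small_cactus (H : sgraph) (L : seq (seq H)) : #|H| <= 3 -> cactus L -> L != [::] ->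
  exists h k l, L = [:: [:: h; k; l]] /\ perm_eq (enum H) [:: h; k; l].
Proof.
case: L => // c L H3 /and4P[c3 Uc le1 Lc] _.
have cH : perm_eq (enum H) c.
  rewrite perm_sym; apply: uniq_perm; rewrite ?enum_uniq // => x.
  have /(uniq_min_size Uc) : {subset c <= enum H} by move=> y; rewrite mem_enum.
  by rewrite -cardE (leq_trans H3 c3) => /(_ isT)[_ ->].
have L0 : L = [::].
  case: L le1 Lc => // d L le1 /and4P[d3 Ud _ _].
  have : size d <= 1.
    apply: leq_trans le1; move/permP: cH => <-; rewrite -size_filter.
    apply: uniq_leq_size => // y yd; rewrite mem_filter mem_enum andbT /=.
    by rewrite mem_cat yd.
  by rewrite leqNgt (ltn_trans _ d3).
have sc : size c = 3.
  by apply/eqP; rewrite eqn_leq c3 andbT -(perm_size cH) -cardE.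
case: c sc cH {c3 Uc le1} => [|h [|k [|l []]]] // _ cH.
by exists h, k, l; rewrite L0.
Qed.

Lemma triangle_isomorphic (H : sgraph) (h k l : H) : perm_eq (enum H) [:: h; k; l] ->
  adj h k -> adj k l -> adj l h -> isomorphic H (complete 3).
Proof.
move=> pH hk kl lh; have cH : #|H| = 3 by rewrite cardE (perm_size pH).
have full (x y : H) : adj x y = (x != y).
  have mem3 z : z \in [:: h; k; l] by rewrite -(perm_mem pH) mem_enum.
  have [->|xy] := eqVneq x y; first by rewrite adj_irrefl.
  move: (mem3 x) (mem3 y) xy; rewrite !inE.
  by move=> /or3P[]/eqP-> /or3P[]/eqP->; rewrite ?eqxx // adj_sym.
exists (fun x => cast_ord cH (enum_rank x)).
  exists (fun i => enum_val (cast_ord (esym cH) i)) => x.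
    by rewrite cast_ordK enum_rankK.
  by rewrite enum_valK cast_ordKV.
move=> x y; rewrite full /adj /= /complete_adj.
by rewrite (inj_eq (@cast_ord_inj _ _ cH)) (inj_eq enum_rank_inj).
Qed.

Lemma cactus_map (T U : eqType) (f : T -> U) L : injective f ->
  cactus (map (map f) L) = cactus L.
Proof.
move=> f_inj; elim: L => //= c L ->; rewrite size_map map_inj_uniq // -map_flatten count_map.
by do 3 congr (_ && _); congr (_ <= _); apply: eq_count => x /=; rewrite mem_map.
Qed.

Lemma substitution_signed (G : sgraph) (v : G) (H : sgraph) :
  signed_decomposable G -> ~ isolated v -> eulerian H -> odd #|H| ->
  ~ isomorphic H (complete 3) \/ 4 <= deg v -> signed_decomposable (substitution v H).
Proof.
move=> Gdec v_nbr eH oH H3 s sC even_s; set GH := substitution v H in s sC even_s *.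
have [h0 _] : exists h0 : H, true.
  by case: (pickP H) => [h _|noH]; [exists h | rewrite eq_card0 in oH].
have [y0 vy0] : exists y0, adj v y0.
  by have [/existsP//|/existsPn] := boolP [exists y, adj v y].
pose sH h k := s (inr h) (inr k).
have sHC : commutative sH by move=> h k; apply: sC.
have [L0 [L [L0e Lc Lo LF]]] := graph_decomposition sHC eH.
pose sG := pull h0 s; have sGC : commutative sG := pullC h0 sC.
pose a := esum sH.
(* Adding [a], the total sign of [H], is a flip exactly when [a] is odd. The total sign on [G] thus
   becomes that of the substitution. *)
pose sG' x y := sG x y + a * ew v y0 x y.
have sG'C : commutative sG' by move=> x y; rewrite /sG' sGC ewC.
have even_G : ~~ odd (esum sG').
  have ewyC : commutative (fun x y : G => a * ew v y0 x y) by move=> x y; rewrite ewC.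
  rewrite (esumD sGC ewyC) (esumM a (@ewC _ v y0)) esum_ew vy0 muln1.
  by move: even_s; rewrite (esum_substitution h0).
have [LG LGe LGF] := Gdec sG' sG'C even_G.
have LGW := decomposition_weights LGF.
have [c0 c0L c0y] : exists2 c, c \in LG & csum (ew v y0) c != 0.
  have := LGW v y0; rewrite vy0 => W.
  have [/hasP[c cL cy]|] := boolP (has (fun c => csum (ew v y0) c != 0) LG); first by exists c.
  rewrite -all_predC => /allP none; move: W; rewrite big1_seq // => c /andP[_ /none].
  by rewrite /= negbK => /eqP.
have pLG := perm_to_rem c0L; set L1 := rem c0 LG in pLG.
have LGok c : c \in LG -> [/\ 2 < size c, uniq c & ~~ odd (csum sG c + a * csum (ew v y0) c)].
  by move=> /(allP LGe)/and3P[c3 Uc]; rewrite /sG' csumD csumM.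
have L1sub : {subset L1 <= LG} by move=> c; apply: mem_rem.
(* The edge [v y0] is covered once, so the flip affects [c0] and no other cycle. *)
have [c01 L1y] : csum (ew v y0) c0 = 1 /\ {in L1, forall c, csum (ew v y0) c = 0}.
  have := LGW v y0; rewrite vy0 (perm_big _ pLG) big_cons /=.
  have [c3 Uc _] := LGok c0 c0L; have := csum_ew_le1 v y0 c3 Uc.
  case: (csum (ew v y0) c0) c0y => [|[|n]] // _ _; rewrite add1n => -[/eqP].
  rewrite sum_nat_seq_eq0 => /allP none; split=> // c /none /eqP.
  by [].
have c0_odd : odd (csum sG c0) = odd a.
  by have [_ _] := LGok c0 c0L; rewrite c01 muln1 oddD; case: (odd _); case: (odd _).
have L1even c : c \in L1 -> ~~ odd (csum sG c).
  by move=> cL1; have [_ _] := LGok c (L1sub c cL1); rewrite L1y // muln0 addn0.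
(* The cycles of [L0] are even, so those of [L] carry the parity of [a] and restore evenness
   together with [c0]. *)
have a_odd : odd a = odd (\sum_(c <- L) csum sH c).
  rewrite /a LF // oddD [odd (\sum_(c <- L0) _)](_ : _ = false) //.
  apply/negbTE; elim: L0 L0e {LF} => [|c L0' IH] /=; first by rewrite big_nil.
  by case/andP=> /and3P[_ _ ec] /IH e0; rewrite big_cons oddD (negPf ec).
pose up (c : seq H) : seq GH := map inr c.
have upE F c : csum F (up c) = csum (fun h k => F (inr h) (inr k)) c by rewrite csum_map.
have uniq_up c : uniq (up c) = uniq c by apply: map_inj_uniq => ? ? [].
have sumL F : \sum_(d <- map up L) csum F d = \sum_(d <- L) csum (fun h k => F (inr h) (inr k)) d.
  by rewrite big_map; apply: eq_bigr => d _; rewrite upE.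
have total F : commutative F -> esum F =
    csum (pull h0 F) c0 + \sum_(d <- map up L) csum F d +
    \sum_(c <- L1) csum (pull h0 F) c + \sum_(c <- map up L0) csum F c.
  move=> FC; rewrite (esum_substitution h0) // LGF; last exact: pullC.
  rewrite (perm_big _ pLG) big_cons /= LF //.
  have -> : \sum_(c <- map up L0) csum F c = \sum_(c <- L0) csum (fun h k => F (inr h) (inr k)) c.
    by rewrite big_map; apply: eq_bigr => d _; rewrite upE.
  rewrite sumL [X in _ + X = _]addnC !addnA; congr (_ + _); exact: addnAC.
have dec_L0 : dec s (fun F => \sum_(c <- map up L0) csum F c).
  apply: (dec_sum (G := fun c F => csum F c)) => _ /mapP[c cL ->].
  apply: dec_cycle; have /and3P[c3 Uc ec] := allP L0e c cL.
  by rewrite /even_cycle size_map c3 uniq_up Uc upE.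
have sizeX : size (new_verts v H) = #|H| by rewrite size_map -cardE.
have dec_plain c : c \in L1 -> dec s (fun F => csum (pull h0 F) c).
  move=> cL1; have [c3 Uc _] := LGok c (L1sub c cL1); have ec := L1even c cL1.
  have [vc|vc] := boolP (v \in c); last first.
    apply: eq_dec (dec_cycle (c := map (lift_vert v h0) c) _) => [F _|].
      exact: pull_avoiding.
    rewrite /even_cycle size_map c3 map_inj_uniq ?Uc; last exact: lift_vert_inj.
    by rewrite -pull_avoiding.
  have [x [y [q [Uq _ _ pE]]]] := pull_through h0 c3 Uc vc.
  apply: (eq_dec pE); apply: dec_outer_spokes => //; first by rewrite sizeX.
  by rewrite -pE.
have vc0 : v \in c0 by apply: contraNT c0y => /csum_ew_notin ->.
have [c03 Uc0 _] := LGok c0 c0L.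
have [x [y [q [Uq vx vy pE]]]] := pull_through h0 c03 Uc0 vc0.
have main_even : ~~ odd (csum sG c0 + \sum_(d <- map up L) csum s d).
  by rewrite sumL oddD c0_odd a_odd addbb.
have upL : cactus (map up L) /\ all (fun d => odd (csum s d)) (map up L).
  split; first by rewrite cactus_map // => ? ? [].
  by rewrite all_map; apply: sub_all Lo => d; rewrite /= upE.
have [size_ok|] := boolP ((3 < #|H|) || (L == [::])).
  have d0 : dec s (fun F => csum (pull h0 F) c0 + \sum_(d <- map up L) csum F d).
    apply: (eq_dec (g := fun F => outer (lift_vert v h0 y) (lift_vert v h0 x) (map (lift_vert v h0) q) F +
      \sum_(b <- new_verts v H) spoke_sum (lift_vert v h0 y) (lift_vert v h0 x) F b +
      \sum_(d <- map up L) csum F d)) => [F FC|]; first by rewrite pE.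
    have [Lc' Lo'] := upL.
    apply: dec_piece => //.
    - by rewrite sizeX.
    - move=> b /flatten_mapP[d _ /mapP[h _ ->]]; apply: map_f; exact: mem_enum.
    - by rewrite sizeX; case: (L) size_ok.
    by rewrite -pE.
  apply: (eq_dec total); apply: decD dec_L0; apply: decD d0 _.
  by apply: (dec_sum (G := fun c F => csum (pull h0 F) c)).
rewrite negb_or -leqNgt => /andP[H_small L_ne].
have [h [k [l [LE pH]]]] := small_cactus H_small Lc L_ne.
have deg4 : 4 <= deg v.
  case: H3 => // [[]]; have adjL u w : csum (ew u w) [:: h; k; l] != 0 -> adj u w.
    have := LF (ew u w) (@ewC _ u w); rewrite esum_ew LE big_seq1.
    by case: (adj u w) => //; case: (csum _ _) => // n; rewrite addnS.
  by apply: (triangle_isomorphic pH); apply: adjL; rewrite /= /ew !eqxx ?orbT ?addnS.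
(* [c0] contains only two of the at least four edges at [v], and the cycles of [LG] cover them
   all. *)
have [c1 c1L1 vc1] : exists2 c, c \in L1 & v \in c.
  have [/hasP[c cL1 vc]|] := boolP (has (fun c => v \in c) L1); first by exists c.
  rewrite -all_predC => /allP none; move: deg4; rewrite -esum_degree LGF; last by move=> ? ?; apply: addnC.
  rewrite (perm_big _ pLG) big_cons /= big1_seq => [|c /andP[_ cL1]].
    rewrite addn0 (csum_vertex (fun u => u == v : nat)) -big_mkcond sum1_count /=.
    by rewrite (count_uniq_mem _ Uc0) vc0.
  rewrite (csum_vertex (fun u => u == v : nat)) big1_seq // => u /andP[_ uc].
  by apply/eqP; rewrite eqb0; apply: contraNneq (none c cL1) => <-.
have [c13 Uc1 _] := LGok c1 (L1sub c1 c1L1).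
have [x' [y' [q' [Uq' vx' vy' pE']]]] := pull_through h0 c13 Uc1 vc1.
have pL1 := perm_to_rem c1L1; set L2 := rem c1 L1 in pL1.
(* An edge at [v] lies on one cycle only, so [c0] and [c1] use different neighbours of [v], as the
   gadget requires. *)
have apart u w : 0 < csum (ew v u) c0 -> 0 < csum (ew v w) c1 -> u != w.
  move=> u0 w1; apply: contraTneq w1 => <-; rewrite -leqNgt leqn0.
  have := LGW v u; rewrite (perm_big _ pLG) big_cons /= (perm_big _ pL1) big_cons /=.
  move: u0; case: (csum _ c0) => // n _; case: (csum _ c1) => // m.
  by rewrite !addSn addnS; case: (adj _ _).
pose lv := lift_vert v h0.
have pX : perm_eq (new_verts v H) [:: inr h; inr k; inr l] by apply: (perm_map inr pH).
have split_uniq b c r : uniq (b :: c :: map lv r ++ new_verts v H) ->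
    uniq ([:: b; c; inr h; inr k; inr l] ++ map lv r).
  have -> : [:: b; c; inr h; inr k; inr l] ++ map lv r = b :: c :: [:: inr h; inr k; inr l] ++ map lv r by [].
  rewrite (perm_uniq (s2 := b :: c :: [:: inr h; inr k; inr l] ++ map lv r)) //.
  rewrite 2!perm_cons; apply: perm_trans (permEl (perm_catC _ _)) _.
  by rewrite perm_cat2r.
have pieceE r b c F : outer b c (map lv r) F + \sum_(z <- new_verts v H) spoke_sum b c F z =
    outer b c (map lv r) F + \sum_(z <- [:: inr h; inr k; inr l]) spoke_sum b c F z.
  by rewrite (perm_big _ pX).
have even1 := L1even c1 c1L1.
have d01 : dec s (fun F => csum (pull h0 F) c0 + csum (pull h0 F) c1 + \sum_(d <- map up L) csum F d).
  apply: eq_dec (dec_two_pieces_triangle (b := lv y) (c := lv x) (q := map lv q)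
    (b' := lv y') (c' := lv x') (q' := map lv q') sC _ (split_uniq _ _ _ Uq) (split_uniq _ _ _ Uq') _ _).
  - move=> F FC; rewrite pE // pE' // -/lv !pieceE LE /= big_seq1.
    by [].
  - have U1 := split_uniq _ _ _ Uq; have U2 := split_uniq _ _ _ Uq'.
    have {}U1 : uniq ([:: lv y; lv x] ++ [:: inr h; inr k; inr l]).
      by move: U1; rewrite cat_uniq => /and3P[].
    have {}U2 : uniq ([:: lv y'; lv x'] ++ [:: inr h; inr k; inr l]).
      by move: U2; rewrite cat_uniq => /and3P[].
    move: U1; rewrite !cat_uniq => /and3P[Uyx /hasPn new_yx _].
    rewrite -[uniq _]/(uniq ([:: lv y; lv x] ++ ([:: lv y'; lv x'] ++ [:: inr h; inr k; inr l]))).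
    rewrite cat_uniq Uyx U2 andbT; apply/hasPn => z; rewrite mem_cat => /orP[|/new_yx //].
    rewrite !inE => /orP[] /eqP->; rewrite /= !(inj_eq (@lift_vert_inj _ _ _ _)) negb_or.
      by rewrite ![y' == _]eq_sym !apart.
    by rewrite ![x' == _]eq_sym !apart.
  - by move: main_even; rewrite /sG pE // -/lv pieceE LE /= big_seq1.
  by move: even1; rewrite /sG pE' // -/lv pieceE.
apply: (dec_split (g1 := fun F => csum (pull h0 F) c0 + csum (pull h0 F) c1 + \sum_(d <- map up L) csum F d)
   sC (decD (dec_sum (G := fun c F => csum (pull h0 F) c) (r := L2) _) dec_L0) _ even_s _) => //.
  by move=> c cL2; apply: dec_plain; apply: mem_rem cL2.
move=> F FC; rewrite total // (perm_big _ pL1) big_cons /=.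
by rewrite -!addnA; congr (_ + _); exact: addnCA.
Qed.

Theorem theorem5p1 (G : sgraph) (v : G) (H : sgraph)
    (G_secd : strongly_even_cycle_decomposable G)
    (v_nonisolated : ~ isolated v)
    (H_eulerian : eulerian H)
    (H_odd : odd #|H|)
    (H_or_deg : ~ isomorphic H (complete 3) \/ 4 <= deg v) :
  strongly_even_cycle_decomposable (substitution v H).
Proof.
apply: signed_strongly_decomposable; apply: substitution_signed => //.
exact: strongly_decomposable_signed.
Qed.
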